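(* There is a randomized algorithm that, given as input an undirected $n$-vertex graph $G=(V,E)$ of maximum degree $\Delta$ and an integer $k>3\Delta$, outputs a proper $k$-coloring of $G$ whose distribution is exactly the uniform distribution on the set of all proper $k$-colorings of $G$. The algorithm uses only independent fair coin tosses (each landing heads or tails with probability $1/2$) and terminates in expected time $O\big((n\log^2 n)\cdot(\Delta^2\log\Delta\log k)\big)$. In particular, $k_0(\Delta)\le 3\Delta$.
   Context: A proper $k$-coloring of $G$ is a map $\chi:V\to[k]=\{1,\dots,k\}$ with $\chi(u)\neq\chi(w)$ for every edge $\{u,w\}\in E$. For a function $\Delta\mapsto k_0(\Delta)$: $k_0(\Delta)$ is the minimum integer $k^*$ such that there is a randomized algorithm that, given any $n$-vertex graph of maximum degree $\Delta$ and any integer $k>k^*$, produces a proper $k$-coloring of the graph that is exactly uniformly distributed over all proper $k$-colorings, in expected time polynomial in $k$ and $n$. *)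

(* Defs.v *)
From mathcomp Require Import all_boot all_order all_algebra.
From mathcomp Require Import all_classical all_reals all_analysis.

Set Implicit Arguments.
Unset Strict Implicit.
Unset Printing Implicit Defensive.

Import Order.TTheory GRing.Theory Num.Theory.

Local Open Scope classical_set_scope.
Local Open Scope ring_scope.

(* A simple graph on n vertices is a symmetric irreflexive [e : rel 'I_n]; the
   colour set [k] = {1, ..., k} is represented by 'I_k, with colours numbered
   from 0. *)

Definition neighbours (n : nat) (e : rel 'I_n) (v : 'I_n) : {set 'I_n} :=
  [set u | e v u]%SET.

Definition max_degree (n : nat) (e : rel 'I_n) : nat :=
  (\max_(v < n) #|neighbours e v|)%N.

Definition proper_coloring (n k : nat) (e : rel 'I_n)
    (chi : {ffun 'I_n -> 'I_k}) : bool :=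
  [forall u, forall v, e u v ==> (chi u != chi v)].

Definition num_proper (n k : nat) (e : rel 'I_n) : nat :=
  #|[set chi : {ffun 'I_n -> 'I_k} | proper_coloring e chi]%SET|.

(* The model of computation is a randomized word RAM with structured control
   flow.  Programs are finite syntactic objects, independent of the input.  A
   machine with w-bit words has registers and a random-access memory, both
   indexed by nat. *)

Inductive operand : Type := Reg of nat | Cst of nat.

Inductive binop : Type := Add | Sub | Mul | Div | Lt | Eq.

Inductive cmd : Type :=
| Skip
| Op of binop & nat & operand & operand   (* Op o r a b : r := a o b *)
| Read of nat & operand                   (* Read r a   : r := mem[a] *)
| Write of operand & operand              (* Write a b  : mem[a] := b *)
| Toss of nat                             (* Toss r     : r := fair bit *)
| Seq of cmd & cmd
| If of operand & cmd & cmd               (* the test is: operand <> 0 *)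
| While of operand & cmd.

Record state : Type := State {
  todo : seq cmd;
  regs : nat -> nat;
  memory : nat -> nat }.

Definition eval_op (o : binop) (x y : nat) : nat :=
  match o with
  | Add => x + y
  | Sub => x - y
  | Mul => x * y
  | Div => x %/ y
  | Lt => x < y
  | Eq => x == y
  end%N.

Definition eval (w : nat) (s : state) (a : operand) : nat :=
  match a with Reg r => regs s r | Cst x => x %% 2 ^ w end%N.

(* One unit of time.  The bit [b] is consulted only when the instruction is
   Toss; all arithmetic is modulo 2 ^ w. *)
Definition step (w : nat) (b : bool) (s : state) : state :=
  match todo s with
  | [::] => s
  | Skip :: K => State K (regs s) (memory s)
  | Op o r x y :: K =>
      State K [eta regs s with
                 r |-> (eval_op o (eval w s x) (eval w s y) %% 2 ^ w)%N] (memory s)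
  | Read r a :: K => State K [eta regs s with r |-> memory s (eval w s a)] (memory s)
  | Write a x :: K => State K (regs s) [eta memory s with eval w s a |-> eval w s x]
  | Toss r :: K => State K [eta regs s with r |-> (b %% 2 ^ w)%N] (memory s)
  | Seq p q :: K => State [:: p, q & K] (regs s) (memory s)
  | If a p q :: K =>
      State ((if eval w s a != 0%N then p else q) :: K) (regs s) (memory s)
  | While a p :: K =>
      State (if eval w s a != 0%N then [:: p, While a p & K] else K)
            (regs s) (memory s)
  end.

(* Each time step has its own coin, so no coin is ever used twice. *)
Fixpoint run (w : nat) (bits : nat -> bool) (s : state) (t : nat) : state :=
  match t with
  | 0%N => s
  | t'.+1 => step w (bits t') (run w bits s t')
  end.

Definition halted (s : state) : bool := nilp (todo s).

(* The initial memory holds n, k, then n + 1 pointers, then the concatenated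
   adjacency lists: the list of v occupies the addresses from the v-th pointer
   (included) to the (v+1)-st (excluded).  The rest of the memory is zero. *)
Definition encode (n : nat) (e : rel 'I_n) (k : nat) : seq nat :=
  let nbrs := [seq [seq val u | u <- enum (neighbours e v)] | v <- enum 'I_n] in
  [:: n; k]
    ++ [seq (n + 3 + sumn (take i (shape nbrs)))%N | i <- iota 0 n.+1]
    ++ flatten nbrs.

Definition init (prog : cmd) (n : nat) (e : rel 'I_n) (k : nat) : state :=
  State [:: prog] (fun=> 0%N) (nth 0%N (encode e k)).

(* On halting, the colour of vertex v is in memory cell v. *)
Definition outputs (prog : cmd) (w n : nat) (e : rel 'I_n) (k : nat)
    (bits : nat -> bool) (chi : {ffun 'I_n -> 'I_k}) : Prop :=
  exists t, let s := run w bits (init prog e k) t in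
    halted s /\ forall v : 'I_n, memory s v = chi v :> nat.

(* +oo when the program does not halt *)
Definition runtime (R : realType) (prog : cmd) (w n : nat) (e : rel 'I_n)
    (k : nat) (bits : nat -> bool) : \bar R :=
  ereal_inf [set (t%:R%:E : \bar R) |
             t in [set t | halted (run w bits (init prog e k) t)]].

Definition mutually_independent (R : realType) (d d' : measure_display)
    (Omega : measurableType d) (T : measurableType d')
    (P : probability Omega R) (X : nat -> {RV P >-> T}) : Prop :=
  forall (J : seq nat) (B : nat -> set T), uniq J ->
    (forall i, measurable (B i)) ->
    P (\bigcap_(i in [set` J]) (X i @^-1` B i)) =
    (\prod_(i <- J) P (X i @^-1` B i))%E.

Definition fair_coins (R : realType) (d : measure_display)
    (Omega : measurableType d) (P : probability Omega R)
    (coin : nat -> {RV P >-> bool}) : Prop :=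
  (forall i, distribution P (coin i) =1 bernoulli_prob 2^-1) /\
  mutually_independent coin.

(* The first conjunct makes the set of proper colourings nonempty. *)
Definition samples_uniformly (R : realType) (d : measure_display)
    (Omega : measurableType d) (P : probability Omega R)
    (coin : nat -> {RV P >-> bool})
    (prog : cmd) (w n : nat) (e : rel 'I_n) (k : nat) : Prop :=
  P [set x | exists2 chi : {ffun 'I_n -> 'I_k},
       proper_coloring e chi & outputs prog w e (fun t => coin t x) chi] = 1%E /\
  forall chi : {ffun 'I_n -> 'I_k}, proper_coloring e chi ->
    P [set x | outputs prog w e (fun t => coin t x) chi] =
    ((num_proper k e)%:R^-1)%:E.

Definition expected_time (R : realType) (d : measure_display)
    (Omega : measurableType d) (P : probability Omega R)
    (coin : nat -> {RV P >-> bool})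
    (prog : cmd) (w n : nat) (e : rel 'I_n) (k : nat) : \bar R :=
  (\int[P]_x runtime R prog w e k (fun t => coin t x))%E.

(* Words have at least c * log2 (n + k + 2) bits; the exponent c depends on the
   program only. *)
Definition enough_bits (c n k w : nat) : Prop :=
  ((n + k + 2) ^ c <= 2 ^ w)%N.

(* [prog] samples exactly uniformly, within expected time [bound], on all
   inputs in [dom] and whatever the source of fair coins. *)
Definition perfect_sampler (prog : cmd) (c : nat)
    (dom : forall n : nat, rel 'I_n -> nat -> Prop)
    (bound : forall (R : realType) (n : nat), rel 'I_n -> nat -> R) : Prop :=
  forall (n : nat) (e : rel 'I_n) (k w : nat),
    symmetric e -> irreflexive e -> dom n e k -> enough_bits c n k w ->
  forall (R : realType) (d : measure_display) (Omega : measurableType d)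
    (P : probability Omega R) (coin : nat -> {RV P >-> bool}),
    fair_coins coin ->
    samples_uniformly coin prog w e k /\
    (expected_time coin prog w e k <= (bound R n e k)%:E)%E.

(* (n log^2 n) (Delta^2 log Delta log k).  The factors n and Delta are replaced
   by 1 when they are 0, and the arguments of the logarithms by 2 when they are
   smaller; nothing changes when n, Delta, k >= 2. *)
Definition lg (R : realType) (m : nat) : R := ln (maxn m 2)%:R.

Definition time_bound (R : realType) (n Delta k : nat) : R :=
  ((maxn n 1)%:R * lg R n ^+ 2) *
  ((maxn Delta 1)%:R ^+ 2 * lg R Delta * lg R k).

(* Perfect sampling is possible in expected polynomial time for graphs of
   maximum degree Delta and k > kstar. *)
Definition poly_sampleable (Delta kstar : nat) : Prop :=
  exists (prog : cmd) (c C a : nat),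
    perfect_sampler prog c
      (fun n e k => max_degree e = Delta /\ (kstar < k)%N)
      (fun R n e k => (C * (n + k + 1) ^ a)%:R).

(* k0 = k_0(Delta) *)
Definition is_k0 (Delta k0 : nat) : Prop :=
  poly_sampleable Delta k0 /\
  forall k', poly_sampleable Delta k' -> (k0 <= k')%N.

(* Main.v *)
Require Import Defs.
From mathcomp Require Import all_boot all_order all_algebra.
From mathcomp Require Import all_classical all_reals all_analysis.
From mathcomp Require Import ring lra zify.

(* The heat-bath update of a vertex is simulated for all colourings at once by
   bounding lists (Huber; Bhandari and Chakraborty).  Suppose that the colours
   of the neighbours of [v] lie in a list S, of size at most 2D < k.  The new
   colour of [v] is then either a colour c drawn outside S, or the j-th element
   of S for a random j drawn beforehand, so that it is known up to two values
   whatever the colouring ([contract]); it is known exactly when j is out of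
   range or hits a surely blocked colour.  A list S of size at most 2D is
   available when the neighbours are already known up to two values; during the
   first sweep the other neighbours are updated first, so as to confine each of
   them to S plus a single new colour ([compress]).  In later sweeps the mean
   number of undetermined vertices decays geometrically, so that after
   (2D+1)(log n+1) sweeps -- a block -- all colourings have coalesced with
   probability at least 1/2.

   The output is obtained by Wilson's read-once coupling from the past: blocks
   are run one after the other, and the colouring that precedes the second
   coalescing block is returned, the first one serving to forget the initial
   colouring.

   The analysis needs upper bounds only.  For a program and a reward on its
   final states, [value] is the mean reward plus [lam] times the mean running
   time.  With [lam = 1] and no reward it bounds the running time; with
   [lam = 0] it bounds the probability of each output by the inverse of the
   number of colourings.  Since the program halts almost surely, these bounds
   are equalities. *)

Set Implicit Arguments.
Unset Strict Implicit.
Unset Printing Implicit Defensive.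

Import Order.TTheory GRing.Theory Num.Theory.

Local Open Scope ring_scope.

(** * Finite random experiments *)

(** The condition k > 3D is used twice: a list of up to 2D colours must fit into the k - D values of
    j, so that each listed colour is proposed with the same weight, and a later sweep multiplies the
    bound on the probability that a vertex is undetermined by 2D/(k - D) < 1. As k - D >= 2D + 1, 2D
    + 1 sweeps halve it; hence the length of a block.

    No random map on colourings is ever formed. One colouring is carried along with its bounds, and
    three facts replace a coupling of all starts: the colouring alone moves by heat bath, the bounds
    alone move by a law that ignores the colouring, and the colouring stays within the bounds.

    Rejection and coalescence loops have no a priori length, so every estimate concerns runs cut at
    time t. Inequalities pass through the induction on t, whereas the exact output law would only
    appear in the limit.

    A first-sweep update costs about D^2 log k steps, a later one D log k, and there are about D log
    n later sweeps: a block takes about n D^2 log n log k steps. The further logarithms of the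
    claimed time are slack. *)

(* [Draw l f] draws an entry of [l] uniformly and continues with [f]; drawing
   from an empty list has total mass 0. *)
Inductive dist (T : Type) : Type :=
| Ret of T
| Draw (U : eqType) of seq U & (U -> dist T).

Arguments Ret {T} _.
Arguments Draw {T U} _ _.

Section Distributions.
Variable T : Type.

Fixpoint bind (T' : Type) (d : dist T) (f : T -> dist T') : dist T' :=
  match d with
  | Ret y => f y
  | Draw U l h => Draw l (fun u => bind (h u) f)
  end.

Fixpoint supp (d : dist T) (Q : T -> Prop) : Prop :=
  match d with
  | Ret y => Q y
  | Draw U l f => forall u, u \in l -> supp (f u) Q
  end.

(** Rules out empty draws, but only along outcomes that can occur: an empty draw in an unreachable
    branch does no harm. *)
Fixpoint lossless (d : dist T) : Prop :=
  match d with
  | Ret y => True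
  | Draw U l f => l != [::] /\ forall u, u \in l -> lossless (f u)
  end.

Fixpoint foldM (I : Type) (f : I -> T -> dist T) (l : seq I) (y : T) : dist T :=
  if l is i :: l' then bind (f i y) (foldM f l') else Ret y.

Lemma supp_sub (d : dist T) (Q Q' : T -> Prop) :
  (forall y, Q y -> Q' y) -> supp d Q -> supp d Q'.
Proof. by move=> QQ'; elim: d => [y|U l f IH] /=; auto. Qed.

Lemma supp_all (d : dist T) (Q : T -> Prop) : (forall y, Q y) -> supp d Q.
Proof. by move=> h; elim: d => [y|U l f IH] /=. Qed.

Variable R : realType.

Fixpoint expect (d : dist T) (g : T -> R) : R :=
  match d with
  | Ret y => g y
  | Draw U l f => (\sum_(u <- l) expect (f u) g) / (size l)%:R
  end.

Lemma expect_le (d : dist T) (g g' : T -> R) :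
  supp d (fun y => g y <= g' y) -> expect d g <= expect d g'.
Proof.
elim: d => [y|U l f IH] //= h.
rewrite ler_wpM2r ?invr_ge0 ?ler0n // big_seq [leRHS]big_seq.
by apply: ler_sum => u ul; apply: IH; exact: h.
Qed.

Lemma eq_expect_supp (d : dist T) (g g' : T -> R) :
  supp d (fun y => g y = g' y) -> expect d g = expect d g'.
Proof.
move=> h; apply/eqP; rewrite eq_le !expect_le //.
  by apply: supp_sub h => y ->.
by apply: supp_sub h => y ->.
Qed.

Lemma eq_expect (d : dist T) (g g' : T -> R) :
  g =1 g' -> expect d g = expect d g'.
Proof. by move=> h; apply: eq_expect_supp; exact: supp_all. Qed.

Lemma expect_ge0 (d : dist T) (g : T -> R) :
  (forall y, 0 <= g y) -> 0 <= expect d g.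
Proof.
move=> g0; elim: d => [y|U l f IH] //=.
by rewrite divr_ge0 // sumr_ge0.
Qed.

Lemma expectD (d : dist T) (g g' : T -> R) :
  expect d (fun y => g y + g' y) = expect d g + expect d g'.
Proof.
elim: d => [y|U l f IH] //=.
by rewrite -mulrDl -big_split /=; under eq_bigr do rewrite IH.
Qed.

Lemma expectZ (d : dist T) (c : R) (g : T -> R) :
  expect d (fun y => c * g y) = c * expect d g.
Proof.
elim: d => [y|U l f IH] //=.
by under eq_bigr do rewrite IH; rewrite -mulr_sumr mulrA.
Qed.

Lemma expect_sum (I : Type) (s : seq I) (d : dist T) (g : I -> T -> R) :
  expect d (fun y => \sum_(i <- s) g i y) = \sum_(i <- s) expect d (g i).
Proof.
elim: s => [|i s IH].
  rewrite big_nil; under eq_expect do rewrite big_nil.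
  by rewrite -[RHS](mul0r (expect d (fun=> 0))) -expectZ; apply: eq_expect => y; rewrite mul0r.
by rewrite big_cons -IH -expectD; apply: eq_expect => y; rewrite big_cons.
Qed.

Lemma size_neq0 (U : eqType) (l : seq U) : l != [::] -> (size l)%:R != 0 :> R.
Proof. by rewrite pnatr_eq0 size_eq0. Qed.

Lemma expect_cst (d : dist T) (c : R) : lossless d -> expect d (fun=> c) = c.
Proof.
elim: d => [y|U l f IH] //= [l0 tf].
rewrite (eq_big_seq (fun=> c)) => [|u ul]; last by rewrite IH //; exact: tf.
by rewrite big_const_seq count_predT iter_addr_0 -[c *+ _]mulr_natr mulfK // size_neq0.
Qed.

(** If the observable is settled by the first draw, all later draws integrate out. This is how the
    bounds are freed from the draws that look at the colouring. *)
Lemma expect_draw (U : eqType) (l : seq U) (f : U -> dist T) (g : T -> R)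
    (h : U -> R) :
  lossless (Draw l f) -> (forall u, u \in l -> supp (f u) (fun y => g y = h u)) ->
  expect (Draw l f) g = (\sum_(u <- l) h u) / (size l)%:R.
Proof.
move=> [l0 tf] gh /=; congr (_ / _); apply: eq_big_seq => u ul.
by rewrite (eq_expect_supp (gh u ul)) expect_cst //; exact: tf.
Qed.

End Distributions.

Section Bind.
Variables (T T' : Type) (R : realType).

Lemma expect_bind (d : dist T) (f : T -> dist T') (g : T' -> R) :
  expect (bind d f) g = expect d (fun y => expect (f y) g).
Proof. by elim: d => [y|U l h IH] //=; under eq_bigr do rewrite IH. Qed.

Lemma supp_bind (d : dist T) (f : T -> dist T') (Q : T' -> Prop) :
  supp d (fun y => supp (f y) Q) -> supp (bind d f) Q.
Proof. by elim: d => [y|U l h IH] //= H u ul; apply: IH; exact: H. Qed.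

Lemma lossless_bind (d : dist T) (f : T -> dist T') :
  lossless d -> supp d (fun y => lossless (f y)) -> lossless (bind d f).
Proof.
elim: d => [y|U l h IH] //= [l0 tl] H; split=> // u ul.
by apply: IH; [exact: tl|exact: H].
Qed.

End Bind.

Section FoldM.
Variables (T I : Type) (R : realType).

Lemma foldM_cat (f : I -> T -> dist T) l1 l2 y (g : T -> R) :
  expect (foldM f (l1 ++ l2) y) g =
  expect (foldM f l1 y) (fun y' => expect (foldM f l2 y') g).
Proof.
elim: l1 y => [|i l1 IH] y //=.
by rewrite !expect_bind; apply: eq_expect => y'; rewrite IH.
Qed.

End FoldM.

(** * Bounding lists *)

Section Chain.
Variables (n k : nat) (e : rel 'I_n).

Local Notation coloring := {ffun 'I_n -> 'I_k}.
Local Notation bounds := {ffun 'I_n -> 'I_k * 'I_k}.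
Local Notation D := (max_degree e).

Definition nbrs (v : 'I_n) : seq 'I_n := enum (neighbours e v).

Definition nbr_colors (x : coloring) (v : 'I_n) : seq 'I_k :=
  [seq x u | u <- nbrs v].

Definition outside (S : seq 'I_k) : seq 'I_k :=
  [seq c <- enum 'I_k | c \notin S].

Definition recolor (T : Type) (x : {ffun 'I_n -> T}) (v : 'I_n) (c : T) :
  {ffun 'I_n -> T} := [ffun u => if u == v then c else x u].

Definition add_color (S : seq 'I_k) (c : 'I_k) : seq 'I_k :=
  if c \in S then S else rcons S c.

Definition gather (L : bounds) (lim : nat) (v : 'I_n) : seq 'I_k :=
  foldl (fun S (u : 'I_n) =>
    if (u < lim)%N then add_color (add_color S (L u).1) (L u).2 else S)
    [::] (nbrs v).

(** The surely blocked colours: a trusted neighbour whose two bounds agree has that colour in every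
    colouring compatible with the bounds. *)
Definition certain (L : bounds) (lim : nat) (v : 'I_n) : seq 'I_k :=
  [seq (L u).1 | u : 'I_n <- nbrs v & (u < lim)%N && ((L u).1 == (L u).2)].

(** Padding is for the sake of [compress], which is a heat-bath step only when the list is at least
    as long as the set of blocked colours. Trying the first D colours is enough, since [ft] is at
    most D. *)
Definition fill (ft : nat) (S : seq 'I_k) : seq 'I_k :=
  foldl (fun S c => if (size S < ft)%N then add_color S c else S)
    S (take D (enum 'I_k)).

(* Heat-bath update of [w] whose new colour is known to lie in [S] plus one
   colour that does not depend on the colouring. *)
Definition compress (w : 'I_n) (p : coloring * seq 'I_k) :
    dist (coloring * seq 'I_k) :=
  let N := nbr_colors p.1 w in
  Draw (outside p.2) (fun c => Draw (iota 0 (k - #|N|)) (fun a =>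
    if (c \notin N) && (a < k - size p.2)%N
    then Ret (recolor p.1 w c, rcons p.2 c)
    else Draw [seq s <- p.2 | s \notin N]
           (fun s => Ret (recolor p.1 w s, rcons p.2 c)))).

Definition compress_late (lim : nat) (w : 'I_n) (p : coloring * seq 'I_k) :
    dist (coloring * seq 'I_k) :=
  if (w < lim)%N then Ret p else compress w p.

(* Heat-bath update of [v], all of whose neighbours have their colours in [S]:
   the new colour is one of two colours that do not depend on the colouring,
   and even one of one colour when the second is surely blocked. *)
Definition contract (v : 'I_n) (C S : seq 'I_k) (p : coloring * bounds) :
    dist (coloring * bounds) :=
  let N := nbr_colors p.1 v in
  Draw (outside S) (fun c => Draw (iota 0 (k - D)) (fun j =>
  Draw (iota 0 (k - #|N|)) (fun a =>
    let c' := nth c S j in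
    Ret (recolor p.1 v
           (if [&& (j < size S)%N, c' \notin N & (a < k - D)%N] then c' else c),
         recolor p.2 v
           (c, if (j < size S)%N && (c' \notin C) then c' else c))))).

(* An item ((lim, ft), v) asks for an update of [v] that trusts the bounds of
   the vertices below [lim] only, and pads the list of colours to size [ft]. *)
Definition item : Type := ((nat * nat) * 'I_n)%type.

Definition start (it : item) (L : bounds) : seq 'I_k :=
  fill it.1.2 (gather L it.1.1 it.2).

Definition process (it : item) (p : coloring * bounds) :
    dist (coloring * bounds) :=
  bind (foldM (compress_late it.1.1) (nbrs it.2) (p.1, start it p.2))
       (fun q => contract it.2 (certain p.2 it.1.1 it.2) q.2 (q.1, p.2)).

(** From here on, the L versions are the same updates seen from the bounds alone: the colouring and
    the draws that only affect it are dropped. *)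
Definition compress_lateL (lim : nat) (w : 'I_n) (S : seq 'I_k) :
    dist (seq 'I_k) :=
  if (w < lim)%N then Ret S else Draw (outside S) (fun c => Ret (rcons S c)).

Definition contractL (v : 'I_n) (C S : seq 'I_k) (L : bounds) : dist bounds :=
  Draw (outside S) (fun c => Draw (iota 0 (k - D)) (fun j =>
    let c' := nth c S j in
    Ret (recolor L v (c, if (j < size S)%N && (c' \notin C) then c' else c)))).

Definition processL (it : item) (L : bounds) : dist bounds :=
  bind (foldM (compress_lateL it.1.1) (nbrs it.2) (start it L))
       (fun S => contractL it.2 (certain L it.1.1 it.2) S L).

Lemma size_nbrs v : (size (nbrs v) <= D)%N.
Proof. by rewrite -cardE /max_degree; exact: leq_bigmax. Qed.

Lemma card_nbr_colors x v : (#|nbr_colors x v| <= D)%N.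
Proof.
by apply: leq_trans (card_size _) _; rewrite size_map size_nbrs.
Qed.

Lemma size_outside S : size (outside S) = (k - #|S|)%N.
Proof.
have h : (#|S| + size (outside S) = k)%N.
  rewrite -[RHS]card_ord -(cardC (mem S)); congr (_ + _)%N.
  by rewrite [RHS]cardE /outside enumT.
by move: h; clear; lia.
Qed.

Lemma size_outside_uniq (S : seq 'I_k) : uniq S -> size (outside S) = (k - size S)%N.
Proof. by move=> /card_uniqP uS; rewrite size_outside uS. Qed.

Lemma mem_outside S c : (c \in outside S) = (c \notin S).
Proof. by rewrite mem_filter mem_enum andbT. Qed.

Lemma outside_neq0 (S : seq 'I_k) : uniq S -> (size S < k)%N -> outside S != [::].
Proof. by move=> uS lt_S; rewrite -size_eq0 size_outside_uniq // subn_eq0 -ltnNge. Qed.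

Lemma recolorE T (x : {ffun 'I_n -> T}) v c u :
  recolor x v c u = if u == v then c else x u.
Proof. by rewrite ffunE. Qed.

(** * Both updates are heat-bath steps, and heat bath preserves the uniform law *)

Section Sums.
Variable R : realType.

Lemma sum_outside S (f : 'I_k -> R) :
  \sum_(c <- outside S) f c = \sum_(c | c \notin S) f c.
Proof. by rewrite big_filter big_enum_cond. Qed.

Lemma sum_uniq S (P : pred 'I_k) (f : 'I_k -> R) : uniq S ->
  \sum_(c <- [seq c <- S | P c]) f c = \sum_(c | (c \in S) && P c) f c.
Proof.
move=> uS; rewrite big_uniq ?filter_uniq //.
by apply: eq_bigl => c; rewrite mem_filter andbC.
Qed.

(** The test [a < p] on a uniform [a] simulates a coin of bias p/m. Writing the mean as a correction
    of the default [v] lets the corrections of the various colours add up. *)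
Lemma average_lt m p (u v : R) : (0 < m)%N -> (p <= m)%N ->
  (\sum_(a <- iota 0 m) (if (a < p)%N then u else v)) / m%:R =
  v + p%:R / m%:R * (u - v).
Proof.
move=> m0 le_pm; have m0' : m%:R != 0 :> R by rewrite pnatr_eq0 -lt0n.
have -> : \sum_(a <- iota 0 m) (if (a < p)%N then u else v) = p%:R * u + (m - p)%:R * v.
  rewrite -(subnKC le_pm) iotaD big_cat /= add0n addKn; congr (_ + _).
    rewrite big_seq (eq_bigr (fun=> u)) => [|a]; last by rewrite mem_iota => /andP[_ ->].
    by rewrite -big_seq big_const_seq count_predT iter_addr_0 size_iota mulr_natl.
  rewrite big_seq (eq_bigr (fun=> v)) => [|a]; last by rewrite mem_iota => /andP[h _]; rewrite ltnNge h.
  by rewrite -big_seq big_const_seq count_predT iter_addr_0 size_iota mulr_natl.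
by rewrite natrB //; field.
Qed.


Definition heat_bath (w : 'I_n) (f : coloring -> R) (x : coloring) : R :=
  (\sum_(c | c \notin nbr_colors x w) f (recolor x w c)) /
  (k - #|nbr_colors x w|)%:R.

(** A free colour outside S is proposed with probability 1/(k - |S|) and kept with probability (k -
    |S|)/(k - |N|), a number at most 1 because |N| <= |S|; the product is the heat-bath weight. The
    remaining mass is spread evenly over the free members of S, so these also get equal weights,
    necessarily the right ones. *)
Lemma compress_heat_bath w x (S : seq 'I_k) (f : coloring -> R) :
  uniq S -> (#|nbr_colors x w| <= size S)%N -> (size S < k)%N ->
  expect (compress w (x, S)) (fun q => f q.1) = heat_bath w f x.
Proof.
move=> uS le_N lt_S; rewrite /compress /heat_bath /=.
set N := nbr_colors x w in le_N *.
(* The mean over the free members of S. When there are none it is 0 by the convention on division,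
   in agreement with an empty draw. *)
pose A := (\sum_(s <- [seq s <- S | s \notin N]) f (recolor x w s)) /
          (size [seq s <- S | s \notin N])%:R.
pose m : R := (k - #|N|)%:R.
have m_gt0 : (0 < k - #|N|)%N by rewrite subn_gt0 (leq_ltn_trans le_N).
have m0 : m != 0 by rewrite /m pnatr_eq0 -lt0n.
have s0 : (k - size S)%:R != 0 :> R by rewrite pnatr_eq0 -lt0n subn_gt0.
under eq_bigr => c _.
  rewrite (eq_bigr (fun a => if (a < if c \notin N then k - size S else 0)%N
                             then f (recolor x w c) else A)); last first.
    move=> a _; case: (c \notin N) => //=.
    by case: ifP.
  rewrite size_iota average_lt //; last by case: ifP => // _; rewrite leq_sub2l.
  over.
rewrite size_outside_uniq // sum_outside big_split /=.
have -> : \sum_(c | c \notin S) (if c \notin N then k - size S else 0)%N%:R / (k - #|N|)%:R *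
    (f (recolor x w c) - A) =
  (k - size S)%:R / m * (\sum_(c | (c \notin S) && (c \notin N)) f (recolor x w c) -
     \sum_(c | (c \notin S) && (c \notin N)) A).
  rewrite -sumrB mulr_sumr [RHS]big_mkcondr /=; apply: eq_bigr => c _.
  by case: ifP => // _; rewrite !mul0r.
have AE : \sum_(c | (c \in S) && (c \notin N)) f (recolor x w c) =
          \sum_(c | (c \in S) && (c \notin N)) A.
  rewrite -!sum_uniq // big_const_seq count_predT iter_addr_0 -mulr_natr /A.
  case: (eqVneq [seq s <- S | s \notin N] [::]) => [->|ne]; first by rewrite big_nil mulr0.
  by rewrite divfK // size_neq0.
have splitN (g : 'I_k -> R) : \sum_(c | c \notin N) g c =
    \sum_(c | (c \in S) && (c \notin N)) g c +
    \sum_(c | (c \notin S) && (c \notin N)) g c.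
  rewrite (bigID (mem S)) /=; congr (_ + _); by apply: eq_bigl => c; rewrite andbC.
have cstS : \sum_(c | c \notin S) A = (k - size S)%:R * A.
  rewrite -sum_outside big_const_seq count_predT iter_addr_0 size_outside_uniq //.
  by rewrite mulr_natl.
have cstN : \sum_(c | c \notin N) A = m * A.
  rewrite -sum_outside big_const_seq count_predT iter_addr_0 size_outside.
  by rewrite mulr_natl.
rewrite cstS; move: cstN; rewrite !splitN -AE.
set X := \sum_(c | _) _; set Y := \sum_(c | _) A; set Z := \sum_(c | _) f _.
move=> cstN; have -> : Y = m * A - X by rewrite -cstN addrC addKr.
by field; rewrite m0 s0.
Qed.

(** The index j has k - D possible values, in general more than S has entries; the surplus values
    contribute no correction. *)
Lemma sum_prefix (S : seq 'I_k) m (c : 'I_k) (h : 'I_k -> R) :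
  (size S <= m)%N ->
  \sum_(j <- iota 0 m) (if (j < size S)%N then h (nth c S j) else 0) =
  \sum_(s <- S) h s.
Proof.
move=> le_m; rewrite (big_nth c).
rewrite (_ : iota 0 m = index_iota 0 m); last by rewrite /index_iota subn0.
rewrite (big_nat_widen 0 (size S) m) // [RHS]big_mkcond /=.
by apply: eq_bigr => j _.
Qed.

(** A free member of S is hit by j with probability 1/(k - D) and accepted with probability (k -
    D)/(k - |N|). Everything else falls back on c, which is uniform outside S and always free
    because S contains N. The hypothesis |S| + D <= k makes every member of S reachable by j. *)
Lemma contract_heat_bath v C x L (S : seq 'I_k) (f : coloring -> R) :
  uniq S -> {subset nbr_colors x v <= S} -> (size S + D <= k)%N -> (D < k)%N ->
  (size S < k)%N ->
  expect (contract v C S (x, L)) (fun q => f q.1) = heat_bath v f x.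
Proof.
move=> uS sub_N le_S lt_D lt_S; rewrite /contract /heat_bath /=.
have le_N := card_nbr_colors x v.
set N := nbr_colors x v in sub_N le_N *.
have m_gt0 : (0 < k - #|N|)%N by rewrite subn_gt0 (leq_ltn_trans le_N).
pose m : R := (k - #|N|)%:R.
have m0 : m != 0 by rewrite /m pnatr_eq0 -lt0n.
have s0 : (k - size S)%:R != 0 :> R by rewrite pnatr_eq0 -lt0n subn_gt0.
have d_gt0 : (0 < k - D)%N by rewrite subn_gt0.
have d0 : (k - D)%:R != 0 :> R by rewrite pnatr_eq0 -lt0n.
pose h c s : R := if s \notin N then
  (k - D)%:R / m * (f (recolor x v s) - f (recolor x v c)) else 0.
under eq_bigr => c _.
  under eq_bigr => j _.
    rewrite (eq_bigr (fun a => if (a < if (j < size S) && (nth c S j \notin N) then k - D else 0)%N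
      then f (recolor x v (nth c S j)) else f (recolor x v c))); last first.
      move=> a _; case: (j < size S)%N => //=.
      by case: (nth c S j \in N) => //=; case: (a < k - D)%N.
    rewrite size_iota average_lt //; last by case: ifP => // _; rewrite leq_sub2l.
    over.
  rewrite big_split /= big_const_seq count_predT iter_addr_0 size_iota -[f _ *+ _]mulr_natr.
  rewrite (eq_bigr (fun j => if (j < size S)%N then h c (nth c S j) else 0)); last first.
    move=> j _; rewrite /h; case: (j < size S)%N => /=; last by rewrite !mul0r.
    by case: ifP => // _; rewrite !mul0r.
  rewrite sum_prefix; last by rewrite leq_subRL // 1?addnC // ltnW.
  rewrite /h -big_mkcond -big_filter /= -mulr_sumr sumrB.
  over.
have splitN (g : 'I_k -> R) : \sum_(c | c \notin N) g c =
    \sum_(s <- [seq s <- S | s \notin N]) g s + \sum_(c | c \notin S) g c.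
  rewrite (bigID (mem S)) /= sum_uniq //; congr (_ + _).
    by apply: eq_bigl => c; rewrite andbC.
  apply: eq_bigl => c.
  by case: (boolP (c \in S)) => cS; rewrite ?andbF // andbT; apply: contra cS; exact: sub_N.
(* The free members of S are counted by comparing the complements of N and of S, as N lies in S. *)
have cN : (\sum_(s <- [seq s <- S | s \notin N]) (1 : R)) = m - (k - size S)%:R.
  have e1 : \sum_(c | c \notin N) (1 : R) = m.
    rewrite -sum_outside big_const_seq count_predT iter_addr_0 size_outside //.
  have e2 : \sum_(c | c \notin S) (1 : R) = (k - size S)%:R.
    by rewrite -sum_outside big_const_seq count_predT iter_addr_0 size_outside_uniq.
  by rewrite -e1 -e2 splitN addrK.
have cst c : \sum_(s <- [seq s <- S | s \notin N]) f (recolor x v c) =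
    (m - (k - size S)%:R) * f (recolor x v c).
  by rewrite -cN mulr_suml; apply: eq_bigr => s _; rewrite mul1r.
under eq_bigr => c _ do rewrite cst.
rewrite size_outside_uniq // sum_outside.
pose X := \sum_(s <- [seq s <- S | s \notin N]) f (recolor x v s).
rewrite (eq_bigr (fun c => X / m + (k - size S)%:R / m * f (recolor x v c))); last first.
  by move=> c _; rewrite -/X -/m; field; rewrite m0 d0.
have cstS (y : R) : \sum_(c | c \notin S) y = (k - size S)%:R * y.
  rewrite -sum_outside big_const_seq count_predT iter_addr_0 size_outside_uniq //.
  by rewrite mulr_natl.
rewrite big_split /= cstS -mulr_sumr.
rewrite splitN -/X -/m; by field; rewrite m0 s0.
Qed.

Section Stationary.
Hypotheses (sym_e : symmetric e) (irr_e : irreflexive e) (lt_D : (D < k)%N).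

Lemma mem_nbrs v u : (u \in nbrs v) = e v u.
Proof. by rewrite mem_enum inE. Qed.

Lemma nbr_colors_recolor x w c : nbr_colors (recolor x w c) w = nbr_colors x w.
Proof.
apply/eq_in_map => u; rewrite mem_nbrs recolorE => ewu.
by case: eqP ewu => // ->; rewrite irr_e.
Qed.

Lemma proper_nbr_colors x w : proper_coloring e x -> x w \notin nbr_colors x w.
Proof.
move=> /forallP/(_ w)/forallP h; apply/mapP => -[u]; rewrite mem_nbrs => ewu xE.
by have := implyP (h u) ewu; rewrite xE eqxx.
Qed.

Lemma proper_recolor x w c :
  proper_coloring e x -> c \notin nbr_colors x w -> proper_coloring e (recolor x w c).
Proof.
move=> /forallP px cN; apply/forallP => u; apply/forallP => v; apply/implyP => euv.
rewrite !recolorE; case: (eqVneq u w) => [uw|_]; case: (eqVneq v w) => [vw|_].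
- by move: euv; rewrite uw vw irr_e.
- apply: contra cN => /eqP ->; apply/mapP; exists v => //.
  by rewrite mem_nbrs -uw.
- rewrite eq_sym; apply: contra cN => /eqP ->; apply/mapP; exists u => //.
  by rewrite mem_nbrs sym_e -vw.
- by have := forallP (px u) v; rewrite euv.
Qed.

(** Reversibility: exchanging the old and the new colour of w is an involution on the pairs of a
    proper colouring and a free colour. It keeps the weight, since w is not its own neighbour and
    the blocked set is unchanged. *)
Lemma heat_bath_stationary w (f : coloring -> R) :
  \sum_(x | proper_coloring e x) heat_bath w f x =
  \sum_(x | proper_coloring e x) f x.
Proof.
pose h (p : coloring * 'I_k) := (recolor p.1 w p.2, p.1 w).
have hK : involutive h.
  move=> [x c]; rewrite /h /=; congr (_, _); last by rewrite recolorE eqxx.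
  by apply/ffunP => u; rewrite !recolorE; case: eqP => [->|].
transitivity (\sum_(p | proper_coloring e p.1 && (p.2 \notin nbr_colors p.1 w))
    f p.1 / (k - #|nbr_colors p.1 w|)%:R).
  rewrite (reindex_inj (inv_inj hK)) /=.
  rewrite /heat_bath; under eq_bigr do rewrite mulr_suml.
  rewrite pair_big_dep /=; apply: eq_big => [[x c]|[x c] _] /=.
    rewrite nbr_colors_recolor; apply/idP/idP => /andP[px cN].
      by rewrite proper_recolor // proper_nbr_colors.
    have -> : x = recolor (recolor x w c) w (x w).
      by apply/ffunP => u; rewrite !recolorE; case: eqP => [->|].
    rewrite proper_recolor ?nbr_colors_recolor //=.
    by have := proper_nbr_colors w px; rewrite nbr_colors_recolor recolorE eqxx.
  by rewrite nbr_colors_recolor.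
rewrite -(pair_big_dep (fun x => proper_coloring e x) (fun x c => c \notin nbr_colors x w)
  (fun x c => f x / (k - #|nbr_colors x w|)%:R)) /=.
apply: eq_bigr => x _.
rewrite -sum_outside big_const_seq count_predT iter_addr_0 size_outside.
rewrite -[(_ / _) *+ _]mulr_natr divfK // pnatr_eq0 -lt0n subn_gt0.
exact: leq_ltn_trans (card_nbr_colors _ _) lt_D.
Qed.

End Stationary.

End Sums.
End Chain.

(** * Invariants of a single update with bounding lists *)

Section Block.
Variables (n k : nat) (e : rel 'I_n).

Local Notation coloring := {ffun 'I_n -> 'I_k}.
Local Notation bounds := {ffun 'I_n -> 'I_k * 'I_k}.
Local Notation D := (max_degree e).

Hypotheses (sym_e : symmetric e) (irr_e : irreflexive e) (lt_D : (3 * D < k)%N).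

Lemma mem_add_color (S : seq 'I_k) c d :
  (d \in add_color S c) = (d == c) || (d \in S).
Proof.
rewrite /add_color; case: ifP => cS; last by rewrite mem_rcons inE.
by case: eqP => [->|].
Qed.

Lemma uniq_add_color (S : seq 'I_k) c : uniq S -> uniq (add_color S c).
Proof. by rewrite /add_color; case: ifP => // cS uS; rewrite rcons_uniq cS. Qed.

Lemma size_add_color (S : seq 'I_k) c :
  (size S <= size (add_color S c) <= (size S).+1)%N.
Proof. by rewrite /add_color; case: ifP => _; rewrite ?size_rcons; lia. Qed.

Definition late (lim : nat) (u : 'I_n) : bool := ~~ (u < lim)%N.

Lemma gatherP (L : bounds) lim v :
  [/\ uniq (gather e L lim v),
      (size (gather e L lim v) <= 2 * count (fun u : 'I_n => u < lim) (nbrs e v))%N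
    & forall u, u \in nbrs e v -> (u < lim)%N ->
      (L u).1 \in gather e L lim v /\ (L u).2 \in gather e L lim v].
Proof.
rewrite /gather; set f := fun _ _ => _.
have mono (S : seq 'I_k) l c : c \in S -> c \in foldl f S l.
  elim: l S => [//|u l IH] S cS /=; apply: IH; rewrite /f.
  by case: ifP => // _; rewrite !mem_add_color cS !orbT.
suff : forall S : seq 'I_k, uniq S -> [/\ uniq (foldl f S (nbrs e v)),
    (size (foldl f S (nbrs e v)) <= size S + 2 * count (fun u : 'I_n => u < lim) (nbrs e v))%N
    & forall u, u \in nbrs e v -> (u < lim)%N ->
      (L u).1 \in foldl f S (nbrs e v) /\ (L u).2 \in foldl f S (nbrs e v)].
  by move=> /(_ [::] isT).
elim: (nbrs e v) => [|u l IH] S uS /=; first by split=> //; rewrite muln0 addn0.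
have uf : uniq (f S u) by rewrite /f; case: ifP => // _; do 2 apply: uniq_add_color.
have [h1 h2 h3] := IH _ uf; split=> //.
  apply: leq_trans h2 _; rewrite mulnDr addnA leq_add2r /f; case: (u < lim)%N => /=; last by rewrite addn0.
  have := size_add_color (add_color S (L u).1) (L u).2.
  by have := size_add_color S (L u).1; lia.
move=> u'; rewrite inE => /orP[/eqP -> lt_u|]; last exact: h3.
by split; apply: mono; rewrite /f lt_u !mem_add_color eqxx ?orbT.
Qed.

Lemma fillP ft (S : seq 'I_k) : uniq S -> (ft <= D)%N ->
  [/\ uniq (fill e ft S), {subset S <= fill e ft S}, (ft <= size (fill e ft S))%N
    & (size (fill e ft S) <= maxn ft (size S))%N].
Proof.
move=> uS le_ft; rewrite /fill; set f := fun _ _ => _.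
have step (S' : seq 'I_k) c : uniq S' -> [/\ uniq (f S' c), {subset S' <= f S' c},
    (size S' <= size (f S' c) <= maxn ft (size S'))%N &
    (ft <= size (f S' c))%N \/ c \in f S' c].
  move=> uS'; rewrite /f; case: ltnP => lt_S'.
    split; first exact: uniq_add_color.
    - by move=> d dS; rewrite mem_add_color dS orbT.
    - by have /andP[h1 h2] := size_add_color S' c; rewrite h1 (leq_trans h2).
    - by right; rewrite mem_add_color eqxx.
  by split=> //; first [by left|rewrite leqnn].
have main l (S' : seq 'I_k) : uniq S' -> [/\ uniq (foldl f S' l), {subset S' <= foldl f S' l},
    (size S' <= size (foldl f S' l) <= maxn ft (size S'))%N &
    (ft <= size (foldl f S' l))%N \/ {subset l <= foldl f S' l}].
  elim: l S' => [|c l IH] S' uS' /=; first by split=> //; [lia|right].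
  have [h1 h2 h3 h4] := step S' c uS'; have [i1 i2 i3 i4] := IH _ h1.
  split=> //; [by move=> d /h2 /i2|by lia|].
  case: h4 => [h4|h4]; first by left; lia.
  case: i4 => [i4|i4]; [by left|right] => d; rewrite inE => /orP[/eqP ->|/i4 //].
  exact: i2.
have [h1 h2 h3 h4] := main (take D (enum 'I_k)) S uS; split=> //; last by case/andP: h3.
(* A list that stays shorter than [ft] has absorbed each of the first D colours, which are distinct
   since D <= k; so its size is at least D after all. *)
case: h4 => // sub; apply: leq_trans (uniq_leq_size _ sub).
  by rewrite size_take size_enum_ord; case: ltnP; lia.
by rewrite take_uniq // enum_uniq.
Qed.

Definition valid (it : item n) : Prop :=
  it.1 = (n, 0%N) \/ it.1 = (it.2 : nat, D).

(** With a trusted and b late neighbours, a + b <= D. The gathered list has at most 2a colours and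
    padding brings it to max(D, 2a) at most; adding one colour per late neighbour stays within 2D,
    since D + b <= 2D and 2a + b <= 2D. This is why a late neighbour may cost one colour where a
    trusted one costs two. *)
Lemma startP (it : item n) (L : bounds) : valid it ->
  let nl := count (late it.1.1) (nbrs e it.2) in
  let S := start e it L in
  [/\ uniq S, (size S + nl <= 2 * D)%N, nl = 0%N \/ (D <= size S)%N
    & forall u, u \in nbrs e it.2 -> (u < it.1.1)%N ->
      (L u).1 \in S /\ (L u).2 \in S].
Proof.
case: it => -[lim ft] v /= it_ok; rewrite /start /=.
have [g1 g2 g3] := gatherP L lim v.
have le_ft : (ft <= D)%N by case: it_ok => /= -[_ ->].
have [f1 f2 f3 f4] := fillP g1 le_ft.
have cnt : (count (fun u : 'I_n => u < lim) (nbrs e v) + count (late lim) (nbrs e v) <= D)%N.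
  by rewrite count_predC size_nbrs.
split=> //.
- case: it_ok => /= -[limE ftE]; last by lia.
  have -> : count (late lim) (nbrs e v) = 0%N.
    by apply/eqP; rewrite -leqn0 leqNgt -has_count -all_predC; apply/allP => u _ /=; rewrite negbK limE.
  by subst ft; lia.
- case: it_ok => /= -[limE ftE]; [left|right; lia].
  by apply/eqP; rewrite -leqn0 leqNgt -has_count -all_predC; apply/allP => u _ /=; rewrite negbK limE.
by move=> u un /(g3 u un)[/f2 ? /f2 ?].
Qed.

Lemma mem_certain (L : bounds) lim v c : c \in certain e L lim v ->
  exists2 u, (u \in nbrs e v) && (u < lim)%N & L u = (c, c).
Proof.
move=> /mapP[u]; rewrite mem_filter => /andP[/andP[h1 /eqP h2] h3] cE.
by exists u; rewrite ?h3 //; move: h2 cE; case: (L u) => /= a b -> ->.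
Qed.

Section Compress.
Variables (w : 'I_n) (x : coloring) (S : seq 'I_k).
Hypotheses (uS : uniq S) (le_S : (D <= size S)%N) (lt_S : (size S < k)%N).

Lemma compress_supp :
  supp (compress e w (x, S)) (fun q => exists2 c, c \notin S &
    [/\ q.2 = rcons S c, q.1 w \in q.2 & forall u, u != w -> q.1 u = x u]).
Proof.
move=> c; rewrite mem_outside => cS a _.
have post s : s \in rcons S c -> exists2 c0, c0 \notin S &
    [/\ rcons S c = rcons S c0, recolor x w s w \in rcons S c
      & forall u, u != w -> recolor x w s u = x u].
  move=> sS; exists c => //; split=> // [|u /negPf uw]; last by rewrite recolorE uw.
  by rewrite recolorE eqxx.
case: ifP => _ /=; first by apply: post; rewrite mem_rcons mem_head.
move=> s; rewrite mem_filter => /andP[_ sS]; apply: post.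
by rewrite mem_rcons inE sS orbT.
Qed.

(** The draw among the free members of S is never empty when it is reached: if S were contained in
    N, the sizes would force S = N as sets, so c would be free and every a would pass the test. *)
Lemma compress_lossless : lossless (compress e w (x, S)).
Proof.
have le_N := leq_trans (card_nbr_colors e x w) le_S.
have card_S : #|S| = size S by apply/card_uniqP.
split; first exact: outside_neq0.
move=> c; rewrite mem_outside => cS; split.
  by rewrite -size_eq0 size_iota -lt0n subn_gt0 (leq_ltn_trans le_N).
move=> a; rewrite mem_iota add0n => /andP[_ lt_a]; case: ifP => //= no; split=> //.
apply/eqP => SN; have sub : {subset S <= nbr_colors e x w}.
  move=> s sS; apply/negPn/negP => sN.
  have : s \in [seq s <- S | s \notin nbr_colors e x w] by rewrite mem_filter sN.
  by rewrite SN.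
have cE : #|S| = #|nbr_colors e x w|.
  apply/eqP; rewrite eqn_leq; apply/andP; split; first exact/subset_leq_card/fintype.subsetP.
  by rewrite card_S.
have /(subset_cardP cE) eqS : S \subset nbr_colors e x w by apply/fintype.subsetP.
by move: no; rewrite -eqS cS /= -card_S cE lt_a.
Qed.

Lemma compress_bounds (R : realType) (g : seq 'I_k -> R) :
  expect (compress e w (x, S)) (fun q => g q.2) =
  expect (Draw (outside S) (fun c => Ret (rcons S c))) g.
Proof.
apply: (expect_draw (h := fun c => g (rcons S c)) compress_lossless).
by move=> c cS a _; case: ifP.
Qed.

End Compress.

Section Fold.
Variable lim : nat.

(** What is needed to compress the late vertices of [l] one after the other. The lower bound on the
    size is waived when none is left, which exempts the later sweeps from padding. *)
Definition room (l : seq 'I_n) (S : seq 'I_k) : Prop :=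
  [/\ uniq S, count (late lim) l = 0%N \/ (D <= size S)%N
    & (size S + count (late lim) l < k)%N].

Lemma room_cons u l S : ~~ late lim u -> room (u :: l) S -> room l S.
Proof. by move=> /negPf nl [h1 h2 h3]; move: h2 h3; rewrite /room /= nl. Qed.

Lemma room_late u l S c : late lim u -> c \notin S -> room (u :: l) S ->
  [/\ (D <= size S)%N, (size S < k)%N & room l (rcons S c)].
Proof.
move=> lu cS [h1 h2 h3]; move: h2 h3; rewrite /= lu => h2 h3.
have le_S : (D <= size S)%N by case: h2.
split; rewrite // ?(leq_ltn_trans _ h3) ?leq_addr //.
split; first by rewrite rcons_uniq cS.
  by right; rewrite size_rcons; lia.
by rewrite size_rcons; lia.
Qed.

Lemma exists_outside (S : seq 'I_k) : (size S < k)%N -> exists c, c \notin S.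
Proof.
move=> lt_S; have : (0 < size (outside S))%N.
  by rewrite size_outside subn_gt0 (leq_ltn_trans (card_size _)).
by case E: (outside S) => [//|c l] _; exists c; rewrite -mem_outside E mem_head.
Qed.

Lemma room_late' u l S : late lim u -> room (u :: l) S ->
  [/\ uniq S, (D <= size S)%N & (size S < k)%N].
Proof.
move=> lu [h1 h2 h3]; have [|c cS] := @exists_outside S; first by lia.
by have [] := room_late lu cS (And3 h1 h2 h3).
Qed.

(** A compressed vertex takes its colour from the current list or from the colour just added. Lists
    only grow and other steps do not touch the vertex, so its colour is still listed at the end. *)
Lemma fold_compress_supp l x S : room l S ->
  supp (foldM (compress_late e lim) l (x, S)) (fun q =>
    [/\ uniq q.2, {subset S <= q.2}, size q.2 = (size S + count (late lim) l)%N,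
        forall u, u \in l -> late lim u -> q.1 u \in q.2
      & forall u, ~~ ((u \in l) && late lim u) -> q.1 u = x u]).
Proof.
elim: l x S => [|w l IH] x S rm /=; first by split=> //; [case: rm|rewrite addn0].
apply: supp_bind; rewrite /compress_late; case: ifPn => lw.
  have nl : ~~ late lim w by rewrite negbK.
  apply: supp_sub (IH x S (room_cons nl rm)) => -[x' S'] [h1 h2 h3 h4 h5] /=; split=> //.
  - by rewrite h3 (negPf nl).
  - by move=> u; rewrite inE => /orP[/eqP ->|]; [rewrite (negPf nl)|exact: h4].
  - by move=> u nu; apply: h5; apply: contra nu => /andP[ul lu]; rewrite inE ul orbT.
have [uS le_S lt_S] := room_late' (lw : late lim w) rm.
apply: supp_sub (@compress_supp w x S) => -[x1 S1] /= [c cS [-> x1w x1E]].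
have [_ _ rm1] := room_late lw cS rm.
apply: supp_sub (IH x1 _ rm1) => -[x' S'] [h1 h2 h3 h4 h5] /=; split=> //.
- by move=> s sS; apply: h2; rewrite mem_rcons inE sS orbT.
- by rewrite h3 size_rcons /late lw; lia.
- move=> u; rewrite inE => /orP[/eqP -> _|]; last exact: h4.
  have [wl|wl] := boolP (w \in l); first exact: h4.
  by rewrite h5 ?(negPf wl) //; exact: h2.
move=> u; rewrite inE negb_and negb_or => nu.
rewrite h5; last by rewrite negb_and; case/orP: nu => [/andP[_ ->]|->] //; rewrite orbT.
by apply: x1E; apply: contraTneq nu => ->; rewrite eqxx /late lw.
Qed.

Lemma fold_compress_expect (R : realType) (f : coloring -> R) l x S : room l S ->
  expect (foldM (compress_late e lim) l (x, S)) (fun q => f q.1) =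
  foldr (fun (w : 'I_n) h => if (w < lim)%N then h else heat_bath e w h) f l x.
Proof.
elim: l x S => [|w l IH] x S rm //=.
rewrite expect_bind /compress_late; case: ifPn => lw.
  have nl : ~~ late lim w by rewrite negbK.
  by rewrite /= IH //; exact: room_cons nl rm.
have [uS le_S lt_S] := room_late' (lw : late lim w) rm.
rewrite -(compress_heat_bath (S := S)) //; last exact: leq_trans (card_nbr_colors _ _ _) le_S.
apply: eq_expect_supp; apply: supp_sub (@compress_supp w x S) => -[x1 S1] /= [c cS [-> _ _]].
by rewrite IH //; have [_ _] := room_late lw cS rm.
Qed.

Lemma fold_compress_bounds (R : realType) (g : seq 'I_k -> R) l x S : room l S ->
  expect (foldM (compress_late e lim) l (x, S)) (fun q => g q.2) =
  expect (foldM (compress_lateL lim) l S) g.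
Proof.
elim: l x S => [|w l IH] x S rm //=.
rewrite !expect_bind /compress_late /compress_lateL; case: ifPn => lw.
  have nl : ~~ late lim w by rewrite negbK.
  by rewrite /= IH //; exact: room_cons nl rm.
have [uS le_S lt_S] := room_late' (lw : late lim w) rm.
rewrite -(compress_bounds w x) //.
apply: eq_expect_supp; apply: supp_sub (@compress_supp w x S) => -[x1 S1] /= [c cS [-> _ _]].
by rewrite IH //; have [_ _] := room_late lw cS rm.
Qed.

Lemma fold_compress_lossless l S : room l S -> lossless (foldM (@compress_lateL n k lim) l S).
Proof.
elim: l S => [|w l IH] S rm //=.
apply: lossless_bind; rewrite /compress_lateL; case: ifPn => lw //=.
- have [uS le_S lt_S] := room_late' (lw : late lim w) rm.
  by split=> //; exact: outside_neq0.
- have nl : ~~ late lim w by rewrite negbK.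
  by apply: IH; exact: room_cons nl rm.
move=> c; rewrite mem_outside => cS.
by apply: IH; have [_ _] := room_late lw cS rm.
Qed.

Lemma fold_compressL_supp l S : room l S ->
  supp (foldM (@compress_lateL n k lim) l S) (fun S' => uniq S' /\ size S' = (size S + count (late lim) l)%N).
Proof.
elim: l S => [|w l IH] S rm /=; first by split=> //; [case: rm|rewrite addn0].
apply: supp_bind; rewrite /compress_lateL; case: ifPn => lw /=.
  have nl : ~~ late lim w by rewrite negbK.
  apply: supp_sub (IH S (room_cons nl rm)) => S' [h1 h2] /=; split=> //.
  by rewrite h2 (negPf nl).
move=> c; rewrite mem_outside => cS.
have [_ _ rm1] := room_late (lw : late lim w) cS rm.
apply: supp_sub (IH _ rm1) => S' [h1 h2]; split=> //.
by rewrite h2 size_rcons /late lw; lia.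
Qed.

End Fold.

Lemma start_room (it : item n) (L : bounds) : valid it ->
  room it.1.1 (nbrs e it.2) (start e it L).
Proof.
move=> vit; have [h1 h2 h3 _] := startP L vit; split=> //.
by apply: leq_ltn_trans h2 (leq_ltn_trans _ lt_D); rewrite leq_mul2r orbT.
Qed.

Definition consistent (lim : nat) (p : coloring * bounds) : Prop :=
  forall u : 'I_n, (u < lim)%N -> p.1 u = (p.2 u).1 \/ p.1 u = (p.2 u).2.

(** A first-sweep update of v is made when the vertices below v are trusted, and adds v to them. In
    a later sweep all vertices are trusted and remain so. *)
Definition next_limit (it : item n) : nat :=
  if it.1.1 == n then n else it.2.+1.

(** The effect of an update on the colouring alone, as an operator on test functions: a composition
    of heat baths, first at the late neighbours and then at the vertex. Only the stationarity of
    each factor matters. *)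
Definition update_colors (R : realType) (it : item n) (f : coloring -> R) :
    coloring -> R :=
  foldr (fun (w : 'I_n) h => if (w < it.1.1)%N then h else heat_bath e w h)
    (heat_bath e it.2 f) (nbrs e it.2).

Lemma fold_start_supp (it : item n) x (L : bounds) : valid it ->
  consistent it.1.1 (x, L) ->
  supp (foldM (compress_late e it.1.1) (nbrs e it.2) (x, start e it L)) (fun q =>
    [/\ uniq q.2, (size q.2 <= 2 * D)%N, {subset nbr_colors e q.1 it.2 <= q.2}
      & forall u : 'I_n, (u < it.1.1)%N -> q.1 u = x u]).
Proof.
move=> vit cons; have [s1 s2 s3 s4] := startP L vit.
apply: supp_sub (@fold_compress_supp _ _ x _ (start_room L vit)) => -[x' S'] [h1 h2 h3 h4 h5] /=.
have eqx (u : 'I_n) : (u < it.1.1)%N -> x' u = x u.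
  by move=> lu; apply: h5; rewrite /late lu andbF.
split=> //=; first by rewrite h3.
move=> c /mapP[u un ->]; have [lu|lu] := ltnP u it.1.1; last first.
  by apply: h4 => //; rewrite /late -leqNgt.
by rewrite eqx //; apply: h2; have [? ?] := s4 u un lu; case: (cons u lu) => /= ->.
Qed.

Lemma process_expect (R : realType) (it : item n) x (L : bounds) (f : coloring -> R) :
  valid it -> consistent it.1.1 (x, L) ->
  expect (process e it (x, L)) (fun q => f q.1) = update_colors it f x.
Proof.
move=> vit cons; rewrite /process expect_bind /update_colors.
rewrite -(fold_compress_expect _ x (start_room L vit)).
apply: eq_expect_supp; apply: supp_sub (@fold_start_supp _ _ _ vit cons) => -[x' S'] /= [h1 h2 h3 _].
by apply: contract_heat_bath => //; move: h2 lt_D; clear; lia.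
Qed.

Lemma contract_bounds (R : realType) v C x (S : seq 'I_k) (L : bounds) (g : bounds -> R) :
  uniq S -> (size S < k)%N ->
  expect (contract e v C S (x, L)) (fun q => g q.2) = expect (contractL e v C S L) g.
Proof.
move=> uS lt_S; rewrite /contract /contractL /=.
have N0 : (k - #|nbr_colors e x v|)%:R != 0 :> R.
  rewrite pnatr_eq0 -lt0n subn_gt0 (leq_ltn_trans (card_nbr_colors _ _ _)) //.
  by move: lt_D; clear; lia.
congr (_ / _); apply: eq_bigr => c _; congr (_ / _); apply: eq_bigr => j _.
by rewrite big_const_seq count_predT iter_addr_0 size_iota -[g _ *+ _]mulr_natr mulfK.
Qed.

Lemma process_bounds (R : realType) (it : item n) x (L : bounds) (g : bounds -> R) :
  valid it -> consistent it.1.1 (x, L) ->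
  expect (process e it (x, L)) (fun q => g q.2) = expect (processL e it L) g.
Proof.
move=> vit cons; rewrite /process /processL !expect_bind.
rewrite -(fold_compress_bounds _ x (start_room L vit)).
apply: eq_expect_supp; apply: supp_sub (@fold_start_supp _ _ _ vit cons) => -[x' S'] /= [h1 h2 h3 _].
by apply: contract_bounds => //; move: h2 lt_D; clear; lia.
Qed.

(** Compression recolours untrusted vertices only, so old trusted bounds survive; the vertex itself
    takes one of the two colours recorded for it. *)
Lemma process_supp (it : item n) x (L : bounds) :
  valid it -> consistent it.1.1 (x, L) ->
  supp (process e it (x, L)) (consistent (next_limit it)).
Proof.
move=> vit cons; rewrite /process; apply: supp_bind.
apply: supp_sub (@fold_start_supp _ _ _ vit cons) => -[x' S'] /= [h1 h2 h3 h4].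
move=> c _ j _ a _ u lu; rewrite /= !recolorE.
case: eqP => [_|uv] /=; last first.
  have lu' : (u < it.1.1)%N.
    move: lu; rewrite /next_limit; case: vit => ->; first by rewrite eqxx.
    case: eqP => [->|_]; first by [].
    by rewrite /= ltnS leq_eqVlt => /orP[/eqP /val_inj|].
  by rewrite h4 //; exact: cons.
case: ifP => [/and3P[-> c'N _]|_]; last by left.
rewrite ifT; first by right.
(* A surely blocked colour is the actual colour of some neighbour. An accepted c' is therefore not
   one of them, and it is recorded as the second bound. *)
apply: contra c'N => /mem_certain[w /andP[wn lw] Lw].
by apply/mapP; exists w => //; rewrite h4 //; have := cons w lw; rewrite /= Lw /=; case.
Qed.

Lemma contractL_lossless v C (S : seq 'I_k) (L : bounds) : uniq S -> (size S < k)%N ->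
  lossless (contractL e v C S L).
Proof.
move=> uS lt_S; split; first exact: outside_neq0.
move=> c _; split=> //.
by rewrite -size_eq0 size_iota -lt0n subn_gt0; move: lt_D; clear; lia.
Qed.

Lemma processL_lossless (it : item n) (L : bounds) : valid it -> lossless (processL e it L).
Proof.
move=> vit; have rm := start_room L vit; have [s1 s2 s3 s4] := startP L vit.
apply: lossless_bind; first exact: fold_compress_lossless.
apply: supp_sub (@fold_compressL_supp _ _ _ rm) => S [h1 h2].
by apply: contractL_lossless => //; rewrite h2; apply: leq_ltn_trans s2 _; move: lt_D; clear; lia.
Qed.

End Block.

(** * Coalescence and read-once coupling from the past *)

Section Coupling.
Variables (n k : nat) (e : rel 'I_n).

Local Notation coloring := {ffun 'I_n -> 'I_k}.
Local Notation bounds := {ffun 'I_n -> 'I_k * 'I_k}.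
Local Notation D := (max_degree e).

Hypotheses (sym_e : symmetric e) (irr_e : irreflexive e) (lt_D : (3 * D < k)%N).

(** [lim] is the number of initial vertices whose bounds are trusted. The final requirement lim = n
    says that a block ends with all bounds valid. *)
Fixpoint scheduled (lim : nat) (s : seq (item n)) : Prop :=
  if s is it :: s' then
    [/\ valid e it, it.1.1 = lim & scheduled (next_limit it) s']
  else lim = n.

Definition first_sweep : seq (item n) :=
  [seq ((nat_of_ord v, D), v) | v <- enum 'I_n].

Definition later_sweep : seq (item n) :=
  [seq ((n, 0%N), v) | v <- enum 'I_n].

Definition schedule (T : nat) : seq (item n) :=
  first_sweep ++ flatten (nseq T later_sweep).

Lemma scheduled_later (l : seq 'I_n) s :
  scheduled n s -> scheduled n ([seq ((n, 0%N), v) | v <- l] ++ s).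
Proof.
move=> hs; elim: l => [|v l IH] //=; split=> //; first by left.
by rewrite /next_limit eqxx.
Qed.

Lemma scheduled_sweeps T : scheduled n (flatten (nseq T later_sweep)).
Proof. by elim: T => [|T IH] //=; exact: scheduled_later. Qed.

Lemma scheduled_schedule T : scheduled 0 (schedule T).
Proof.
rewrite /schedule /first_sweep.
suff : forall (l : seq 'I_n) i, (i <= n)%N -> map val l = iota i (n - i) ->
    scheduled i ([seq ((nat_of_ord v, D), v) | v <- l] ++ flatten (nseq T later_sweep)).
  by apply; rewrite ?val_enum_ord ?subn0.
elim=> [|v l IH] i le_i /= lE.
  have -> : i = n by apply/eqP; rewrite eqn_leq le_i /= -subn_eq0 -(size_iota i (n - i)) -lE.
  exact: scheduled_sweeps.
have lt_i : (i < n)%N by rewrite -subn_gt0 -(size_iota i (n - i)) -lE.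
move: lE; rewrite -subnSK //= => -[vi lE].
split=> //; first by right.
by rewrite /next_limit /= vi ltn_eqF //; exact: IH.
Qed.

Lemma fill0 (S : seq 'I_k) : fill e 0 S = S.
Proof. by rewrite /fill; elim: (take _ _). Qed.

Lemma gather_sub (L : bounds) lim v :
  {subset gather e L lim v <= flatten [seq [:: (L u).1; (L u).2] | u <- nbrs e v]}.
Proof.
rewrite /gather; set f := fun _ _ => _.
suff : forall (l : seq 'I_n) (S : seq 'I_k) c, c \in foldl f S l ->
    c \in S \/ c \in flatten [seq [:: (L u).1; (L u).2] | u <- l].
  by move=> h c /h[].
elim=> [|u l IH] S c /=; first by left.
move=> /IH[|h]; last by right; rewrite !inE h !orbT.
rewrite /f; case: ifP => _; last by left.
by rewrite !mem_add_color => /or3P[/eqP ->|/eqP ->|]; [right|right|left]; rewrite ?inE ?eqxx ?orbT.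
Qed.

(** * Marginal laws of a block and its probability of coalescence *)

Section Expectations.
Variable R : realType.

Lemma sweeps_expect s lim x (L : bounds) (f : coloring -> R) :
  scheduled lim s -> consistent lim (x, L) ->
  expect (foldM (process e) s (x, L)) (fun q => f q.1) =
  foldr (fun it h => update_colors e it h) f s x.
Proof.
elim: s lim x L => [|it s IH] lim x L //= [vit limE sch] cons.
rewrite -limE in cons; rewrite expect_bind -(process_expect lt_D _ vit cons).
apply: eq_expect_supp.
by apply: supp_sub (process_supp lt_D vit cons) => -[x' L'] cons'; exact: IH sch cons'.
Qed.

Lemma sweeps_bounds s lim x (L : bounds) (g : bounds -> R) :
  scheduled lim s -> consistent lim (x, L) ->
  expect (foldM (process e) s (x, L)) (fun q => g q.2) =
  expect (foldM (processL e) s L) g.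
Proof.
elim: s lim x L => [|it s IH] lim x L //= [vit limE sch] cons.
rewrite -limE in cons.
rewrite expect_bind [RHS]expect_bind.
rewrite -(process_bounds lt_D (fun L' => expect (foldM (processL e) s L') g) vit cons).
apply: eq_expect_supp.
by apply: supp_sub (process_supp lt_D vit cons) => -[x' L'] cons'; exact: IH sch cons'.
Qed.

Lemma sweeps_supp s lim x (L : bounds) :
  scheduled lim s -> consistent lim (x, L) ->
  supp (foldM (process e) s (x, L)) (consistent n).
Proof.
elim: s lim x L => [|it s IH] lim x L /= => [->|[vit limE sch]] // cons.
rewrite -limE in cons; apply: supp_bind.
by apply: supp_sub (process_supp lt_D vit cons) => -[x' L'] cons'; exact: IH sch cons'.
Qed.

Lemma sweepsL_lossless s lim (L : bounds) :
  scheduled lim s -> lossless (foldM (processL e) s L).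
Proof.
elim: s lim L => [|it s IH] lim L //= [vit limE sch].
apply: lossless_bind; first exact: processL_lossless.
by apply: supp_all => L'; exact: IH sch.
Qed.

Lemma sweeps_stationary s (f : coloring -> R) :
  \sum_(x | proper_coloring e x) foldr (fun it h => update_colors e it h) f s x =
  \sum_(x | proper_coloring e x) f x.
Proof.
have lt_Dk : (D < k)%N by move: lt_D; clear; lia.
elim: s => [//|it s <-] /=; rewrite /update_colors.
elim: (nbrs e it.2) => [|w l IH] /=; first by rewrite heat_bath_stationary.
by case: ifP => _; rewrite ?heat_bath_stationary.
Qed.

Definition split_at (v : 'I_n) (L : bounds) : R := ((L v).1 != (L v).2)%:R.

(** Two distinct bounds arise only when j points to a member of S that is not surely blocked, and
    each such member has probability 1/(k - D). *)
Lemma contractL_split v C (S : seq 'I_k) (L : bounds) : uniq S -> (size S <= 2 * D)%N ->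
  expect (contractL e v C S L) (split_at v) <=
  (size [seq c <- S | c \notin C])%:R / (k - D)%:R.
Proof.
move=> uS le_S; have lt_S : (size S < k)%N by move: le_S lt_D; clear; lia.
have d0 : 0 < (k - D)%:R :> R by rewrite ltr0n subn_gt0; move: lt_D; clear; lia.
have d0' := lt0r_neq0 d0.
rewrite -(expect_cst ((size [seq c <- S | c \notin C])%:R / (k - D)%:R)
  (contractL_lossless lt_D v C L uS lt_S)) /=.
rewrite ler_pM2r ?invr_gt0 ?ltr0n; last first.
  by rewrite size_outside_uniq // subn_gt0.
apply: ler_sum => c _; rewrite ler_pM2r ?invr_gt0 ?size_iota //.
rewrite big_const_seq count_predT iter_addr_0 size_iota -[(_ / _) *+ _]mulr_natr divfK //.
rewrite -[leRHS](_ : \sum_(s <- S) (s \notin C)%:R = _); last first.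
  by rewrite -sum1_size big_filter natr_sum [RHS]big_mkcond; apply: eq_bigr => s _; case: ifP.
rewrite -(sum_prefix (m := k - D) c (fun s => (s \notin C)%:R)); last first.
  by move: le_S lt_D; clear; lia.
apply: ler_sum => j _; rewrite /split_at recolorE eqxx /=.
case: (j < size S)%N => /=; last by rewrite eqxx.
case: (nth c S j \in C) => /=; first by rewrite eqxx.
by case: (_ != _).
Qed.

Lemma split_at_recolor u v c (L : bounds) : u != v ->
  split_at u (recolor L v c) = split_at u L.
Proof. by move=> /negPf uv; rewrite /split_at recolorE uv. Qed.

Lemma processL_other (it : item n) (L : bounds) u : valid e it -> u != it.2 ->
  expect (processL e it L) (split_at u) = split_at u L.
Proof.
move=> vit uv.
rewrite -[RHS](expect_cst (split_at u L) (processL_lossless lt_D L vit)).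
apply: eq_expect_supp; apply: supp_bind; apply: supp_all => S c _ j _ /=.
exact: split_at_recolor.
Qed.

(** In a later sweep there is neither compression nor padding: the list holds nothing but bounds of
    neighbours. A determined neighbour contributes a surely blocked colour, an undetermined one at
    most two other colours. *)
Lemma processL_split v (L : bounds) :
  expect (processL e ((n, 0%N), v) L) (split_at v) <=
  2 / (k - D)%:R * \sum_(u <- nbrs e v) split_at u L.
Proof.
have vit : valid e ((n, 0%N), v) by left.
have [s1 s2 s3 s4] := startP lt_D L vit.
rewrite /processL.
have -> : foldM (compress_lateL (k := k) n) (nbrs e v) (start e ((n, 0%N), v) L) =
          Ret (start e ((n, 0%N), v) L).
  by elim: (nbrs e v) (start _ _ _) => [//|w l IH] S /=; rewrite /compress_lateL ltn_ord /= IH.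
set S := start _ _ _ in s1 s2 s3 s4 *.
apply: le_trans (contractL_split _ _ _ s1 _) _ => /=.
  by apply: leq_trans s2; exact: leq_addr.
rewrite [leRHS]mulrAC; apply: ler_wpM2r.
  by rewrite invr_ge0 ler0n.
have sub : {subset [seq c <- S | c \notin certain e L n v] <=
    flatten [seq (if (L u).1 != (L u).2 then [:: (L u).1; (L u).2] else [::]) | u <- nbrs e v]}.
  move=> c; rewrite mem_filter => /andP[cC cS].
  have {cS} : c \in flatten [seq [:: (L u).1; (L u).2] | u <- nbrs e v].
    move: cS; rewrite /S /start /= fill0; exact: gather_sub.
  move=> /flatten_mapP[u un cu]; apply/flatten_mapP; exists u => //.
  case: ifPn => //; rewrite negbK => /eqP Lu; apply: contraNT cC => _.
  have cE : c = (L u).1 by move: cu; rewrite -Lu !inE orbb => /eqP.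
  by apply/mapP; exists u => //; rewrite mem_filter ltn_ord Lu eqxx.
have le1 := uniq_leq_size (filter_uniq _ s1) sub.
apply: le_trans (_ : (size (flatten [seq (if (L u).1 != (L u).2 then
    [:: (L u).1; (L u).2] else [::]) | u <- nbrs e v]))%:R <= _).
  by rewrite ler_nat.
rewrite size_flatten /shape -map_comp sumnE big_map natr_sum mulr_sumr.
by apply: ler_sum => u _ /=; rewrite /split_at; case: ifP => _ /=; rewrite ?mulr1 ?mulr0.
Qed.

Definition contraction : R := 2 * D%:R / (k - D)%:R.

Lemma contraction_ge0 : 0 <= contraction.
Proof. by rewrite /contraction divr_ge0 ?mulr_ge0. Qed.

Lemma contraction_le1 : contraction <= 1.
Proof.
rewrite /contraction ler_pdivrMr ?ltr0n; last by move: lt_D; clear; lia.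
by rewrite mul1r -natrM ler_nat; move: lt_D; clear; lia.
Qed.

(** * Geometric decay of the undetermined vertices *)

Section Decay.
Variable L0 : bounds.

Let split_mean s u := expect (foldM (processL e) s L0) (split_at u).

Lemma split_mean_rcons s v (b : 'I_n -> R) :
  (forall u, split_mean s u <= b u) -> forall u,
  split_mean (s ++ [:: ((n, 0%N), v)]) u <=
  if u == v then 2 / (k - D)%:R * \sum_(w <- nbrs e v) b w else b u.
Proof.
move=> le_b u; rewrite /split_mean foldM_cat.
have -> : expect (foldM (processL e) s L0)
    (fun L => expect (foldM (processL e) [:: ((n, 0%N), v)] L) (split_at u)) =
  expect (foldM (processL e) s L0)
    (fun L => expect (processL e ((n, 0%N), v) L) (split_at u)).
  by apply: eq_expect => L; rewrite /foldM expect_bind.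
case: eqP => [->|/eqP uv]; last first.
  rewrite (_ : expect _ _ = split_mean s u) //; apply: eq_expect => L.
  by apply: processL_other => //; left.
apply: le_trans (expect_le (g' := fun L =>
  2 / (k - D)%:R * \sum_(w <- nbrs e v) split_at w L) _) _.
  by apply: supp_all => L; exact: processL_split.
rewrite expectZ expect_sum ler_wpM2l ?divr_ge0 //.
by apply: ler_sum => w _; exact: le_b.
Qed.

(** [done] marks the vertices already updated in the current sweep. An update reads old and new
    neighbours alike; all of them satisfy the weaker bound r because the factor is at most 1, and D
    neighbours at r give [contraction * r]. *)
Lemma split_mean_partial (l : seq 'I_n) s (done : pred 'I_n) r : 0 <= r ->
  (forall u, split_mean s u <= if done u then contraction * r else r) ->
  forall u, split_mean (s ++ [seq ((n, 0%N), v) | v <- l]) u <=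
            if done u || (u \in l) then contraction * r else r.
Proof.
move=> r0; elim: l s done => [|v l IH] s done le_s u /=.
  by rewrite cats0 orbF.
rewrite -cat1s catA inE.
have le_r (b : bool) : (if b then contraction * r else r) <= r.
  by case: b => //; rewrite ler_piMl // contraction_le1.
rewrite orbA; apply: (IH (s ++ [:: ((n, 0%N), v)]) (fun u => done u || (u == v))) => {}u.
apply: le_trans (split_mean_rcons v le_s u) _.
case: eqP => _; rewrite ?orbF // orbT.
have cE : contraction * r = 2 / (k - D)%:R * (D%:R * r) by rewrite /contraction; ring.
rewrite [leRHS]cE.
rewrite ler_wpM2l ?divr_ge0 //.
apply: le_trans (ler_sum _ (fun w _ => le_r (done w))) _.
rewrite big_const_seq count_predT iter_addr_0 -[r *+ _]mulr_natl ler_wpM2r // ler_nat.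
exact: size_nbrs.
Qed.

Lemma split_mean_sweeps T s r : 0 <= r ->
  (forall u, split_mean s u <= r) ->
  forall u, split_mean (s ++ flatten (nseq T later_sweep)) u <= contraction ^+ T * r.
Proof.
elim: T s r => [|T IH] s r r0 le_s u /=; first by rewrite cats0 expr0 mul1r.
rewrite catA exprSr -mulrA; apply: IH => [|{}u]; first by rewrite mulr_ge0 // contraction_ge0.
apply: le_trans (split_mean_partial (enum 'I_n) r0 (done := xpred0) le_s u) _.
by rewrite /= mem_enum.
Qed.

(** The first sweep only makes the bounds valid; the trivial bound 1 is used for it, and the later
    sweeps do the rest. *)
Lemma split_mean_schedule T u : split_mean (schedule T) u <= contraction ^+ T.
Proof.
rewrite -[leRHS]mulr1 /schedule; apply: split_mean_sweeps => // {}u.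
have h : lossless (foldM (processL e) first_sweep L0).
  have := scheduled_schedule 0; rewrite /schedule /= cats0.
  exact: sweepsL_lossless.
rewrite -[leRHS](expect_cst 1 h); apply: expect_le; apply: supp_all => L.
by rewrite /split_at; case: (_ != _).
Qed.

End Decay.

Definition coalesced (L : bounds) : bool := [forall v, (L v).1 == (L v).2].

Definition common (L : bounds) : coloring := [ffun v => (L v).1].

Lemma coalescedP x (L : bounds) : coalesced L -> consistent n (x, L) -> x = common L.
Proof.
move=> /forallP cL cons; apply/ffunP => v; rewrite ffunE.
by have /eqP := cL v; case: (cons v (ltn_ord v)) => /= -> // <-.
Qed.

Definition start_bounds (c : 'I_k) : bounds := [ffun _ => (c, c)].

Definition coalescence (T : nat) (L0 : bounds) : R :=
  expect (foldM (processL e) (schedule T) L0) (fun L => (coalesced L)%:R).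

Lemma not_coalesced_le (L : bounds) : (~~ coalesced L)%:R <= \sum_v split_at v L.
Proof.
case: (boolP (coalesced L)) => [_|]; first by apply: sumr_ge0 => v _; rewrite /split_at.
rewrite negb_forall => /existsP[v vs] /=; rewrite (bigD1 v) //= {1}/split_at vs.
by rewrite lerDl sumr_ge0 // => u _; rewrite /split_at.
Qed.

Lemma expect_coalesced_compl T L0 (g : bounds -> R) :
  (forall L, g L = (~~ coalesced L)%:R) ->
  expect (foldM (processL e) (schedule T) L0) g = 1 - coalescence T L0.
Proof.
move=> gE; apply/eqP; rewrite eq_sym subr_eq eq_sym /coalescence -expectD; apply/eqP.
rewrite -[RHS](expect_cst 1 (sweepsL_lossless L0 (scheduled_schedule T))).
by apply: eq_expect => L; rewrite gE; case: coalesced; rewrite ?addr0 ?add0r.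
Qed.

Lemma coalescence_ge T L0 : n%:R * contraction ^+ T <= 2^-1 -> 2^-1 <= coalescence T L0.
Proof.
move=> le_half; have h := expect_coalesced_compl T L0 (fun L => erefl).
suff : 1 - coalescence T L0 <= 2^-1 by lra.
rewrite -h; apply: le_trans le_half.
apply: le_trans (expect_le (supp_all _ not_coalesced_le)) _.
rewrite (expect_sum (index_enum _)) .
apply: le_trans (ler_sum _ (fun v _ => split_mean_schedule L0 T v)) _.
by rewrite sumr_const card_ord mulr_natl.
Qed.

(** This is (1 + 1/m)^(m+1) >= 2, an instance of Bernoulli's inequality, which is [bern] with the
    denominators cleared. *)
Lemma double_expn (m : nat) : (2 * m ^ m.+1 <= m.+1 ^ m.+1)%N.
Proof.
case: m => [//|m].
have bern p : (m.+1 ^ p * (m.+1 + p) <= m.+2 ^ p * m.+1)%N.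
  elim: p => [|p IH]; first by rewrite addn0.
  have := leq_mul (leqnn m.+2) IH; rewrite !expnS; nia.
have := bern m.+2; have : (0 < m.+1 ^ m.+2)%N by rewrite expn_gt0.
nia.
Qed.

(** From k > 3D the factor is at most 2D/(2D + 1), and [double_expn] with m = 2D applies. *)
Lemma contraction_half : contraction ^+ (2 * D).+1 <= 2^-1.
Proof.
have d0 : 0 < (2 * D).+1%:R :> R by rewrite ltr0n.
have le_c : contraction <= (2 * D)%:R / (2 * D).+1%:R.
  rewrite /contraction natrM ler_wpM2l ?mulr_ge0 // lef_pV2 ?posrE // ?ltr0n ?ler_nat;
  move: lt_D; clear; lia.
apply: le_trans (lerXn2r _ _ _ le_c) _; rewrite ?nnegrE ?contraction_ge0 ?divr_ge0 //.
rewrite expr_div_n ler_pdivrMr ?exprn_gt0 // mulrC ler_pdivlMr // -!natrX -natrM ler_nat mulnC.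
exact: double_expn.
Qed.

(** One halving per 2D + 1 sweeps: after l + 1 of them the union bound over at most 2^l vertices
    leaves 1/2. *)
Lemma coalescence_half l L0 : (n <= 2 ^ l)%N ->
  2^-1 <= coalescence ((2 * D).+1 * l.+1) L0.
Proof.
move=> le_n; apply: coalescence_ge; rewrite exprM.
have h : (contraction ^+ (2 * D).+1) ^+ l.+1 <= 2^-1 ^+ l.+1.
  by rewrite lerXn2r ?nnegrE ?exprn_ge0 ?contraction_ge0 ?invr_ge0 // contraction_half.
apply: le_trans (ler_wpM2l (ler0n _ _) h) _.
rewrite exprS mulrCA ler_piMr ?invr_ge0 // exprVn.
by rewrite ler_pdivrMr ?exprn_gt0 // mul1r -natrX ler_nat.
Qed.

(** Greedy colouring in the order of the vertices, each having at most D < k blocked colours. It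
    makes division by the number of proper colourings legitimate. *)
Lemma exists_proper : exists x : coloring, proper_coloring e x.
Proof.
have k_gt0 : (0 < k)%N by exact: leq_ltn_trans lt_D.
suff : forall i, (i <= n)%N -> exists x : coloring, forall u v : 'I_n,
    (u < i)%N -> (v < i)%N -> e u v -> x u != x v.
  move=> /(_ n (leqnn n))[x h]; exists x; apply/forallP => u; apply/forallP => v.
  by apply/implyP; apply: h.
elim=> [|i IH] lt_i; first by exists [ffun _ => Ordinal k_gt0].
have [x hx] := IH (ltnW lt_i).
have [|c cN] := exists_outside (S := nbr_colors e x (Ordinal lt_i)).
  rewrite size_map; apply: leq_ltn_trans (size_nbrs _ _) _; move: lt_D; clear; lia.
exists (recolor x (Ordinal lt_i) c) => u v lt_u lt_v euv; rewrite !recolorE.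
have nbr w : e (Ordinal lt_i) w -> c != x w.
  move=> ew; apply: contra cN => /eqP ->; apply/mapP; exists w => //.
  by rewrite mem_nbrs.
have lt_of (w : 'I_n) : (w < i.+1)%N -> w != Ordinal lt_i -> (w < i)%N.
  by move=> h1 h2; rewrite ltn_neqAle -ltnS h1 andbT; apply: contra h2 => /eqP wi; apply/eqP/val_inj.
case: (eqVneq u (Ordinal lt_i)) => [uE|nu]; case: (eqVneq v (Ordinal lt_i)) => [vE|nv].
- by move: euv; rewrite uE vE irr_e.
- by apply: nbr; rewrite -uE.
- by rewrite eq_sym; apply: nbr; rewrite sym_e -vE.
by apply: hx => //; exact: lt_of.
Qed.

(** * Exactness of read-once coupling from the past *)

Section ReadOnce.
Variables (T : nat) (L0 : bounds) (phi : coloring -> R).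
Hypothesis phi_ge0 : forall x, 0 <= phi x.

Definition block_mean (x : coloring) (g : coloring * bounds -> R) : R :=
  expect (foldM (process e) (schedule T) (x, L0)) g.

Let p := coalescence T L0.

(* The expected payoff when the state is [x], [t] more blocks are allowed, and
   the state before the next coalescing block is output. *)
Fixpoint payoff (t : nat) (x : coloring) : R :=
  if t is t'.+1 then
    p * phi x + block_mean x (fun q => (~~ coalesced q.2)%:R * payoff t' q.1)
  else 0.

Definition uniform_mean : R :=
  (\sum_(x | proper_coloring e x) phi x) / (num_proper k e)%:R.

Lemma num_properE : (num_proper k e)%:R = \sum_(x : coloring | proper_coloring e x) 1 :> R.
Proof.
by rewrite /num_proper -sum1_card natr_sum; apply: eq_bigl => x; rewrite inE.
Qed.

Lemma num_proper_gt0 : 0 < (num_proper k e)%:R :> R.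
Proof.
have [x px] := exists_proper.
by rewrite ltr0n /num_proper; apply/card_gt0P; exists x; rewrite inE.
Qed.

Lemma coalescence_ge0 : 0 <= p.
Proof. by apply: expect_ge0. Qed.

Lemma consistent0 x : consistent 0 (x, L0).
Proof. by []. Qed.

Lemma block_bounds x (g : bounds -> R) :
  block_mean x (fun q => g q.2) = expect (foldM (processL e) (schedule T) L0) g.
Proof. exact: sweeps_bounds (scheduled_schedule T) (@consistent0 x). Qed.

Lemma block_coalesced x : block_mean x (fun q => (coalesced q.2)%:R) = p.
Proof. exact: block_bounds. Qed.

Lemma block_not_coalesced x : block_mean x (fun q => (~~ coalesced q.2)%:R) = 1 - p.
Proof. by rewrite (block_bounds x (fun L => (~~ coalesced L)%:R)) expect_coalesced_compl. Qed.

(* After coalescence the state is a function of the bounds, whose law does not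
   depend on the initial state. *)
Lemma block_common x (g : coloring -> R) :
  block_mean x (fun q => (coalesced q.2)%:R * g q.1) =
  expect (foldM (processL e) (schedule T) L0)
    (fun L => (coalesced L)%:R * g (common L)).
Proof.
rewrite -(block_bounds x (fun L => (coalesced L)%:R * g (common L))).
apply: eq_expect_supp; apply: supp_sub (sweeps_supp (scheduled_schedule T) (@consistent0 x)).
move=> [x' L'] cons /=; case: (boolP (coalesced L')) => cL; last by rewrite !mul0r.
by rewrite (coalescedP cL cons).
Qed.

Lemma block_stationary (g : coloring -> R) :
  \sum_(x | proper_coloring e x) block_mean x (fun q => g q.1) =
  \sum_(x | proper_coloring e x) g x.
Proof.
rewrite -[RHS](sweeps_stationary (schedule T)); apply: eq_bigr => x _.
exact: sweeps_expect (scheduled_schedule T) (@consistent0 x).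
Qed.

Lemma block_split x (g : coloring * bounds -> R) :
  block_mean x g = block_mean x (fun q => (coalesced q.2)%:R * g q) +
                   block_mean x (fun q => (~~ coalesced q.2)%:R * g q).
Proof.
rewrite -expectD; apply: eq_expect => q.
by case: coalesced; rewrite !(mul1r, mul0r, addr0, add0r).
Qed.

Lemma payoff_mono t x : payoff t x <= payoff t.+1 x.
Proof.
elim: t x => [|t IH] x; last first.
  rewrite [leLHS]/= [leRHS]/= lerD2l; apply: expect_le; apply: supp_all => q.
  by rewrite ler_wpM2l.
rewrite /= addr_ge0 ?mulr_ge0 ?coalescence_ge0 //.
by apply: expect_ge0 => q; rewrite mulr0.
Qed.

(** The left side does not depend on x, by [block_common], so it may be averaged over the proper
    colourings. By stationarity the full mean of [payoff t] after a block is its mean before; by the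
    recursion the part without coalescence is the mean of [payoff t.+1] minus that of p * phi. The
    coalescing part is thus p times the uniform mean, plus the mean of [payoff t] minus
    [payoff t.+1], which is nonpositive. In the limit this would be an equality; for finite t the
    inequality is enough. *)
Lemma block_payoff x t :
  block_mean x (fun q => (coalesced q.2)%:R * payoff t q.1) <= p * uniform_mean.
Proof.
have N0 := num_proper_gt0.
have sumE (c : R) : \sum_(y : coloring | proper_coloring e y) c = (num_proper k e)%:R * c.
  by rewrite num_properE mulr_suml; apply: eq_bigr => y _; rewrite mul1r.
have const y : block_mean y (fun q => (coalesced q.2)%:R * payoff t q.1) =
               block_mean x (fun q => (coalesced q.2)%:R * payoff t q.1).
  by rewrite !block_common.
rewrite -(ler_pM2l N0) -sumE; under eq_bigr => y _ do rewrite -(const y).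
rewrite [leRHS](_ : _ = p * \sum_(y | proper_coloring e y) phi y); last first.
  by rewrite /uniform_mean; field; exact: lt0r_neq0.
have -> : \sum_(y | proper_coloring e y)
    block_mean y (fun q => (coalesced q.2)%:R * payoff t q.1) =
  \sum_(y | proper_coloring e y) (payoff t y - (payoff t.+1 y - p * phi y)).
  rewrite sumrB -(block_stationary (payoff t)) -sumrB; apply: eq_bigr => y _.
  by rewrite (block_split y (fun q => payoff t q.1)) /= [p * _ + _]addrC !addrK.
rewrite mulr_sumr; apply: ler_sum => y _.
by have := payoff_mono t y; lra.
Qed.

End ReadOnce.

End Expectations.
End Coupling.

(** * Runs of the machine on fair coins *)

Local Open Scope classical_set_scope.

Lemma eq_run (w : nat) (b1 b2 : nat -> bool) (s : state) (t : nat) :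
  (forall i, (i < t)%N -> b1 i = b2 i) -> run w b1 s t = run w b2 s t.
Proof.
elim: t => [//|t IH] eqb /=; rewrite IH ?eqb// => i lti; apply: eqb; lia.
Qed.

Lemma halted_step (w : nat) (b : bool) (s : state) :
  halted s -> step w b s = s.
Proof. by case: s => -[]. Qed.

Lemma halted_run (w : nat) (b : nat -> bool) (s : state) (t t' : nat) :
  (t <= t')%N -> halted (run w b s t) -> run w b s t' = run w b s t.
Proof.
move=> /subnK <- h; elim: (t' - t)%N => [//|d IH].
by rewrite addSn /= IH halted_step.
Qed.

Section Averages.
Variables (R : realType) (w : nat).

(** This recursion peels off the first step, whereas [run] peels off the last; [run_cylinder]
    reconciles the two. *)
Fixpoint average (t : nat) (f : state -> R) (s : state) : R :=
  if t is t'.+1 then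
    (average t' f (step w true s) + average t' f (step w false s)) / 2
  else f s.

Variables (d : measure_display) (Omega : measurableType d).
Variables (P : probability Omega R) (coin : nat -> {RV P >-> bool}).
Hypothesis fair : fair_coins coin.

Definition cylinder (bs : seq bool) : set Omega :=
  \bigcap_(i in [set` iota 0 (size bs)]) (coin i @^-1` [set nth false bs i]).

Lemma cylinderP bs x :
  cylinder bs x <-> forall i, (i < size bs)%N -> coin i x = nth false bs i.
Proof.
split=> [h i lti|h i /=]; first by apply: h; rewrite /= mem_iota.
by rewrite mem_iota => /andP[_ lti]; rewrite /= h.
Qed.

Lemma measurable_coin i (B : set bool) : measurable (coin i @^-1` B).
Proof. by rewrite -[X in measurable X]setTI; apply: measurable_funP. Qed.

Lemma measurable_cylinder bs : measurable (cylinder bs).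
Proof.
rewrite /cylinder bigcap_seq.
by apply: bigsetI_measurable => i _; exact: measurable_coin.
Qed.

Lemma coin_half i b : P (coin i @^-1` [set b]) = (2^-1)%:E.
Proof.
have := fair.1 i [set b]; rewrite /distribution /pushforward /= => ->.
rewrite bernoulli_probE ?invr_ge0 ?ler0n ?invf_le1 ?ler1n //.
have mem1 b' : (b' \in [set b]) = (b' == b).
  by apply/idP/eqP => [/set_mem //|->]; exact: mem_set.
rewrite !diracE !mem1; case: b {mem1} => /=; rewrite ?mule1 ?mule0.
  by rewrite adde0.
by rewrite add0e /unstable.onem; congr (_%:E); lra.
Qed.

Lemma probability_cylinder bs : P (cylinder bs) = ((2^-1) ^+ size bs)%:E.
Proof.
rewrite /cylinder fair.2 ?iota_uniq //.
under eq_bigr do rewrite coin_half.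
by rewrite prodEFin big_const_seq count_predT size_iota -Monoid.iteropE.
Qed.

Lemma cylinder_rcons bs :
  cylinder bs = cylinder (rcons bs true) `|` cylinder (rcons bs false).
Proof.
apply/seteqP; split=> x.
  move=> /cylinderP h.
  have h' : cylinder (rcons bs (coin (size bs) x)) x.
    apply/cylinderP => i; rewrite size_rcons ltnS nth_rcons leq_eqVlt.
    by case: ltngtP => //= [/h //|-> _].
  by case: (coin (size bs) x) h'; [left|right].
by case=> /cylinderP h; apply/cylinderP => i lti;
  rewrite h ?size_rcons 1?ltnW // nth_rcons lti.
Qed.

(** The outcome of a run of given length is a function of finitely many coins. With the first coins
    fixed to [bs], the induction splits on the next coin until none is left, where the event is a
    whole cylinder or empty. *)
Lemma run_cylinder (H : state -> bool) s t bs :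
  let E := cylinder bs `&` [set x | H (run w (coin^~ x) s (size bs + t))] in
  measurable E /\
  P E = ((2^-1) ^+ size bs *
     average t (fun s' => (H s')%:R) (run w (nth false bs) s (size bs)))%:E.
Proof.
elim: t bs => [|t IH] bs /=.
  rewrite addn0.
  have -> : cylinder bs `&` [set x | H (run w (coin^~ x) s (size bs))] =
            if H (run w (nth false bs) s (size bs)) then cylinder bs else set0.
    case: ifP => h; apply/seteqP; split => x //=.
    - by case.
    - move=> cx; split=> //; move/cylinderP: cx => cx.
      by rewrite (@eq_run _ _ (nth false bs)) ?h // => i lti; exact: cx.
    - by case=> /cylinderP cx; rewrite (@eq_run _ _ (nth false bs)) ?h // => i lti; exact: cx.
  case: (H _); last by rewrite measure0 mulr0; split; first exact: measurable0.
  by rewrite mulr1; split; [exact: measurable_cylinder|exact: probability_cylinder].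
have [mt Pt] := IH (rcons bs true).
have [mf Pf] := IH (rcons bs false).
move: mt Pt mf Pf; rewrite !size_rcons addSnnS => mt Pt mf Pf.
rewrite cylinder_rcons setIUl; split; first exact: measurableU.
rewrite measureU //; last first.
  apply/seteqP; split=> x // -[[/cylinderP ct _] [/cylinderP cf _]].
  have := ct (size bs); have := cf (size bs).
  by rewrite !size_rcons !nth_rcons !ltnn !eqxx => -> // /(_ (leqnn _)).
rewrite [X in (X + _)%E]Pt [X in (_ + X)%E]Pf -EFinD; congr (_%:E) => /=.
have runE b : run w (nth false (rcons bs b)) s (size bs) =
              run w (nth false bs) s (size bs).
  by apply: eq_run => i lti; rewrite nth_rcons lti.
by rewrite !runE !nth_rcons !ltnn !eqxx exprS; field.
Qed.

Lemma measurable_run (H : state -> bool) s t :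
  measurable [set x | H (run w (coin^~ x) s t)].
Proof.
have [] := run_cylinder H s t [::].
by rewrite /cylinder /= set_nil bigcap_set0 setTI.
Qed.

Lemma probability_run (H : state -> bool) s t :
  P [set x | H (run w (coin^~ x) s t)] =
  (average t (fun s' => (H s')%:R) s)%:E.
Proof.
have [_] := run_cylinder H s t [::].
by rewrite /cylinder /= set_nil bigcap_set0 setTI expr0 mul1r.
Qed.

End Averages.

(** * Values of truncated runs *)

Section Values.
Variables (R : realType) (w : nat) (lam : R) (F : state -> R).

(* The expected payoff [F] at the final state plus [lam] per unit of running
   time, where runs of length at least [t] are cut at time [t] and earn no
   payoff. *)
Fixpoint value (t : nat) (s : state) : R :=
  if halted s then F s else
  if t is t'.+1 then
    lam + (value t' (step w true s) + value t' (step w false s)) / 2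
  else 0.

Lemma value_halted t s : halted s -> value t s = F s.
Proof. by case: t => [|t] /= ->. Qed.

Lemma average_halted t (f : state -> R) s : halted s -> average w t f s = f s.
Proof.
by elim: t s => [//|t IH] s hs /=; rewrite !halted_step // IH //; field.
Qed.

(** The mean of the truncated running time is written as the sum of the probabilities of still
    running at each time, which makes the later integral a series. *)
Lemma valueE t s : value t s =
  lam * (\sum_(i < t) average w i (fun s' => (~~ halted s')%:R : R) s) +
  average w t (fun s' => if halted s' then F s' else 0) s.
Proof.
elim: t s => [|t IH] s; first by rewrite big_ord0 mulr0 add0r.
have [hs|hs] := boolP (halted s).
  rewrite (value_halted _ hs) average_halted // hs big1 ?mulr0 ?add0r // => i _.
  by rewrite average_halted // hs.
rewrite big_ord_recl /= hs (negbTE hs) /= !IH.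
by rewrite -mulr_suml big_split /=; field.
Qed.

End Values.

(** * From bounds on values to exact sampling and expected time *)

Section Sampling.
Variables (R : realType) (w : nat).
Variables (d : measure_display) (Omega : measurableType d).
Variables (P : probability Omega R) (coin : nat -> {RV P >-> bool}).
Hypothesis fair : fair_coins coin.
Variable s0 : state.

Let ran x t := run w (coin^~ x) s0 t.

Lemma probability_payoff (H : state -> bool) t :
  P [set x | halted (ran x t) && H (ran x t)] =
  (value w 0 (fun s => (H s)%:R : R) t s0)%:E.
Proof.
rewrite valueE mul0r add0r.
rewrite (probability_run w fair (fun s => halted s && H s)); congr (_%:E).
elim: t s0 => [|t IH] s /=; last by rewrite !IH.
by case: (halted s); case: (H s).
Qed.

Lemma sum_probability_running t :
  (\sum_(i < t) P [set x | ~~ halted (ran x i)])%E =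
  (value w 1 (fun=> 0 : R) t s0)%:E.
Proof.
rewrite valueE mul1r.
rewrite (_ : average _ _ _ _ = 0) ?addr0; last first.
  elim: t s0 => [|t IH] s /=; first by case: ifP.
  by rewrite !IH addr0 mul0r.
rewrite -sumEFin; apply: eq_bigr => i _.
exact: (probability_run w fair (fun s => ~~ halted s)).
Qed.

Lemma measurable_ran (H : state -> bool) t : measurable [set x | H (ran x t)].
Proof. exact: measurable_run. Qed.

Lemma measurable_ever (H : state -> bool) :
  measurable [set x | exists t, H (ran x t)].
Proof.
have -> : [set x | exists t, H (ran x t)] = \bigcup_t [set x | H (ran x t)].
  by apply/seteqP; split=> x /= => [[t h]|[t _ h]]; exists t.
by apply: bigcupT_measurable => t; exact: measurable_ran.
Qed.

(** A halted machine no longer moves, so the events increase with t and continuity from below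
    carries the bound to the limit. *)
Lemma probability_ever_le (H : state -> bool) (c : R) :
  (forall t, value w 0 (fun s => (H s)%:R) t s0 <= c) ->
  (P [set x | exists t, halted (ran x t) && H (ran x t)] <= c%:E)%E.
Proof.
move=> le_c; pose G t := [set x | halted (ran x t) && H (ran x t)].
have mG t : measurable (G t) by exact: (measurable_ran (fun s => halted s && H s)).
have -> : [set x | exists t, halted (ran x t) && H (ran x t)] = \bigcup_t G t.
  by apply/seteqP; split=> x /= => [[t h]|[t _ h]]; exists t.
have cvgG : P (G n) @[n --> \oo] --> P (\bigcup_n G n).
  apply: nondecreasing_cvg_mu => //; first exact: bigcupT_measurable.
  move=> t t' le_tt'; apply/subsetPset => x /andP[h1 h2].
  by rewrite /G /= /ran (halted_run le_tt' h1) h1.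
rewrite -(cvg_lim _ cvgG) //; apply: lime_le; first by apply/cvg_ex; eexists; exact: cvgG.
by apply: nearW => t; rewrite probability_payoff lee_fin.
Qed.

Section Bounded.
Variable bound : R.
Hypothesis le_bound : forall t, value w 1 (fun=> 0 : R) t s0 <= bound.

(** A run that never halts is still running at each of the times below n, so n times its probability
    is at most [bound] for all n. *)
Lemma never_halting : P [set x | forall t, ~~ halted (ran x t)] = 0%E.
Proof.
set A := [set x | _].
have mA : measurable A.
  rewrite -[A]setCK; apply: measurableC.
  have -> : ~` A = [set x | exists t, halted (ran x t)].
    apply/seteqP; split=> x /=.
      by move/existsNP => [t /negP]; rewrite negbK; exists t.
    by move=> [t ht] /(_ t); rewrite ht.
  exact: measurable_ever.
have finA : P A \is a fin_num by exact: fin_num_measure.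
have le_n (n : nat) : n%:R * fine (P A) <= bound.
  rewrite -lee_fin.
  have -> : (n%:R * fine (P A))%:E = (\sum_(i < n) P A)%E.
    by rewrite -(fineK finA) sumEFin sumr_const card_ord mulr_natl.
  apply: le_trans (_ : (\sum_(i < n) P [set x | ~~ halted (ran x i)] <= _)%E).
    apply: lee_sum => i _; apply: le_measure; rewrite ?inE //.
      exact: (measurable_ran (fun s => ~~ halted s)).
    by move=> x; apply.
  by rewrite sum_probability_running lee_fin.
have : 0 <= fine (P A) by exact: fine_ge0.
rewrite le_eqVlt => /orP[/eqP A0|A0]; first by rewrite -[LHS]fineK // -A0.
have b0 : 0 <= bound by have := le_n 0%N; rewrite mul0r.
have := archi_boundP (divr_ge0 b0 (ltW A0)).
by rewrite ltr_pdivrMr // ltNge le_n.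
Qed.

(** The running time counts the instants at which the machine has not halted, and the series
    diverges to +oo when it never does. Sum and integral can then be exchanged. *)
Lemma runtime_series prog n (e : rel 'I_n) k x : s0 = init prog e k ->
  runtime R prog w e k (coin^~ x) =
  (\sum_(0 <= t <oo) (\1_[set x | ~~ halted (ran x t)] x)%:E)%E.
Proof.
move=> s0E; rewrite /runtime -s0E.
have ge0 t : (0 <= (\1_[set x | ~~ halted (ran x t)] x)%:E :> \bar R)%E.
  by rewrite lee_fin.
have run1 t : (forall t', (t' < t)%N -> ~~ halted (ran x t')) ->
    (t%:R%:E <= \sum_(0 <= t <oo) (\1_[set x | ~~ halted (ran x t)] x)%:E :> \bar R)%E.
  move=> ht; apply: le_trans (_ : (\sum_(0 <= i < t) (\1_[set x | ~~ halted (ran x i)] x)%:E <= _)%E); last first.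
    by apply: nneseries_lim_ge => i _ _.
  rewrite big_nat sumEFin lee_fin.
  rewrite (eq_bigr (fun=> 1)); last first.
    by move=> i /ht hi; rewrite indicE mem_set.
  by rewrite -big_nat sumr_const_nat subn0.
apply/eqP; rewrite eq_le; apply/andP; split; last first.
  apply: le_ereal_inf_tmp => _ [t ht <-].
  apply: lime_le; first exact: is_cvg_nneseries.
  apply: nearW => m; rewrite sumEFin lee_fin.
  have halts i : (t <= i)%N -> ~~ halted (ran x i) = false.
    by move=> le_ti; rewrite /ran (halted_run le_ti ht) ht.
  rewrite (@le_trans _ _ (\sum_(0 <= i < m) (i < t)%N%:R)) //.
    apply: ler_sum_nat => i _; rewrite indicE; case: ltnP => [_|/halts hi].
      by case: (_ \in _).
    by rewrite memNset //= hi.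
  rewrite -natr_sum ler_nat.
  suff /andP[] : (\sum_(0 <= i < m) (i < t) <= t)%N &&
                 (\sum_(0 <= i < m) (i < t) <= m)%N by [].
  elim: m {halts} => [|m /andP[IH1 IH2]]; first by rewrite big_geq.
  by rewrite big_nat_recr //=; case: (ltnP m t) => h; rewrite ?addn0 ?addn1; lia.
have [[t ht]|no] := pselect (exists t, halted (ran x t)).
  case: (ex_minnP (ex_intro (fun t => halted (ran x t)) t ht)) => m hm min_m.
  apply: le_trans (run1 m _); first by apply: ereal_inf_lbound; exists m.
  by move=> t' lt_t'; apply/negP => /min_m; lia.
rewrite (_ : (\sum_(0 <= t <oo) _)%E = +oo%E) ?leey //.
apply: eq_infty => r; have [r0|r0] := leP 0 r; last first.
  by apply: le_trans (run1 0%N _) => //; rewrite lee_fin ltW.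
apply: le_trans (run1 (Num.bound r) _).
  by rewrite lee_fin ltW // archi_boundP.
by move=> t' _; apply/negP => ht; apply: no; exists t'.
Qed.

Lemma expected_time_le prog n (e : rel 'I_n) k : s0 = init prog e k ->
  (expected_time coin prog w e k <= bound%:E)%E.
Proof.
move=> s0E; rewrite /expected_time.
rewrite (eq_integral _ _ (fun x _ => runtime_series x s0E)).
have mN t : measurable [set x | ~~ halted (ran x t)].
  exact: (measurable_ran (fun s => ~~ halted s)).
rewrite integral_nneseries //; last first.
  by move=> t; apply/measurable_realfun.measurable_EFinP; exact: measurable_realfun.measurable_indic.
apply: lime_le; first by apply: is_cvg_nneseries => t _ _; apply: integral_ge0 => x _; rewrite lee_fin.
apply: nearW => m.
rewrite (eq_bigr (fun t => P [set x | ~~ halted (ran x t)])); last first.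
  by move=> t _; rewrite integral_indic // setIT.
by rewrite big_mkord sum_probability_running lee_fin.
Qed.

(** Non-halting runs and improper outputs are null, so the N proper outputs cover a set of
    probability 1. Each has probability at most 1/N; the other N - 1 take at most (N - 1)/N by the
    union bound, which leaves at least 1/N for the chosen one. *)
Lemma samples_uniformly_of_bounds prog n (e : rel 'I_n) k :
  s0 = init prog e k ->
  let output s (chi : {ffun 'I_n -> 'I_k}) :=
    [forall v : 'I_n, memory s v == chi v :> nat] in
  (forall chi, proper_coloring e chi -> forall t,
     value w 0 (fun s => (output s chi)%:R : R) t s0 <= (num_proper k e)%:R^-1) ->
  (forall t, value w 0
     (fun s => (~~ [exists chi, proper_coloring e chi && output s chi])%:R : R)
     t s0 <= 0) ->
  samples_uniformly coin prog w e k.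
Proof.
move=> s0E output le_chi le_bad; rewrite /samples_uniformly.
pose O chi : set Omega := [set x | exists t, halted (ran x t) && output (ran x t) chi].
have outE chi : [set x | outputs prog w e (coin^~ x) chi] = O chi.
  apply/seteqP; split=> x /= [t].
    rewrite -s0E => -[h1 h2]; exists t; rewrite /ran h1.
    by apply/forallP => v; apply/eqP.
  move=> /andP[h1 /forallP h2]; exists t; rewrite -s0E; split=> // v.
  exact/eqP.
pose good s := [exists chi, proper_coloring e chi && output s chi].
pose G : set Omega := [set x | exists t, halted (ran x t) && good (ran x t)].
have mO chi : measurable (O chi).
  exact: (measurable_ever (fun s => halted s && output s chi)).
have mG : measurable G by exact: (measurable_ever (fun s => halted s && good s)).
have PG1 : P G = 1%E.
  pose B : set Omega := [set x | exists t, halted (ran x t) && ~~ good (ran x t)].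
  have mB : measurable B by exact: (measurable_ever (fun s => halted s && ~~ good s)).
  have mN : measurable [set x | forall t, ~~ halted (ran x t)].
    have -> : [set x | forall t, ~~ halted (ran x t)] = \bigcap_t [set x | ~~ halted (ran x t)].
      by apply/seteqP; split=> x /= h t; [move=> _|]; exact: h.
    by apply: bigcapT_measurable => t; exact: (measurable_ran (fun s => ~~ halted s)).
  have PGC : P (~` G) = 0%E.
    apply/eqP; rewrite -measure_le0.
    apply: le_trans (_ : (P ([set x | forall t, ~~ halted (ran x t)] `|` B) <= _)%E).
      apply: le_measure; rewrite ?inE //; first exact: measurableC.
        exact: measurableU.
      move=> x /= nG; have [[t ht]|no] := pselect (exists t, halted (ran x t)).
        right; exists t; rewrite ht /=; apply/negP => gd; apply: nG.
        by exists t; rewrite ht.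
      by left => t; apply/negP => ht; apply: no; exists t.
    apply: le_trans (measureU2 _ _ _) _ => //.
    by rewrite [X in (X + _)%E]never_halting add0e; exact: (probability_ever_le le_bad).
  by rewrite -[G]setCK probability_setC ?PGC ?sube0 //; exact: measurableC.
have Ole chi : proper_coloring e chi -> (P (O chi) <= ((num_proper k e)%:R^-1)%:E)%E.
  by move=> pc; exact: (@probability_ever_le (fun s => output s chi) _ (le_chi chi pc)).
have unionP (s : seq {ffun 'I_n -> 'I_k}) : all (proper_coloring e) s ->
    measurable (\big[setU/set0]_(chi <- s) O chi) /\
    (P (\big[setU/set0]_(chi <- s) O chi) <=
     ((size s)%:R * (num_proper k e)%:R^-1)%:E)%E.
  elim: s => [_|chi s IH /= /andP[pc /IH [mU leU]]].
    by rewrite big_nil mul0r measure0.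
  rewrite big_cons; split; first exact: measurableU.
  apply: le_trans (measureU2 _ _ _) _ => //.
  by rewrite -nat1r mulrDl mul1r EFinD leeD // Ole.
have GU x : G x -> exists2 chi, proper_coloring e chi & O chi x.
  move=> [t /andP[ht /existsP[chi /andP[pc oc]]]]; exists chi => //.
  by exists t; rewrite ht.
have inU (s : seq {ffun 'I_n -> 'I_k}) chi x : chi \in s -> O chi x ->
    (\big[setU/set0]_(chi <- s) O chi) x.
  move=> cs Ox; rewrite -bigcup_seq; by exists chi.
split.
  rewrite (_ : [set x | _] = G) //; apply/seteqP; split=> x /=.
    move=> [chi pc h]; have [t /andP[ht oc]] : O chi x by rewrite -outE.
    exists t; rewrite ht /=.
    by apply/existsP; exists chi; rewrite pc.
  move=> /GU[chi pc Ox]; exists chi => //.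
  by move: Ox; rewrite -outE.
move=> chi pc; rewrite outE; apply/eqP; rewrite eq_le Ole //=.
pose S := [set chi : {ffun 'I_n -> 'I_k} | proper_coloring e chi]%SET.
have inS chi' : (chi' \in S) = proper_coloring e chi' by rewrite inE.
pose s := enum (S :\ chi)%SET.
have alls : all (proper_coloring e) s.
  by apply/allP => c; rewrite mem_enum !inE => /andP[].
have [mU leU] := unionP s alls.
have szs : (num_proper k e = (size s).+1)%N.
  by rewrite /num_proper -/S (cardsD1 chi) inS pc add1n /s -cardE.
have N0 : (num_proper k e)%:R != 0 :> R by rewrite szs pnatr_eq0.
have : (1 <= P (O chi) + P (\big[setU/set0]_(chi <- s) O chi))%E.
  rewrite -PG1; apply: le_trans (measureU2 _ _ _) => //.
  apply: le_measure; rewrite ?inE //; first exact: measurableU.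
  move=> x /GU [c pcc Ox]; have [->|ne] := eqVneq chi c; [by left|right].
  by apply: (inU s c) => //; rewrite mem_enum !inE eq_sym ne.
have finO : P (O chi) \is a fin_num by exact: fin_num_measure.
have finU : P (\big[setU/set0]_(chi <- s) O chi) \is a fin_num by exact: fin_num_measure.
rewrite -(fineK finO); move: leU; rewrite -(fineK finU) -EFinD !lee_fin => h1 h2.
have : (size s)%:R = (num_proper k e)%:R - 1 :> R by rewrite szs -natr1 addrK.
move=> szE; move: h1; rewrite szE mulrBl mulfV // mul1r; lra.
Qed.

End Bounded.
End Sampling.

Local Close Scope classical_set_scope.
Local Close Scope ring_scope.

(** * Upper bounds on the value of a program *)

Definition upd (T : Type) (f : nat -> T) (i : nat) (v : T) : nat -> T :=
  fun j => if j == i then v else f j.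
Arguments upd {T} f i v j /.

Definition upd2 (A : nat -> nat -> nat) (a i v : nat) : nat -> nat -> nat :=
  fun b j => if (b == a) && (j == i) then v else A b j.
Arguments upd2 A a i v b j /.

Definition operand_value (rg : nat -> nat) (o : operand) : nat :=
  match o with Reg r => rg r | Cst x => x end.

(** Constants up to 8 are unaffected by reduction modulo the word size, and register 0 is excluded
    because its content is not tracked. *)
Definition operand_ok (o : operand) : bool :=
  match o with Reg r => 0 < r | Cst x => x <= 8 end.

Definition fresh (T : seq nat) (o : operand) : bool :=
  match o with Reg r => r \notin T | Cst _ => true end.

Definition frame (T : seq nat) (rg rg' : nat -> nat) : Prop :=
  forall r, r \notin T -> rg' r = rg r.

Lemma frame_refl T rg : frame T rg rg.
Proof. by []. Qed.

Lemma frame_upd T rg rg' r v :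
  r \in T -> frame T rg rg' -> frame T rg (upd rg' r v).
Proof.
by move=> rT fr r' r'T /=; case: eqP r'T => [->|_ r'T]; [rewrite rT|exact: fr].
Qed.

Lemma frame_sub T T' rg rg' :
  {subset T <= T'} -> frame T rg rg' -> frame T' rg rg'.
Proof. by move=> sub fr r hr; apply: fr; apply: contra hr; exact: sub. Qed.

Lemma frame_trans T T' rg rg' rg'' :
  {subset T <= T'} -> frame T rg rg' -> frame T' rg' rg'' -> frame T' rg rg''.
Proof.
move=> sub fr fr' r rT'; rewrite fr' // fr //.
by apply: contra rT'; exact: sub.
Qed.

(* Register 0 is scratch space; register 1 holds the address of the first free
   cell.  From there on, the memory interleaves seven arrays. *)
Definition array_address (a : nat) (i : operand) : cmd :=
  Seq (Op Mul 0 i (Cst 8)) (Seq (Op Add 0 (Reg 0) (Cst a)) (Op Add 0 (Reg 0) (Reg 1))).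

Definition load (r a : nat) (i : operand) : cmd :=
  Seq (array_address a i) (Read r (Reg 0)).

Definition store (a : nat) (i x : operand) : cmd :=
  Seq (array_address a i) (Write (Reg 0) x).

Definition move (r : nat) (x : operand) : cmd := Op Add r x (Cst 0).

Fixpoint block (l : seq cmd) : cmd :=
  match l with
  | [::] => Skip
  | [:: p] => p
  | p :: l' => Seq p (block l')
  end.

(* [sample m test] puts a uniform element of {j < m | test succeeds on j} into
   register 20, where [test] clears register 24 to accept. *)
Definition sample (m : operand) (test : cmd) : cmd :=
  block [:: move 24 (Cst 1);
    While (Reg 24) (block
      [:: move 21 (Cst 1);
          move 20 (Cst 0);
          Op Lt 22 (Reg 21) m;
          While (Reg 22) (block
            [:: Toss 23;
                Op Add 20 (Reg 20) (Reg 20);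
                Op Add 20 (Reg 20) (Reg 23);
                Op Add 21 (Reg 21) (Reg 21);
                Op Lt 22 (Reg 21) m]);
          Op Lt 22 (Reg 20) m;
          If (Reg 22) test Skip])].

Definition bits_regs : seq nat := [:: 20; 21; 22; 23].
Definition sample_regs : seq nat := bits_regs ++ [:: 24; 25].

(** * Rules for bounding the value of a command *)

Section Logic.
Variables (R : realType) (w : nat) (lam : R) (F : state -> R).
Hypothesis lam_ge0 : (0 <= lam)%R.
Hypothesis F_ge0 : forall s, (0 <= F s)%R.
Variables (B M : nat).
Hypothesis enough_words : B + 8 * M + 8 < 2 ^ w.

Lemma value_ge0 t s : (0 <= value w lam F t s)%R.
Proof.
elim: t s => [|t IH] s /=; first by case: ifP.
by case: ifP => // _; rewrite addr_ge0 // divr_ge0 // addr_ge0.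
Qed.

(* Array 7 stands for the memory cells below [B]. *)
Definition represents (rg : nat -> nat) (A : nat -> nat -> nat)
    (regs mem : nat -> nat) : Prop :=
  [/\ forall r, 0 < r -> regs r = rg r,
      forall a j, a < 7 -> j < M -> mem (B + 8 * j + a) = A a j
    & forall i, i < B -> mem i = A 7 i].

(* [u] units of time have been spent out of [c]. *)
Definition ub (t : nat) (s : state) (u c : nat) (b : R) : Prop :=
  forall t', t' <= t ->
  (value w lam F t' s + lam * u%:R <= lam * c%:R + b)%R.

Definition UB (t : nat) (K : seq cmd) (rg : nat -> nat) (A : nat -> nat -> nat)
    (u c : nat) (b : R) : Prop :=
  forall regs mem, represents rg A regs mem -> ub t (State K regs mem) u c b.

Lemma ub_sub t t' s u u' c c' (b b' : R) :
  t' <= t -> u' + c <= c' + u -> (b <= b')%R -> ub t s u c b -> ub t' s u' c' b'.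
Proof.
move=> le_t le_u le_b H t0 le_t0.
have := H t0 (leq_trans le_t0 le_t).
have : (lam * (u' + c)%:R <= lam * (c' + u)%:R)%R by rewrite ler_wpM2l // ler_nat.
by rewrite !natrD !mulrDr; lra.
Qed.

Lemma UB_sub t t' K rg A u u' c c' (b b' : R) :
  t' <= t -> u' + c <= c' + u -> (b <= b')%R ->
  UB t K rg A u c b -> UB t' K rg A u' c' b'.
Proof. by move=> h1 h2 h3 H regs mem rep; apply: ub_sub h1 h2 h3 (H _ _ rep). Qed.

Lemma UB_shift t K rg A u u' c (b b' : R) :
  (b + lam * u'%:R <= b' + lam * u%:R)%R ->
  UB t K rg A u c b -> UB t K rg A u' c b'.
Proof. by move=> le_b H regs mem rep t' le_t'; have := H _ _ rep _ le_t'; lra. Qed.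

(** A bound about no machine state is void, so one represented state may be assumed. [UB_spent_le]
    then turns a bound on a continuation into a plain inequality between the time spent and the
    budget. *)
Lemma UB_inhabited t K rg A u c (b : R) :
  ((exists regs mem, represents rg A regs mem) -> UB t K rg A u c b) ->
  UB t K rg A u c b.
Proof. by move=> H regs mem rep; apply: H => //; exists regs, mem. Qed.

Lemma UB_spent_le t K rg A u c (b : R) regs mem :
  represents rg A regs mem -> UB t K rg A u c b ->
  (lam * u%:R <= lam * c%:R + b)%R.
Proof.
by move=> rep /(_ _ _ rep 0 (leq0n _)); have := value_ge0 0 (State K regs mem); lra.
Qed.

Lemma UB_le t K rg A u c (b b' : R) :
  (b <= b')%R -> UB t K rg A u c b -> UB t K rg A u c b'.
Proof. by move=> h H; apply: UB_sub H => //; rewrite addnC. Qed.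

Lemma UB_time t t' K rg A u c (b : R) :
  t' <= t -> UB t K rg A u c b -> UB t' K rg A u c b.
Proof. by move=> h H; apply: UB_sub H => //; rewrite addnC. Qed.

Lemma UB_0 p K rg A u c (b : R) :
  (lam * u%:R <= lam * c%:R + b)%R -> UB 0 (p :: K) rg A u c b.
Proof.
by move=> h regs mem rep t'; rewrite leqn0 => /eqP -> /=; rewrite add0r.
Qed.

Lemma ub_step t s s' u c (b : R) :
  ~~ halted s -> (forall bit, step w bit s = s') ->
  ub t.-1 s' u.+1 c b -> ub t s u c b.
Proof.
move=> hs stepE H t' le_t'.
have uE : (lam * u.+1%:R = lam * u%:R + lam)%R by rewrite -natr1 mulrDr mulr1.
case: t' le_t' => [_|t' le_t'] /=; rewrite (negbTE hs).
  (* With no time left the run is worth 0, and the inequality required is inherited from the next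
     state, whose value is nonnegative. *)
  have := H 0 (leq0n _); have := value_ge0 0 s'; rewrite uE.
  by move: lam_ge0; lra.
by rewrite !stepE; have := H t' ltac:(lia); rewrite uE; lra.
Qed.

Lemma ub_pred t s u c (b : R) : ub t s u c b -> ub t.-1 s u c b.
Proof. by move=> H t' le_t'; apply: H; lia. Qed.

Lemma ub_seq t p q K regs mem u c (b : R) :
  ub t (State [:: p, q & K] regs mem) u.+1 c b ->
  ub t (State (Seq p q :: K) regs mem) u c b.
Proof.
by move=> H; apply: (ub_step (s' := State [:: p, q & K] regs mem)) => //; exact: ub_pred.
Qed.

Lemma ub_op t o r x y v K regs mem u c (b : R) :
  let s := State (Op o r x y :: K) regs mem in
  v = eval_op o (Defs.eval w s x) (Defs.eval w s y) -> v < 2 ^ w ->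
  ub t (State K [eta regs with r |-> v] mem) u.+1 c b ->
  ub t s u c b.
Proof.
move=> s vE lt_v H; apply: (ub_step (s' := State K [eta regs with r |-> v] mem)) => //.
  by move=> bit; rewrite -[v in RHS](modn_small lt_v) vE.
exact: ub_pred.
Qed.

Lemma UB_det t p K rg A K' rg' A' u c (b : R) :
  (forall regs mem, represents rg A regs mem ->
    exists regs' mem', represents rg' A' regs' mem' /\
      forall bit, step w bit (State (p :: K) regs mem) = State K' regs' mem') ->
  UB t.-1 K' rg' A' u.+1 c b -> UB t (p :: K) rg A u c b.
Proof.
move=> det H regs mem rep; have [regs' [mem' [rep' stepE]]] := det _ _ rep.
by apply: ub_step stepE _ => //; exact: H.
Qed.

Lemma operand_ok_lt8 (x : nat) : x <= 8 -> x < 2 ^ w.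
Proof. by move=> h; apply: leq_ltn_trans enough_words; clear -h; lia. Qed.

Lemma eval_operand rg A K regs mem o : represents rg A regs mem -> operand_ok o ->
  Defs.eval w (State K regs mem) o = operand_value rg o.
Proof.
move=> [h _ _]; case: o => [r|x] /= ok; first exact: h.
by rewrite modn_small // operand_ok_lt8.
Qed.

Lemma UB_seq t p q K rg A u c (b : R) :
  UB t [:: p, q & K] rg A u.+1 c b -> UB t (Seq p q :: K) rg A u c b.
Proof.
move=> H; apply: (@UB_det _ _ _ _ _ [:: p, q & K] rg A).
  by move=> regs mem rep; exists regs, mem.
by apply: UB_time H; lia.
Qed.

Lemma UB_skip t K rg A u c (b : R) :
  UB t K rg A u.+1 c b -> UB t (Skip :: K) rg A u c b.
Proof.
move=> H; apply: (@UB_det _ _ _ _ _ K rg A).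
  by move=> regs mem rep; exists regs, mem.
by apply: UB_time H; lia.
Qed.

Lemma represents_upd rg A regs mem r v :
  represents rg A regs mem ->
  represents (upd rg r v) A [eta regs with r |-> v] mem.
Proof.
move=> [h1 h2 h3]; split=> // r' r'0 /=.
by case: eqP => // _; exact: h1.
Qed.

Lemma UB_op t o r x y K rg A u c (b : R) :
  operand_ok x -> operand_ok y ->
  eval_op o (operand_value rg x) (operand_value rg y) < 2 ^ w ->
  UB t K (upd rg r (eval_op o (operand_value rg x) (operand_value rg y))) A u.+1 c b ->
  UB t (Op o r x y :: K) rg A u c b.
Proof.
move=> okx oky lt_v H.
apply: (@UB_det _ _ _ _ _ K (upd rg r (eval_op o (operand_value rg x) (operand_value rg y))) A).
  move=> regs mem rep.
  exists [eta regs with r |-> eval_op o (operand_value rg x) (operand_value rg y)], mem.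
  split; first exact: represents_upd.
  move=> bit; rewrite /step /= !(eval_operand _ rep) // modn_small //.
by apply: UB_time H; lia.
Qed.

Lemma UB_if t a p q K rg A u c (b : R) :
  operand_ok a ->
  UB t ((if operand_value rg a != 0 then p else q) :: K) rg A u.+1 c b ->
  UB t (If a p q :: K) rg A u c b.
Proof.
move=> ok H.
apply: (@UB_det _ _ _ _ _ ((if operand_value rg a != 0 then p else q) :: K) rg A).
  move=> regs mem rep; exists regs, mem; split=> // bit.
  by rewrite /step /= (eval_operand _ rep).
by apply: UB_time H; lia.
Qed.

(** Of the rules for commands, this one alone hands on a smaller t: each test takes a step.
    Unbounded loops are thereby handled by induction on t, and all other rules keep t for
    simplicity. *)
Lemma UB_while t a p K rg A u c (b : R) :
  operand_ok a ->
  UB t.-1 (if operand_value rg a != 0 then [:: p, While a p & K] else K) rg A u.+1 c b ->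
  UB t (While a p :: K) rg A u c b.
Proof.
move=> ok H.
apply: (@UB_det _ _ _ _ _ (if operand_value rg a != 0 then [:: p, While a p & K] else K) rg A); last by [].
move=> regs mem rep; exists regs, mem; split=> // bit.
by rewrite /step /= (eval_operand _ rep).
Qed.

Lemma UB_toss t r K rg A u c (b1 b2 b : R) :
  UB t K (upd rg r 1) A u.+1 c b1 -> UB t K (upd rg r 0) A u.+1 c b2 ->
  ((b1 + b2) / 2 <= b)%R ->
  UB t (Toss r :: K) rg A u c b.
Proof.
move=> H1 H2 le_b regs mem rep t' le_t'.
have rep1 := represents_upd r 1 rep; have rep2 := represents_upd r 0 rep.
have uE : (lam * u.+1%:R = lam * u%:R + lam)%R by rewrite -natr1 mulrDr mulr1.
case: t' le_t' => [_|t' le_t'] /=.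
  have := H1 _ _ rep1 0 (leq0n _); have := H2 _ _ rep2 0 (leq0n _).
  have := value_ge0 0 (State K [eta regs with r |-> 1]%N mem).
  have := value_ge0 0 (State K [eta regs with r |-> 0]%N mem).
  by rewrite uE; move: lam_ge0; lra.
rewrite /step /= !modn_small ?operand_ok_lt8 //.
have := H1 _ _ rep1 t' ltac:(lia); have := H2 _ _ rep2 t' ltac:(lia).
by rewrite uE; lra.
Qed.

(** The computation of the address only changes register 0, which [represents] does not mention; the
    six units are its three operations and three sequencings. *)
Lemma ub_address t a i p K rg A regs mem u c (b : R) :
  represents rg A regs mem -> operand_ok i -> rg 1 = B -> a < 7 ->
  operand_value rg i < M ->
  (forall regs', (forall r, 0 < r -> regs' r = rg r) ->
     regs' 0 = B + 8 * operand_value rg i + a ->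
     ub t (State (p :: K) regs' mem) (u + 6) c b) ->
  ub t (State (Seq (array_address a i) p :: K) regs mem) u c b.
Proof.
move=> rep oki rg1 lt_a lt_i H.
have lt8 : operand_value rg i * 8 < 2 ^ w.
  by apply: leq_ltn_trans enough_words; lia.
have lta : operand_value rg i * 8 + a < 2 ^ w.
  by apply: leq_ltn_trans enough_words; lia.
have ltB : operand_value rg i * 8 + a + B < 2 ^ w.
  by apply: leq_ltn_trans enough_words; lia.
have lt_a' : a < 2 ^ w by apply: operand_ok_lt8; lia.
have H8 : 8 < 2 ^ w by apply: operand_ok_lt8.
have [h1 _ _] := rep.
have eval_i K' : Defs.eval w (State K' regs mem) i = operand_value rg i.
  exact: (eval_operand _ rep).
apply: ub_seq; apply: ub_seq.
apply: (ub_op (v := operand_value rg i * 8)) => //.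
  by rewrite eval_i /= modn_small.
apply: ub_seq.
apply: (ub_op (v := operand_value rg i * 8 + a)) => //.
  by rewrite /= modn_small.
apply: (ub_op (v := operand_value rg i * 8 + a + B)) => //.
  by rewrite /= h1 // rg1.
apply: (ub_sub (leqnn t) _ (lexx b) (H _ _ _)) => /=; first by lia.
- by move=> r r0 /=; rewrite !gtn_eqF //; exact: h1.
- by lia.
Qed.

Lemma UB_load t r a i K rg A u c (b : R) :
  0 < r -> operand_ok i -> rg 1 = B -> a < 7 -> operand_value rg i < M ->
  UB t K (upd rg r (A a (operand_value rg i))) A (u + 7) c b ->
  UB t (load r a i :: K) rg A u c b.
Proof.
move=> r0 oki rg1 lt_a lt_i H regs mem rep.
apply: (ub_address rep) => // regs' h h0.
have [h1 h2 h3] := rep.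
apply: (ub_step (s' := State K [eta regs' with r |-> A a (operand_value rg i)] mem)) => //.
  by move=> bit; rewrite -(h2 a) // -h0.
rewrite -[(u + 6).+1]addnS; apply: ub_pred.
apply: H; split=> // r' r'0 /=.
by case: eqP => // _; exact: h.
Qed.

Lemma UB_store t a i x K rg A u c (b : R) :
  operand_ok i -> operand_ok x -> rg 1 = B -> a < 7 -> operand_value rg i < M ->
  UB t K rg (upd2 A a (operand_value rg i) (operand_value rg x)) (u + 7) c b ->
  UB t (store a i x :: K) rg A u c b.
Proof.
move=> oki okx rg1 lt_a lt_i H regs mem rep.
apply: (ub_address rep) => // regs' h h0.
have [h1 h2 h3] := rep.
have eval_x K' : Defs.eval w (State K' regs' mem) x = operand_value rg x.
  case: x okx {H} => [r|x] /= ok; first exact: h.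
  by rewrite modn_small // operand_ok_lt8.
apply: (ub_step (s' := State K regs'
  [eta mem with B + 8 * operand_value rg i + a |-> operand_value rg x])) => //.
  by move=> bit; rewrite -(eval_x (Write (Reg 0) x :: K)) -h0.
rewrite -[(u + 6).+1]addnS; apply: ub_pred.
apply: H; split=> //= [a' j lt_a' lt_j|j lt_j].
  case: ifPn => /eqP E; last first.
    case: ifP => [/andP[/eqP ? /eqP ?]|_]; [by subst|exact: h2].
  have [-> ->] : a' = a /\ j = operand_value rg i by clear -E lt_a lt_a'; lia.
  by rewrite !eqxx.
case: eqP => [?|_]; first by lia.
by rewrite gtn_eqF //=; exact: h3.
Qed.

Lemma UB_read t r i K rg A u c (b : R) :
  operand_ok i -> operand_value rg i < B ->
  UB t K (upd rg r (A 7 (operand_value rg i))) A u.+1 c b ->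
  UB t (Read r i :: K) rg A u c b.
Proof.
move=> oki lt_i H regs mem rep.
have [h1 h2 h3] := rep.
apply: (ub_step (s' := State K [eta regs with r |-> A 7 (operand_value rg i)] mem)) => //.
  by move=> bit; rewrite -h3 // -(eval_operand (Read r i :: K) rep).
apply: ub_pred.
by apply: H; exact: represents_upd.
Qed.

Lemma UB_write t i x K rg A u c (b : R) :
  operand_ok i -> operand_ok x -> operand_value rg i < B ->
  UB t K rg (upd2 A 7 (operand_value rg i) (operand_value rg x)) u.+1 c b ->
  UB t (Write i x :: K) rg A u c b.
Proof.
move=> oki okx lt_i H regs mem rep.
have [h1 h2 h3] := rep.
apply: (ub_step (s' := State K regs [eta mem with operand_value rg i |-> operand_value rg x])) => //.
  by move=> bit; rewrite -!(eval_operand (Write i x :: K) rep).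
apply: ub_pred.
apply: H; split=> //= [a' j lt_a' lt_j|j lt_j].
  rewrite (ltn_eqF lt_a') /= gtn_eqF; first exact: h2.
  by clear -lt_i; lia.
by case: eqP => // _; exact: h3.
Qed.

Lemma UB_move t r x K rg A u c (b : R) :
  operand_ok x -> operand_value rg x < 2 ^ w ->
  UB t K (upd rg r (operand_value rg x)) A u.+1 c b ->
  UB t (move r x :: K) rg A u c b.
Proof. by move=> okx lt_x H; apply: UB_op => //=; rewrite addn0. Qed.

(* From [rg] and [A], the command [p] takes expected time at most [cost] and
   behaves like [d]: an outcome [y] of [d] yields a state satisfying [Post y]. *)
Definition spec (p : cmd) (rg : nat -> nat) (A : nat -> nat -> nat) (cost : nat)
    (T : Type) (d : dist T)
    (Post : T -> (nat -> nat) -> (nat -> nat -> nat) -> Prop) : Prop :=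
  forall t K u c (g : T -> R),
  (forall y rg' A', Post y rg' A' -> UB t K rg' A' (u + cost) c (g y)) ->
  UB t (p :: K) rg A u c (expect d g).

Lemma UB_call t p K rg A cost T (d : dist T) Post u c (g : T -> R) (b : R) :
  spec p rg A cost d Post -> (expect d g <= b)%R ->
  (forall y rg' A', Post y rg' A' -> UB t K rg' A' (u + cost) c (g y)) ->
  UB t (p :: K) rg A u c b.
Proof. by move=> H le_b H'; apply: UB_sub (H _ _ _ _ _ H') => //; rewrite addnC. Qed.

Lemma spec_sub p rg A cost cost' T (d : dist T)
    (Post Post' : T -> (nat -> nat) -> (nat -> nat -> nat) -> Prop) :
  cost <= cost' -> (forall y rg' A', Post y rg' A' -> Post' y rg' A') ->
  spec p rg A cost d Post -> spec p rg A cost' d Post'.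
Proof.
move=> le_cost sub H t K u c g H'; apply: H => y rg' A' /sub /H'.
by apply: UB_sub => //; lia.
Qed.

(** The list of iterations still to be run is the variant, so the induction is on this list and not
    on t. The added units pay for the tests. *)
Lemma spec_while (I T : Type) (f : I -> T -> dist T)
    (Inv : seq I -> T -> (nat -> nat) -> (nat -> nat -> nat) -> Prop) a body cb :
  operand_ok a ->
  (forall l y rg A, Inv l y rg A -> (operand_value rg a != 0) = ~~ nilp l) ->
  (forall i l y rg A, Inv (i :: l) y rg A ->
     spec body rg A cb (f i y) (Inv l)) ->
  forall l y rg A, Inv l y rg A ->
  spec (While a body) rg A (size l * cb.+1).+1 (foldM f l y) (Inv [::]).
Proof.
move=> oka testP bodyP; elim=> [|i l IH] y rg A inv t K u c g H.
  apply: UB_while => //; rewrite (testP _ _ _ _ inv) /=.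
  by apply: UB_sub (H _ _ _ inv) => //; lia.
apply: UB_while => //; rewrite (testP _ _ _ _ inv) /= expect_bind.
apply: (@UB_time t); first lia.
apply: (bodyP _ _ _ _ _ inv) => y' rg' A' inv'.
apply: (IH _ _ _ inv') => y'' rg'' A'' inv''.
by apply: UB_sub (H _ _ _ inv'') => //=; lia.
Qed.

(** * Uniform sampling by rejection from fair bits *)

Section Sample.
Variables (m : operand) (mm : nat) (T : seq nat).
Hypothesis mm_gt0 : 0 < mm.
Hypothesis mm_small : 2 * mm < 2 ^ w.
Hypothesis m_ok : operand_ok m.
Hypothesis m_fresh : fresh sample_regs m.

Lemma operand_value_frame rg rg' :
  frame sample_regs rg rg' -> operand_value rg' m = operand_value rg m.
Proof.
by case: m m_fresh => //= r r_fresh; apply.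
Qed.

Lemma up_log_doubling i : (2 ^ i < mm) = (i < up_log 2 mm).
Proof.
apply/idP/idP => [lt_i|lt_i].
  rewrite ltnNge; apply/negP => /(leq_pexp2l (isT : 0 < 2)).
  by move/(leq_trans (up_logP mm (isT : 1 < 2))); rewrite leqNgt lt_i.
by rewrite ltnNge; apply/negP => /(up_log_min (isT : 1 < 2)); rewrite leqNgt lt_i.
Qed.

Lemma up_log_small : 2 ^ up_log 2 mm < 2 * mm.
Proof.
have [->|l0] := posnP (up_log 2 mm); first by rewrite expn0; lia.
by rewrite -(prednK l0) expnS ltn_pmul2l // up_log_doubling prednK.
Qed.

Lemma bits_sample : {subset bits_regs <= sample_regs}.
Proof. by move=> r; rewrite mem_cat => ->. Qed.

Lemma operand_value_bits rg rg' :
  frame bits_regs rg rg' -> operand_value rg' m = operand_value rg m.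
Proof. by move/(frame_sub bits_sample); exact: operand_value_frame. Qed.

(** Here d bits are still to come and [a] is the number formed by those already tossed, so the final
    value is uniform among the a * 2^d + r. *)
Lemma UB_bits t K A d rg a u c (g : nat -> R) :
  operand_value rg m = mm -> d <= up_log 2 mm ->
  let i := up_log 2 mm - d in
  rg 21 = 2 ^ i -> rg 20 = a -> a < 2 ^ i -> rg 22 = (2 ^ i < mm) ->
  (forall j rg', j < 2 ^ up_log 2 mm -> frame bits_regs rg rg' -> rg' 20 = j ->
     UB t K rg' A (u + (d * 10).+1) c (g j)) ->
  UB t (While (Reg 22) (block
            [:: Toss 23;
                Op Add 20 (Reg 20) (Reg 20);
                Op Add 20 (Reg 20) (Reg 23);
                Op Add 21 (Reg 21) (Reg 21);
                Op Lt 22 (Reg 21) m]) :: K) rg A u c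
    ((\sum_(0 <= r < 2 ^ d) g (a * 2 ^ d + r)%N) / (2 ^ d)%:R)%R.
Proof.
elim: d rg a u => [|d IH] rg a u mE le_d /= r21 r20 lt_a r22 H.
  apply: UB_while => //; rewrite /= r22 up_log_doubling subn0 ltnn /=.
  rewrite expn0 big_nat1 divr1 muln1 addn0; apply: (@UB_time t); first lia.
  by rewrite subn0 in lt_a; rewrite -addn1; apply: H.
have lt_i : 2 ^ (up_log 2 mm - d.+1) < mm by rewrite up_log_doubling; lia.
apply: UB_while => //; rewrite /= r22 lt_i /=.
set i := up_log 2 mm - d.+1 in r21 lt_a r22 lt_i *.
have iE : up_log 2 mm - d = i.+1 by rewrite /i; lia.
apply: (@UB_time t); first lia.
have branch (b : bool) : UB t
    [:: block [:: Op Add 20 (Reg 20) (Reg 20); Op Add 20 (Reg 20) (Reg 23);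
                  Op Add 21 (Reg 21) (Reg 21); Op Lt 22 (Reg 21) m],
        While (Reg 22) (block
            [:: Toss 23;
                Op Add 20 (Reg 20) (Reg 20);
                Op Add 20 (Reg 20) (Reg 23);
                Op Add 21 (Reg 21) (Reg 21);
                Op Lt 22 (Reg 21) m]) & K] (upd rg 23 b) A u.+3 c
    ((\sum_(0 <= r < 2 ^ d) g ((2 * a + b) * 2 ^ d + r)%N) / (2 ^ d)%:R)%R.
  apply: UB_seq; apply: UB_op => //=; rewrite r20; first lia.
  apply: UB_seq; apply: UB_op => //=; first lia.
  apply: UB_seq; apply: UB_op => //=; rewrite r21; first lia.
  set rg' := upd _ 21 _.
  have fr : frame bits_regs rg rg'.
    by do 4 (apply: frame_upd => //).
  have mE' : operand_value rg' m = mm by rewrite (operand_value_bits fr).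
  apply: UB_op => //=; rewrite ?mE' //; first by case: (_ < mm); apply: operand_ok_lt8.
  have pow2 : 2 ^ i + 2 ^ i = 2 ^ i.+1 by rewrite expnS mul2n addnn.
  apply: IH; rewrite /= ?iE -?pow2 //.
  - by rewrite -mE'; apply: operand_value_bits; apply: frame_upd.
  - by clear -le_d; lia.
  - by rewrite /rg' /=; lia.
  - by clear -lt_a; case: b; lia.
  move=> j rg'' lt_j fr'' r20'.
  have fr2 : frame bits_regs rg rg''.
    by apply: (frame_trans (T := bits_regs) _ (frame_upd _ _ fr) fr'').
  by apply: UB_sub (H j rg'' lt_j fr2 r20') => //; clear; lia.
apply: UB_seq; apply: UB_toss (branch true) (branch false) _.
have e2 : ((2 ^ d)%N%:R != 0 :> R)%R by rewrite pnatr_eq0 expn_eq0.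
have double (h : nat -> R) : (\sum_(0 <= r < 2 ^ d.+1) h r =
    \sum_(0 <= r < 2 ^ d) h r + \sum_(0 <= r < 2 ^ d) h (r + 2 ^ d)%N)%R.
  rewrite expnS mul2n -addnn (big_cat_nat (n := 2 ^ d)) ?leq_addr //=.
  by congr (_ + _)%R; rewrite -{1}[2 ^ d]add0n big_addn addnK.
rewrite double expnS natrM.
have -> : (\sum_(0 <= r < 2 ^ d) g (a * (2 * 2 ^ d) + r)%N =
          \sum_(0 <= r < 2 ^ d) g ((2 * a + 0) * 2 ^ d + r)%N)%R.
  by apply: eq_bigr => r _; congr g; clear; lia.
have -> : (\sum_(0 <= r < 2 ^ d) g (a * (2 * 2 ^ d) + (r + 2 ^ d))%N =
          \sum_(0 <= r < 2 ^ d) g ((2 * a + 1) * 2 ^ d + r)%N)%R.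
  by apply: eq_bigr => r _; congr g; clear; lia.
rewrite le_eqVlt; apply/orP; left; apply/eqP; field.
exact: e2.
Qed.

(** A round draws j below 2^l, where 2^l < 2 * mm <= rho * |goods|; it succeeds with probability at
    least 1/rho, so that on average at most rho rounds of cost [it] are needed. A rejected round
    leads back to the initial situation, with a smaller t. *)
Lemma spec_sample rg A test good ct rho :
  operand_value rg m = mm ->
  let goods := [seq j <- iota 0 mm | good j] in
  goods != [::] -> 2 * mm <= rho * size goods ->
  (forall j rg', frame sample_regs rg rg' -> rg' 20 = j -> j < mm ->
     spec test rg' A ct (Ret tt) (fun _ rg'' A'' =>
       [/\ frame [:: 24; 25] rg' rg'', (rg'' 24 != 0) = ~~ good j & A'' = A])) ->
  spec (sample m test) rg A (rho * (ct + 10 * up_log 2 mm + 20) + 3)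
    (Draw goods Ret)
    (fun j rg' A' =>
       [/\ frame sample_regs rg rg', rg' 20 = j, good j, j < mm & A' = A]).
Proof.
move=> mE goods goods0 le_rho testP t K u c g H.
set it := ct + 10 * up_log 2 mm + 20 in H *.
apply: UB_inhabited => -[regs0 [mem0 rep0]].
have goodsP j : j \in goods -> j < mm /\ good j.
  by rewrite mem_filter mem_iota add0n => /andP[-> /andP[_ ->]].
have spent j : j \in goods -> (lam * (u + (rho * it + 3))%:R <= lam * c%:R + g j)%R.
  move=> /goodsP[lt_j good_j].
  apply: UB_spent_le (represents_upd 20 j rep0) (H j (upd rg 20 j) A _).
  by split=> //=; apply: frame_upd.
have size0 : ((size goods)%:R != 0 :> R)%R by rewrite pnatr_eq0 size_eq0.
have size_gt0 : (0 < (size goods)%:R :> R)%R by rewrite ltr0n lt0n size_eq0.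
rewrite /= /sample /block; set body := While (Reg 24) _.
set avg : R := (_ / _)%R.
have avgE : (\sum_(j <- goods) g j = (size goods)%:R * avg)%R.
  by rewrite /avg mulrC divfK.
have sum_cst (x : R) : (\sum_(j <- goods) x = (size goods)%:R * x)%R.
  by rewrite big_const_seq count_predT iter_addr_0 mulr_natl.
(* Settles t = 0: the budget inequalities implied by the bounds for the accepted values are
   averaged. *)
have le_avg : (lam * (u + (rho * it + 3))%:R <= lam * c%:R + avg)%R.
  rewrite -(ler_pM2l size_gt0) mulrDr -avgE -!sum_cst -big_split /=.
  by rewrite big_seq [X in (_ <= X)%R]big_seq; apply: ler_sum => j /spent.
rewrite /=; apply: UB_seq; apply: UB_move => //=; first exact: operand_ok_lt8.
have: frame sample_regs rg (upd rg 24 1) by apply: frame_upd.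
have: upd rg 24 1 24 != 0 by [].
move: (upd rg 24 1) => rg1.
elim: t rg1 H => [|t IH] rg1 H r24 fr1.
  by apply: UB_0; apply: le_trans le_avg; rewrite ler_wpM2l // ler_nat; clear; lia.
apply: UB_while => //; rewrite /= r24 /block.
do 2 (apply: UB_seq; apply: UB_move => //=; first exact: operand_ok_lt8).
apply: UB_seq; set rg2 := upd _ 20 _.
have fr2 : frame sample_regs rg rg2 by do 2 (apply: frame_upd => //).
have mE2 : operand_value rg2 m = mm by rewrite (operand_value_frame fr2).
apply: UB_op => //=; rewrite ?mE2; first by case: (_ < mm); exact: operand_ok_lt8.
apply: UB_seq; set rg3 := upd _ 22 _.
have fr3 : frame sample_regs rg rg3 by apply: frame_upd.
have mE3 : operand_value rg3 m = mm by rewrite (operand_value_frame fr3).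
pose l := up_log 2 mm.
(* Account of one round: both outcomes consume [it]; success gives back the whole reserve rho * it,
   while failure keeps it and faces the mean [avg] again. By the choice of rho the mean of G is at
   most [avg]. *)
pose G j : R := if (j < mm) && good j then (g j - lam * (rho * it)%:R + lam * it%:R)%R
                else (avg + lam * it%:R)%R.
have sumG : ((\sum_(0 <= r < 2 ^ l) G (0 * 2 ^ l + r)%N) / (2 ^ l)%:R <= avg)%R.
  have le_l : mm <= 2 ^ l by exact: up_logP.
  have -> : (\sum_(0 <= r < 2 ^ l) G (0 * 2 ^ l + r)%N =
    \sum_(0 <= r < 2 ^ l) (avg + lam * it%:R) +
    \sum_(j <- goods) (g j - lam * (rho * it)%:R - avg))%R.
    have -> (h : nat -> R) : (\sum_(j <- goods) h j =
        \sum_(0 <= j < 2 ^ l) if good j && (j < mm)%N then h j else 0)%R.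
      rewrite big_filter (_ : iota 0 mm = index_iota 0 mm); last by rewrite /index_iota subn0.
      by rewrite (big_nat_widen 0 mm (2 ^ l)) // big_mkcond.
    rewrite -big_split /=; apply: eq_bigr => j _; rewrite /G mul0n add0n andbC.
    by case: ifP => _; lra.
  rewrite big_split /= !sumr_const_nat subn0 -[(avg *+ _)%R]mulr_natr -[((lam * _) *+ _)%R]mulr_natr.
  rewrite sumrB sumrB !sum_cst avgE ler_pdivrMr ?ltr0n ?expn_gt0 //.
  have : (lam * it%:R * (2 ^ l)%N%:R <= lam * it%:R * (rho * size goods)%N%:R)%R.
    rewrite ler_wpM2l ?mulr_ge0 // ler_nat.
    by apply: leq_trans le_rho; apply: ltnW; exact: up_log_small.
  by rewrite !natrM; lra.
apply: UB_le sumG _.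
apply: UB_bits => //; rewrite ?subnn //.
move=> j rg4 lt_j fr4' r20.
have fr4 : frame sample_regs rg rg4.
  by apply: (frame_trans _ fr3 (frame_sub bits_sample fr4')).
have mE4 : operand_value rg4 m = mm by rewrite (operand_value_frame fr4).
apply: UB_seq; apply: UB_op => //=; rewrite ?mE4 r20; first by case: (_ < mm); exact: operand_ok_lt8.
set rg5 := upd _ 22 _.
have fr5 : frame sample_regs rg rg5 by apply: frame_upd.
have r24' : rg5 24 != 0 by rewrite -[rg5 24]/(rg4 24) fr4'.
have H' y rg' A' : [/\ frame sample_regs rg rg', rg' 20 = y, good y, y < mm & A' = A] ->
    UB t K rg' A' (u + (rho * it + 3)) c (g y).
  by move/H; apply: UB_time.
apply: UB_if => //=.
have -> : rg5 22 = (j < mm) by [].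
rewrite /G; case: (ltnP j mm) => lt_jm /=; last first.
  apply: UB_skip; apply: UB_shift (IH rg5 H' r24' fr5).
  rewrite -addrA lerD2l -mulrDr ler_wpM2l // -natrD ler_nat /it -/l.
  by clear; lia.
have fr45 : frame sample_regs rg rg5 by [].
pose G' (_ : unit) : R := if good j then (g j - lam * (rho * it)%:R + lam * it%:R)%R
                          else (avg + lam * it%:R)%R.
rewrite -[X in UB _ _ _ _ _ _ X]/(G' tt) -[G' tt]/(expect (Ret tt) G').
apply: (testP j rg5 fr5 _ lt_jm); first by [].
move=> [] rg6 A6 [fr6 r24'' ->].
have fr6' : frame sample_regs rg rg6.
  by apply: (frame_trans _ fr5 (frame_sub _ fr6)) => // r; rewrite mem_cat => ->; rewrite orbT.
rewrite /G'; case: (boolP (good j)) r24'' => good_j r24''; last first.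
  apply: UB_shift (IH rg6 H' r24'' fr6').
  rewrite -addrA lerD2l -mulrDr ler_wpM2l // -natrD ler_nat /it -/l.
  by clear; lia.
apply: UB_while => //=; rewrite r24'' /=; apply: (@UB_time t); first exact: leq_pred.
have r20'' : rg6 20 = j by rewrite fr6.
have H6 : UB t K rg6 A (u + (rho * it + 3)) c (g j) by exact: H'.
apply: UB_shift H6.
have -> : (g j - lam * (rho * it)%:R + lam * it%:R + lam * (u + (rho * it + 3))%:R =
           g j + lam * (it + u + 3)%:R)%R by rewrite !natrD !mulrDr; lra.
by rewrite lerD2l ler_wpM2l // ler_nat /it -/l; clear; lia.
Qed.

End Sample.

End Logic.

(** * The program *)

Section Encoding.
Variables (n k : nat) (e : rel 'I_n).

Definition lists : seq (seq nat) := [seq [seq val u | u <- nbrs e v] | v <- enum 'I_n].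

Definition pointer (i : nat) : nat := n + 3 + sumn (take i (shape lists)).

Lemma encodeE : encode e k =
  [:: n; k] ++ [seq pointer i | i <- iota 0 n.+1] ++ flatten lists.
Proof. by []. Qed.

Lemma size_lists : size (shape lists) = n.
Proof. by rewrite /shape /lists 2!size_map size_enum_ord. Qed.

Lemma nth_shape (v : 'I_n) : nth 0 (shape lists) v = size (nbrs e v).
Proof.
by rewrite /shape /lists -map_comp (nth_map v) ?size_enum_ord //= nth_ord_enum size_map.
Qed.

Lemma pointerS (v : 'I_n) : pointer v.+1 = pointer v + size (nbrs e v).
Proof.
by rewrite /pointer (take_nth 0) ?size_lists // -cats1 sumn_cat /= nth_shape addn0 addnA.
Qed.

Lemma pointer_mono i j : i <= j -> pointer i <= pointer j.
Proof.
move=> le_ij; rewrite /pointer leq_add2l -(subnKC le_ij) takeD sumn_cat.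
exact: leq_addr.
Qed.

Lemma size_encode : size (encode e k) = pointer n.
Proof.
rewrite encodeE !size_cat size_map size_iota size_flatten /pointer.
by rewrite [take _ _]take_oversize ?size_lists //=; lia.
Qed.

Lemma pointer_gt (i : nat) : n + 3 <= pointer i.
Proof. exact: leq_addr. Qed.

Lemma encode_n : nth 0 (encode e k) 0 = n.
Proof. by []. Qed.

Lemma encode_k : nth 0 (encode e k) 1 = k.
Proof. by []. Qed.

Lemma encode_pointer i : i <= n -> nth 0 (encode e k) (i + 2) = pointer i.
Proof.
move=> le_i; rewrite encodeE nth_cat ifF; last by rewrite /=; lia.
rewrite (_ : i + 2 - size [:: n; k] = i); last by rewrite /=; lia.
by rewrite nth_cat size_map size_iota ltnS le_i (nth_map 0) ?size_iota // nth_iota.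
Qed.

Lemma nth_flatten_lists (v : 'I_n) i : i < size (nbrs e v) ->
  nth 0 (flatten lists) (sumn (take v (shape lists)) + i) = nth 0 [seq val u | u <- nbrs e v] i.
Proof.
move=> lt_i.
have -> : flatten lists = flatten (take v lists) ++ [seq val u | u <- nbrs e v] ++ flatten (drop v.+1 lists).
  rewrite -{1}(cat_take_drop v lists) flatten_cat (drop_nth [::]); last by rewrite size_map size_enum_ord.
  by rewrite /= (nth_map v) ?size_enum_ord // nth_ord_enum.
have szE : sumn (take v (shape lists)) = size (flatten (take v lists)).
  by rewrite size_flatten /shape map_take.
rewrite szE nth_cat ltnNge leq_addr /= addKn nth_cat size_map lt_i //.
Qed.

Lemma encode_neighbour (v : 'I_n) i : i < size (nbrs e v) ->
  nth 0 (encode e k) (pointer v + i) = nth 0 [seq val u | u <- nbrs e v] i.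
Proof.
move=> lt_i; rewrite -nth_flatten_lists // encodeE catA nth_cat.
have -> : size ([:: n; k] ++ [seq pointer j | j <- iota 0 n.+1]) = n + 3.
  by rewrite size_cat size_map size_iota /=; lia.
rewrite /pointer; set s := sumn _.
by rewrite ifF; [congr (nth _ _ _); lia|lia].
Qed.

Lemma degree_le v : size (nbrs e v) <= n.
Proof. by rewrite -cardE -[X in _ <= X]card_ord max_card. Qed.

Lemma pointer_le i : i <= n -> pointer i <= n + 3 + i * n.
Proof.
elim: i => [|i IH] le_i; first by rewrite /pointer take0 /= addn0.
rewrite (pointerS (Ordinal le_i)) mulSn [n + i * n]addnC addnA leq_add ?degree_le //.
by apply: IH; exact: ltnW.
Qed.

End Encoding.

Lemma enum_ord_cat n (l0 : seq 'I_n) u l1 : enum 'I_n = l0 ++ u :: l1 -> size l0 = u.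
Proof.
move=> enumE; have : index u (enum 'I_n) = size l0.
  have := enum_uniq 'I_n; rewrite enumE cat_uniq => /and3P[_ + _].
  rewrite /= negb_or => /andP[ul0 _].
  by rewrite index_cat (negPf ul0) /= eqxx addn0.
by rewrite index_enum_ord.
Qed.

Definition for_range (r rt : nat) (hi : operand) (body : cmd) : cmd :=
  block [:: move r (Cst 0);
    Op Lt rt (Reg r) hi;
    While (Reg rt) (block
      [:: body;
          Op Add r (Reg r) (Cst 1);
          Op Lt rt (Reg r) hi])].

Definition for_nbrs (ri re ru rt : nat) (v : operand) (body : cmd) : cmd :=
  block [:: Op Add rt v (Cst 2);
    Read ri (Reg rt);
    Op Add rt v (Cst 3);
    Read re (Reg rt);
    Op Lt rt (Reg ri) (Reg re);
    While (Reg rt) (block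
      [:: Read ru (Reg ri);
          body;
          Op Add ri (Reg ri) (Cst 1);
          Op Lt rt (Reg ri) (Reg re)])].

(** * Loops over a range and over the neighbours of a vertex *)

Section Loops.
Variables (R : realType) (w : nat) (lam : R) (F : state -> R).
Hypothesis lam_ge0 : (0 <= lam)%R.
Hypothesis F_ge0 : forall s, (0 <= F s)%R.
Variables (B M : nat).
Hypothesis enough_words : B + 8 * M + 8 < 2 ^ w.

Local Notation UB := (UB w lam F B M).
Local Notation spec := (spec w lam F B M).

Lemma UB_spent t K rg A u u' c (b : R) :
  u' <= u -> UB t K rg A u c b -> UB t K rg A u' c b.
Proof. by move=> h; apply: UB_sub => //; rewrite addnC leq_add2l. Qed.

Lemma bool_lt (b : bool) : b < 2 ^ w.
Proof. by apply: leq_ltn_trans enough_words; case: b; clear; lia. Qed.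

(** The invariant depends on the prefix already treated, whose length is the counter, and must
    ignore the loop registers. [Inv'] translates it into the remaining list expected by
    [spec_while]. *)
Lemma spec_for (I T : Type) (f : I -> T -> dist T)
    (Inv : seq I -> T -> (nat -> nat) -> (nat -> nat -> nat) -> Prop)
    r rt hi body cb (l : seq I) :
  0 < r -> 0 < rt -> r != rt -> operand_ok hi -> size l < 2 ^ w ->
  (forall l0 y rg A, Inv l0 y rg A -> operand_value rg hi = size l) ->
  (forall l0 y rg rg' A, Inv l0 y rg A -> frame [:: r; rt] rg rg' -> Inv l0 y rg' A) ->
  (forall l0 u l1 y rg A, l = l0 ++ u :: l1 -> Inv l0 y rg A -> rg r = size l0 ->
     spec body rg A cb (f u y) (fun y' rg' A' =>
       Inv (rcons l0 u) y' rg' A' /\ rg' r = size l0)) ->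
  forall y rg A, Inv [::] y rg A ->
  spec (for_range r rt hi body) rg A (size l * (cb + 5) + 6) (foldM f l y) (Inv l).
Proof.
move=> r0 rt0 r_rt okhi lt_l hiP frameP bodyP y rg A inv t K u c g H.
have okr : operand_ok (Reg r) by [].
have okrt : operand_ok (Reg rt) by [].
apply: (UB_seq lam_ge0 F_ge0 enough_words).
apply: (UB_move lam_ge0 F_ge0 enough_words) => //=; first exact: (operand_ok_lt8 enough_words).
have inv1 : Inv [::] y (upd rg r 0) A.
  by apply: frameP inv _; apply: frame_upd; rewrite ?inE ?eqxx.
apply: (UB_seq lam_ge0 F_ge0 enough_words).
apply: (UB_op lam_ge0 F_ge0 enough_words) => //=; rewrite (hiP _ _ _ _ inv1) eqxx; first exact: bool_lt.
set rg1 := upd _ rt _.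
have inv2 : Inv [::] y rg1 A.
  by apply: frameP inv1 _; apply: frame_upd; rewrite ?inE ?eqxx ?orbT.
pose Inv' l1 (y : T) rg A := exists l0, [/\ l = l0 ++ l1, Inv l0 y rg A, rg r = size l0
  & rg rt = (size l0 < size l)].
have wh := spec_while lam_ge0 F_ge0 enough_words (f := f) (Inv := Inv') (a := Reg rt)
  (body := block [:: body; Op Add r (Reg r) (Cst 1); Op Lt rt (Reg r) hi]) (cb := cb + 4) okrt.
apply: (wh _ _ l y rg1 A) => //.
- move=> l1 y0 rg0 A0 [l0 [lE _ _ /= ->]]; rewrite lE size_cat.
  by rewrite -[X in X < _]addn0 ltn_add2l; case: l1 {lE}.
- move=> i l1 y0 rg0 A0 [l0 [lE inv0 rE rtE]] t' K' u' c' g' H'.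
  apply: (UB_seq lam_ge0 F_ge0 enough_words).
  apply: (bodyP _ _ _ _ _ _ lE inv0 rE) => y1 rg2 A1 [inv3 r2].
  apply: (UB_seq lam_ge0 F_ge0 enough_words).
  have szl : size l0 + 1 <= size l by rewrite lE size_cat /= leq_add2l.
  apply: (UB_op lam_ge0 F_ge0 enough_words) => //=; rewrite r2.
    by apply: leq_ltn_trans lt_l.
  have inv4 : Inv (rcons l0 i) y1 (upd rg2 r (size l0 + 1)) A1.
    by apply: frameP inv3 _; apply: frame_upd; rewrite ?inE ?eqxx.
  apply: (UB_op lam_ge0 F_ge0 enough_words) => //=; rewrite (hiP _ _ _ _ inv4) eqxx; first exact: bool_lt.
  apply: UB_spent (H' y1 _ A1 _); first by clear; lia.
  exists (rcons l0 i); split=> /=.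
  + by rewrite lE cat_rcons.
  + by apply: frameP inv4 _; apply: frame_upd; rewrite ?inE ?eqxx ?orbT.
  + by rewrite (negPf r_rt) eqxx size_rcons addn1.
  + by rewrite eqxx size_rcons addn1.
- exists [::]; split=> //=; first by rewrite /rg1 /= (negPf r_rt) eqxx.
  by rewrite /rg1 /= eqxx.
move=> y' rg' A' [l0 [lE inv' _ _]]; rewrite cats0 in lE; subst l0.
by apply: UB_spent (H _ _ _ inv'); clear; lia.
Qed.

End Loops.

Section Neighbours.
Variables (R : realType) (w : nat) (lam : R) (F : state -> R).
Hypothesis lam_ge0 : (0 <= lam)%R.
Hypothesis F_ge0 : forall s, (0 <= F s)%R.
Variables (n k : nat) (e : rel 'I_n).

Local Notation B := (pointer e n).
Local Notation M := (n + k + 1).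
Hypothesis enough_words : B + 8 * M + 8 < 2 ^ w.

Local Notation UB := (UB w lam F B M).
Local Notation spec := (spec w lam F B M).

(** The encoded graph has to stay intact until the colours are written over it at the very end. *)
Definition low (A : nat -> nat -> nat) : Prop :=
  forall i, i < B -> A 7 i = nth 0 (encode e k) i.

Lemma word_small x : x <= B + 8 * M + 8 -> x < 2 ^ w.
Proof. by move=> h; apply: leq_ltn_trans enough_words. Qed.

Lemma n_lt_B : n + 3 <= B.
Proof. exact: pointer_gt. Qed.

Lemma low_pointer A i : low A -> i <= n -> A 7 (i + 2) = pointer e i.
Proof.
move=> lowA le_i; rewrite lowA ?encode_pointer //.
by apply: leq_trans n_lt_B; rewrite -addnS leq_add.
Qed.

Lemma low_neighbour A (v : 'I_n) l0 u l1 : low A -> nbrs e v = l0 ++ u :: l1 ->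
  pointer e v + size l0 < B /\ A 7 (pointer e v + size l0) = u.
Proof.
move=> lowA nE; have lt_s : size l0 < size (nbrs e v).
  by rewrite nE size_cat /= -addn1 leq_add2l.
have lt_B : pointer e v + size l0 < B.
  apply: (@leq_trans (pointer e v.+1)); last exact: pointer_mono.
  by rewrite pointerS ltn_add2l.
split=> //; rewrite lowA // encode_neighbour // nE map_cat nth_cat size_map ltnn subnn //.
Qed.

Lemma spec_nbrs (T : Type) (f : 'I_n -> T -> dist T)
    (Inv : seq 'I_n -> T -> (nat -> nat) -> (nat -> nat -> nat) -> Prop)
    ri re ru rt (v : 'I_n) vo body cb :
  uniq [:: 0; ri; re; ru; rt] -> operand_ok vo -> fresh [:: ri; re; ru; rt] vo ->
  (forall l0 y rg A, Inv l0 y rg A -> low A) ->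
  (forall l0 y rg rg' A, Inv l0 y rg A -> frame [:: ri; re; ru; rt] rg rg' ->
     Inv l0 y rg' A) ->
  (forall l0 u l1 y rg A, nbrs e v = l0 ++ u :: l1 -> Inv l0 y rg A -> rg ru = u ->
     spec body rg A cb (f u y) (fun y' rg' A' =>
       [/\ Inv (rcons l0 u) y' rg' A', rg' ri = rg ri & rg' re = rg re])) ->
  forall y rg A, operand_value rg vo = v -> Inv [::] y rg A ->
  spec (for_nbrs ri re ru rt vo body) rg A (size (nbrs e v) * (cb + 7) + 11)
    (foldM f (nbrs e v) y) (Inv (nbrs e v)).
Proof.
move=> uq okvo fresh_vo lowP frameP bodyP y rg A voE inv t K u c g H.
have lowA := lowP _ _ _ _ inv; have ltn_v := ltn_ord v.
have [nB BM] : n + 3 <= B /\ B < 2 ^ w.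
  by split; [exact: n_lt_B|apply: word_small; rewrite -addnA leq_addr].
move: uq; rewrite /= !inE !negb_or andbT => /andP[/and4P[ri0 re0 ru0 rt0]].
move=> /andP[/and3P[ri_re ri_ru ri_rt]] /andP[/andP[re_ru re_rt] ru_rt].
rewrite ![0 == _]eq_sym in ri0 re0 ru0 rt0.
rewrite -!lt0n in ri0 re0 ru0 rt0.
have fr0 (rg1 : nat -> nat) x : frame [:: ri; re; ru; rt] rg rg1 ->
    frame [:: ri; re; ru; rt] rg (upd rg1 rt x).
  by apply: frame_upd; rewrite !inE eqxx !orbT.
have fri (rg1 : nat -> nat) x : frame [:: ri; re; ru; rt] rg rg1 ->
    frame [:: ri; re; ru; rt] rg (upd rg1 ri x).
  by apply: frame_upd; rewrite !inE eqxx.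
have fre (rg1 : nat -> nat) x : frame [:: ri; re; ru; rt] rg rg1 ->
    frame [:: ri; re; ru; rt] rg (upd rg1 re x).
  by apply: frame_upd; rewrite !inE eqxx !orbT.
have voE' rg1 : frame [:: ri; re; ru; rt] rg rg1 -> operand_value rg1 vo = v.
  by move=> fr; rewrite -voE; case: vo fresh_vo {okvo voE} => //= r hr; rewrite fr.
apply: (UB_seq lam_ge0 F_ge0 enough_words).
apply: (UB_op lam_ge0 F_ge0 enough_words) => //=; rewrite voE.
  by apply: leq_ltn_trans BM; clear -nB ltn_v; lia.
have fr1 := fr0 rg (v + 2) (fun _ _ => erefl).
apply: (UB_seq lam_ge0 F_ge0 enough_words).
apply: (UB_read lam_ge0 F_ge0 enough_words) => //=; rewrite eqxx.
  by clear -nB ltn_v; lia.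
rewrite (low_pointer lowA) ?(ltnW ltn_v) //.
have fr2 := fri _ (pointer e v) fr1.
apply: (UB_seq lam_ge0 F_ge0 enough_words).
apply: (UB_op lam_ge0 F_ge0 enough_words) => //=; rewrite (voE' _ fr2).
  by apply: leq_ltn_trans BM; clear -nB ltn_v; lia.
have fr3 := fr0 _ (v + 3) fr2.
apply: (UB_seq lam_ge0 F_ge0 enough_words).
apply: (UB_read lam_ge0 F_ge0 enough_words) => //=; rewrite eqxx.
  by clear -nB ltn_v; lia.
rewrite -[v + 3]addSnnS (low_pointer lowA) //.
have fr4 := fre _ (pointer e v.+1) fr3.
apply: (UB_seq lam_ge0 F_ge0 enough_words).
apply: (UB_op lam_ge0 F_ge0 enough_words) => //=; first exact: bool_lt enough_words _.
set rg5 := upd _ rt _.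
have fr5 : frame [:: ri; re; ru; rt] rg rg5.
  by apply: (fr0); apply: (fre); apply: (fr0); apply: (fri); apply: (fr0).
have r5 : [/\ rg5 ri = pointer e v, rg5 re = pointer e v.+1
            & rg5 rt = (pointer e v < pointer e v.+1)].
  rewrite /rg5 /=; rewrite !eqxx (negPf ri_rt) (negPf ri_re) (negPf re_rt).
  by [].
have {r5} [r5i r5e r5t] := r5.
pose Inv' l1 (y : T) rg A := exists l0, [/\ nbrs e v = l0 ++ l1, Inv l0 y rg A,
  rg ri = pointer e v + size l0, rg re = pointer e v.+1
  & rg rt = (pointer e v + size l0 < pointer e v.+1)].
have wh := spec_while lam_ge0 F_ge0 enough_words (f := f) (Inv := Inv') (a := Reg rt)
  (body := block [:: Read ru (Reg ri); body; Op Add ri (Reg ri) (Cst 1);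
     Op Lt rt (Reg ri) (Reg re)]) (cb := cb + 6) rt0.
apply: (wh _ _ (nbrs e v) y rg5 A) => //.
- move=> l1 y0 rg0 A0 [l0 [lE _ _ _ /= ->]]; rewrite pointerS ltn_add2l lE size_cat.
  by rewrite -[X in X < _]addn0 ltn_add2l; case: l1 {lE}.
- move=> i l1 y0 rg0 A0 [l0 [lE inv0 iE reE rtE]] t' K' u' c' g' H'.
  have lowA0 := lowP _ _ _ _ inv0.
  have [lt_B A7] := low_neighbour lowA0 lE.
  apply: (UB_seq lam_ge0 F_ge0 enough_words).
  apply: (UB_read lam_ge0 F_ge0 enough_words) => //=; rewrite iE // A7.
  have inv1 : Inv l0 y0 (upd rg0 ru i) A0.
    by apply: frameP inv0 _; apply: frame_upd; rewrite ?inE ?eqxx ?orbT.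
  apply: (UB_seq lam_ge0 F_ge0 enough_words).
  apply: (bodyP _ _ _ _ _ _ lE inv1) => [|y1 rg2 A1 [inv3 rg2i rg2e]]; first by rewrite /= eqxx.
  move: rg2i rg2e; rewrite /= (negPf ri_ru) (negPf re_ru) => rg2i rg2e.
  apply: (UB_seq lam_ge0 F_ge0 enough_words).
  apply: (UB_op lam_ge0 F_ge0 enough_words) => //=; rewrite rg2i iE.
    by apply: leq_ltn_trans BM; rewrite addn1.
  apply: (UB_op lam_ge0 F_ge0 enough_words) => //=; first exact: bool_lt enough_words _.
  rewrite eqxx eq_sym (negPf ri_re).
  apply: (UB_spent lam_ge0) (H' y1 _ A1 _); first by clear; lia.
  exists (rcons l0 i); split=> /=.
  + by rewrite lE cat_rcons.
  + by apply: frameP inv3 _; do 2 (apply: frame_upd; first by rewrite !inE eqxx ?orbT).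
  + by rewrite (negPf ri_rt) eqxx size_rcons addn1 addnS.
  + by rewrite (negPf re_rt) eq_sym (negPf ri_re) rg2e.
  + by rewrite eqxx rg2e reE size_rcons addn1 addnS.
- exists [::]; rewrite addn0; split=> //.
  exact: frameP inv fr5.
move=> y' rg' A' [l0 [lE inv' _ _ _]]; rewrite cats0 in lE; subst l0.
by apply: (UB_spent lam_ge0) (H _ _ _ inv'); clear; lia.
Qed.

End Neighbours.

(* Registers 1-4 hold the address of the first free cell, n, k and D, and 5 the
   number of sweeps; 9 is the vertex being updated, 12 the size of the list S,
   17-33 are local to the update.  Arrays: 0 colouring, 1 saved colouring, 2-3
   bounds, 4 marks of the members of S (2 for the surely blocked ones), 5 the
   list S, 6 marks of the colours of the neighbours, 7 the encoded graph. *)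
Definition insert_color (r : nat) : cmd :=
  block [:: load 17 4 (Reg r);
    If (Reg 17) Skip (block
      [:: store 5 (Reg 12) (Reg r);
          store 4 (Reg r) (Cst 1);
          Op Add 12 (Reg 12) (Cst 1)])].

Definition gather_lists : cmd :=
  for_nbrs 13 14 15 16 (Reg 9) (block
    [:: Op Lt 17 (Reg 15) (Reg 10);
        If (Reg 17) (block
          [:: load 18 2 (Reg 15);
              load 19 3 (Reg 15);
              insert_color 18;
              insert_color 19;
              Op Eq 17 (Reg 18) (Reg 19);
              If (Reg 17) (store 4 (Reg 18) (Cst 2)) Skip]) Skip]).

Definition fill_list : cmd :=
  for_range 13 16 (Reg 4) (block
    [:: Op Lt 17 (Reg 12) (Reg 11);
        If (Reg 17) (insert_color 13) Skip]).

Definition count_colors (v : operand) : cmd :=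
  Seq (move 26 (Cst 0)) (for_nbrs 30 31 32 33 v (block
    [:: load 17 0 (Reg 32);
        load 18 6 (Reg 17);
        If (Reg 18) Skip (block
          [:: store 6 (Reg 17) (Cst 1);
              Op Add 26 (Reg 26) (Cst 1)])])).

Definition clear_colors (v : operand) : cmd :=
  for_nbrs 30 31 32 33 v (block
    [:: load 17 0 (Reg 32);
        store 6 (Reg 17) (Cst 0)]).

Definition clear_marks : cmd :=
  for_range 13 16 (Reg 12) (block
    [:: load 17 5 (Reg 13);
        store 4 (Reg 17) (Cst 0)]).

(** * Listing and marking the colours around a vertex *)

Section Routines.
Variables (R : realType) (w : nat) (lam : R) (F : state -> R).
Hypothesis lam_ge0 : (0 <= lam)%R.
Hypothesis F_ge0 : forall s, (0 <= F s)%R.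
Variables (n k : nat) (e : rel 'I_n).

Local Notation B := (pointer e n).
Local Notation M := (n + k + 1).
Local Notation D := (max_degree e).
Hypothesis enough_words : B + 8 * M + 8 < 2 ^ w.

Local Notation UB := (UB w lam F B M).
Local Notation spec := (spec w lam F B M).
Local Notation coloring := {ffun 'I_n -> 'I_k}.
Local Notation bounds := {ffun 'I_n -> 'I_k * 'I_k}.

Ltac u_seq := apply: (UB_seq lam_ge0 F_ge0 enough_words).
Ltac u_op := apply: (UB_op lam_ge0 F_ge0 enough_words) => //=.
Ltac u_if := apply: (UB_if lam_ge0 F_ge0 enough_words) => //=.
Ltac u_skip := apply: (UB_skip lam_ge0 F_ge0 enough_words).
Ltac u_load := apply: (UB_load lam_ge0 F_ge0 enough_words) => //=.
Ltac u_store := apply: (UB_store lam_ge0 F_ge0 enough_words) => //=.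
Ltac u_move := apply: (UB_move lam_ge0 F_ge0 enough_words) => //=.

Lemma UB_callR t p K rg A cost Post u c (b : R) :
  spec p rg A cost (Ret tt) Post ->
  (forall rg' A', Post tt rg' A' -> UB t K rg' A' (u + cost) c b) ->
  UB t (p :: K) rg A u c b.
Proof.
move=> H H'; apply: (UB_call lam_ge0 (g := fun=> b) H) => //.
by move=> [].
Qed.

Lemma frame_step T T' rg rg' rg'' :
  frame T' rg rg' -> frame T rg' rg'' -> all (mem T') T -> frame T' rg rg''.
Proof.
move=> fr fr' /allP sub; apply: (frame_trans (T := T')) fr _ => //.
exact: frame_sub fr'.
Qed.

(** The two families of marks are arbitrary functions, so that half-written marks can be described
    inside the loops. *)
Definition mem_ok (x y : coloring) (L : bounds) (S : seq 'I_k)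
    (mk nk : 'I_k -> nat) (A : nat -> nat -> nat) : Prop :=
  [/\ low k e A,
      forall v : 'I_n, [/\ A 0 v = x v, A 1 v = y v, A 2 v = (L v).1 & A 3 v = (L v).2],
      forall c : 'I_k, A 4 c = mk c,
      forall c : 'I_k, A 6 c = nk c
    & forall i (c : 'I_k), i < size S -> A 5 i = nth c S i].

Definition mark (S C : seq 'I_k) (c : 'I_k) : nat :=
  if c \in C then 2 else (c \in S).

Lemma mem_ok_ext x y L S mk nk mk' nk' A : mk =1 mk' -> nk =1 nk' ->
  mem_ok x y L S mk nk A -> mem_ok x y L S mk' nk' A.
Proof. by move=> h1 h2 [? ? h3 h4 ?]; split=> // c; rewrite -?h1 -?h2. Qed.

Lemma mem_ok_mark x y L S mk nk A (c : 'I_k) v :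
  mem_ok x y L S mk nk A ->
  mem_ok x y L S (fun c' => if c' == c then v else mk c') nk (upd2 A 4 c v).
Proof. by case=> ? ? h3 ? ?; split=> //= c'; rewrite (inj_eq val_inj) h3. Qed.

Lemma mem_ok_nbr_mark x y L S mk nk A (c : 'I_k) v :
  mem_ok x y L S mk nk A ->
  mem_ok x y L S mk (fun c' => if c' == c then v else nk c') (upd2 A 6 c v).
Proof. by case=> ? ? ? h4 ?; split=> //= c'; rewrite (inj_eq val_inj) h4. Qed.

Lemma mem_ok_rcons x y L S mk nk A (c : 'I_k) :
  mem_ok x y L S mk nk A -> mem_ok x y L (rcons S c) mk nk (upd2 A 5 (size S) c).
Proof.
case=> ? ? ? ? h5; split=> //= i c0; rewrite size_rcons ltnS leq_eqVlt nth_rcons.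
by case: eqP => [->|_ /= lt_i]; [rewrite ltnn|rewrite lt_i; exact: h5].
Qed.

Lemma mem_ok_x x y L S mk nk A (v : 'I_n) (c : 'I_k) :
  mem_ok x y L S mk nk A -> mem_ok (recolor x v c) y L S mk nk (upd2 A 0 v c).
Proof.
case=> h1 h2 ? ? ?; split=> //= u; have [? ? ? ?] := h2 u.
rewrite recolorE (inj_eq val_inj); case: (u == v) => //.
Qed.

Lemma mem_ok_y x y L S mk nk A (v : 'I_n) (c : 'I_k) :
  mem_ok x y L S mk nk A -> mem_ok x (recolor y v c) L S mk nk (upd2 A 1 v c).
Proof.
case=> h1 h2 ? ? ?; split=> //= u; have [? ? ? ?] := h2 u.
rewrite recolorE (inj_eq val_inj); case: (u == v) => //.
Qed.

Lemma mem_ok_L x y L S mk nk A (v : 'I_n) (c c' : 'I_k) :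
  mem_ok x y L S mk nk A ->
  mem_ok x y (recolor L v (c, c')) S mk nk (upd2 (upd2 A 2 v c) 3 v c').
Proof.
case=> h1 h2 ? ? ?; split=> //= u; have [? ? ? ?] := h2 u.
rewrite recolorE (inj_eq val_inj); case: (u == v) => //.
Qed.

Definition base (rg : nat -> nat) : Prop :=
  [/\ rg 1 = B, rg 2 = n, rg 3 = k & rg 4 = D].

Lemma base_frame T rg rg' : all (fun r => 4 < r) T ->
  frame T rg rg' -> base rg -> base rg'.
Proof.
move=> /allP T4 fr [? ? ? ?].
have fr4 r : r <= 4 -> rg' r = rg r.
  by move=> le_r; apply: fr; apply/negP => /T4; rewrite ltnNge le_r.
by split; rewrite fr4.
Qed.

Lemma size_uniq_le (S : seq 'I_k) : uniq S -> size S <= k.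
Proof. by move=> /card_uniqP <-; rewrite -[X in _ <= X]card_ord max_card. Qed.

Lemma spec_insert r rg A x y L (S C : seq 'I_k) nk (c : 'I_k) :
  0 < r -> r \notin [:: 12; 17] -> base rg -> uniq S -> {subset C <= S} ->
  mem_ok x y L S (mark S C) nk A -> rg r = c -> rg 12 = size S ->
  spec (insert_color r) rg A 30 (Ret tt) (fun _ rg' A' =>
    [/\ frame [:: 12; 17] rg rg', rg' 12 = size (add_color S c)
      & mem_ok x y L (add_color S c) (mark (add_color S c) C) nk A']).
Proof.
move=> r0 rT [rB rn rk rD] uS sub ok rc r12 t K u cc g H.
have ltc := ltn_ord c; have leS := size_uniq_le uS.
have [h1 h2 h3 h4 h5] := ok.
have rT12 : (r == 12) = false by apply: contraNF rT => /eqP ->.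
have rT17 : (r == 17) = false by apply: contraNF rT => /eqP ->.
rewrite /insert_color /block.
u_seq; u_load; rewrite rc; first by clear -ltc; lia.
u_if; rewrite h3 /mark; case: (boolP (c \in C)) => cC /=.
  have cS := sub c cC; u_skip.
  apply: (UB_spent lam_ge0) (H tt _ A _); first by clear; lia.
  by rewrite /add_color cS; split=> //=; apply: frame_upd.
case: (boolP (c \in S)) => cS /=.
  u_skip; apply: (UB_spent lam_ge0) (H tt _ A _); first by clear; lia.
  by rewrite /add_color cS; split=> //=; apply: frame_upd.
u_seq; u_store; rewrite ?r12 ?rT17 ?rc; first by clear -leS; lia.
u_seq; u_store; rewrite ?rT17 ?rc; first by clear -ltc; lia.
u_op; rewrite r12.
  by apply: leq_ltn_trans enough_words; clear -leS; lia.
apply: (UB_spent lam_ge0) (H tt _ _ _); first by clear; lia.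
split=> /=; first by do 2 apply: frame_upd => //.
  by rewrite /add_color (negPf cS) size_rcons addn1.
rewrite /add_color (negPf cS).
apply: mem_ok_ext (mem_ok_mark _ _ (mem_ok_rcons _ ok)) => // c'; rewrite /mark mem_rcons inE.
by case: eqP => [->|_] //=; rewrite (negPf cC).
Qed.

Lemma foldM_unit (I : Type) (l : seq I) :
  foldM (fun (_ : I) (_ : unit) => Ret tt) l tt = Ret tt.
Proof. by elim: l. Qed.

Definition gather_regs : seq nat := [:: 12; 13; 14; 15; 16; 17; 18; 19].

Lemma spec_gather rg A x y L nk (v : 'I_n) lim :
  base rg -> rg 9 = v -> rg 10 = lim -> lim <= n -> rg 12 = 0 ->
  mem_ok x y L [::] (fun=> 0) nk A ->
  spec gather_lists rg A (D * 100 + 11) (Ret tt) (fun _ rg' A' =>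
    [/\ frame gather_regs rg rg', rg' 12 = size (gather e L lim v)
      & mem_ok x y L (gather e L lim v)
          (mark (gather e L lim v) (certain e L lim v)) nk A']).
Proof.
move=> bs r9 r10 le_lim r12 ok.
pose gstep (S : seq 'I_k) (u : 'I_n) :=
  if u < lim then add_color (add_color S (L u).1) (L u).2 else S.
pose Sp := foldl gstep [::].
pose Cp (l : seq 'I_n) : seq 'I_k :=
  [seq (L u).1 | u : 'I_n <- l & (u < lim) && ((L u).1 == (L u).2)].
pose Inv (l : seq 'I_n) (_ : unit) rg' A' :=
  [/\ frame gather_regs rg rg', rg' 12 = size (Sp l), uniq (Sp l), {subset Cp l <= Sp l}
    & mem_ok x y L (Sp l) (mark (Sp l) (Cp l)) nk A'].
have low_inv l y0 rg' A' : Inv l y0 rg' A' -> low k e A' by case=> _ _ _ _ [].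
rewrite -(foldM_unit (nbrs e v)).
have bound : size (nbrs e v) * (93 + 7) + 11 <= D * 100 + 11.
  by rewrite leq_add2r leq_mul2r size_nbrs orbT.
apply: (spec_sub lam_ge0 enough_words bound _ (spec_nbrs (Inv := Inv) lam_ge0 F_ge0 enough_words _ _ _ low_inv _ _ _ _)) => //.
- by move=> _ rg' A' [? ? ? ? ?].
- move=> l y0 rg1 rg2 A1 [fr ? ? ? ?] fr'; split=> //.
    exact: frame_step fr fr' isT.
  by rewrite fr'.
- move=> l0 u l1 [] rg1 A1 nE [fr r12' uS sub ok1] r15 t K uu cc g H.
  have bs1 : base rg1 by apply: base_frame fr bs.
  have [rB rn rk rD] := bs1.
  have r10' : rg1 10 = lim by rewrite fr.
  have SpE : Sp (rcons l0 u) = gstep (Sp l0) u by rewrite /Sp -cats1 foldl_cat.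
  have CpE : Cp (rcons l0 u) = Cp l0 ++ Cp [:: u].
    by rewrite /Cp -cats1 filter_cat map_cat.
  have ltu := ltn_ord u.
  have [_ h2 _ _ _] := ok1; have [_ _ hL1 hL2] := h2 u.
  rewrite /block; u_seq; u_op; first exact: bool_lt enough_words _.
  rewrite r15 r10'; u_if; case: ltnP => ltul /=; last first.
    u_skip; apply: (UB_spent lam_ge0) (H tt _ A1 _); first by clear; lia.
    split=> //=; rewrite /Inv SpE CpE /gstep ltnNge ltul /= /Cp /= ltnNge ltul /= cats0.
    by split=> //; apply: frame_upd.
  u_seq; u_load; rewrite r15; first by clear -ltu; lia.
  u_seq; u_load; rewrite r15; first by clear -ltu; lia.
  rewrite hL1 hL2; u_seq.
  set rg2 := upd _ 19 _.
  have fr2 : frame gather_regs rg1 rg2 by do 3 apply: frame_upd => //.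
  have bs2 : base rg2 by apply: base_frame fr2 bs1.
  apply: (UB_callR (spec_insert (C := Cp l0) _ _ bs2 uS sub ok1 (c := (L u).1) _ _)) => //.
  move=> rg3 A3 [fr3 r12_3 ok3].
  have uS3 := uniq_add_color (L u).1 uS.
  have sub3 : {subset Cp l0 <= add_color (Sp l0) (L u).1}.
    by move=> c /sub cS; rewrite mem_add_color cS orbT.
  have bs3 : base rg3 by apply: base_frame fr3 bs2.
  u_seq; apply: (UB_callR (spec_insert (C := Cp l0) _ _ bs3 uS3 sub3 ok3 (c := (L u).2) _ _)) => //.
    by rewrite fr3.
  move=> rg4 A4 [fr4 r12_4 ok4].
  have r34 r : r \notin [:: 12; 17] -> rg4 r = rg2 r by move=> hr; rewrite fr4 // fr3.
  have uS4 := uniq_add_color (L u).2 uS3.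
  have fr4' : frame gather_regs rg rg4.
    exact: frame_step (frame_step (frame_step fr fr2 isT) fr3 isT) fr4 isT.
  have bs4 : base rg4 by apply: base_frame fr4 bs3.
  u_seq; u_op; first exact: bool_lt enough_words _.
  rewrite !r34 // /rg2 /=; u_if.
  rewrite (_ : ((L u).1 == (L u).2 :> nat) = ((L u).1 == (L u).2)) //.
  case: (eqVneq (L u).1 (L u).2) => L12 /=.
    u_store; [by case: bs4|by rewrite r34 // /rg2 /=; have := ltn_ord (L u).1; clear; lia|].
    rewrite r34 // /rg2 /=.
    move: ok4 r12_4 uS4; rewrite L12 => ok4 r12_4 uS4.
    apply: (UB_spent lam_ge0) (H tt _ _ _); first by clear; lia.
    rewrite /Inv SpE CpE /gstep ltul /= /Cp /= ltul L12 eqxx /= -/(Cp l0) (r34 13) // (r34 14) // /rg2 /=.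
    split=> //; split=> //; first by apply: frame_upd.
      move=> c; rewrite mem_cat inE => /orP[/sub3 cS|/eqP ->].
        by rewrite mem_add_color -L12 cS orbT.
      by rewrite mem_add_color L12 eqxx.
    apply: mem_ok_ext (mem_ok_mark _ _ ok4) => // c; rewrite /mark mem_cat mem_seq1 L12.
    by case: (c == (L u).2); rewrite ?orbT ?orbF.
  u_skip; apply: (UB_spent lam_ge0) (H tt _ _ _); first by clear; lia.
  rewrite /Inv SpE CpE /gstep ltul /= /Cp /= ltul (negPf L12) /= -/(Cp l0) cats0 (r34 13) // (r34 14) // /rg2 /=.
  split=> //; split=> //; first by apply: frame_upd.
  by move=> c /sub3 cS; rewrite mem_add_color cS orbT.
Qed.

Lemma take_ord_cat (l0 : seq 'I_k) u l1 : take D (enum 'I_k) = l0 ++ u :: l1 ->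
  size l0 = u.
Proof.
move=> tE; apply: (@enum_ord_cat k l0 u (l1 ++ drop D (enum 'I_k))).
by rewrite -[LHS](cat_take_drop D) tE -catA.
Qed.

Lemma spec_fill rg A x y L (S C : seq 'I_k) nk ft :
  base rg -> D <= k -> rg 11 = ft -> rg 12 = size S -> uniq S -> {subset C <= S} ->
  mem_ok x y L S (mark S C) nk A ->
  spec fill_list rg A (D * 40 + 6) (Ret tt) (fun _ rg' A' =>
    [/\ frame [:: 12; 13; 16; 17] rg rg', rg' 12 = size (fill e ft S)
      & mem_ok x y L (fill e ft S) (mark (fill e ft S) C) nk A']).
Proof.
move=> bs le_D r11 r12 uS sub ok.
pose fstep (S : seq 'I_k) (c : 'I_k) := if size S < ft then add_color S c else S.
pose Sp := foldl fstep S.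
pose Inv (l : seq 'I_k) (_ : unit) rg' A' :=
  [/\ frame [:: 12; 13; 16; 17] rg rg', rg' 12 = size (Sp l), uniq (Sp l), {subset C <= Sp l}
    & mem_ok x y L (Sp l) (mark (Sp l) C) nk A'].
have szt : size (take D (enum 'I_k)) = D.
  by rewrite size_take size_enum_ord; case: ltngtP le_D.
rewrite -(foldM_unit (take D (enum 'I_k))).
have bound : size (take D (enum 'I_k)) * (35 + 5) + 6 <= D * 40 + 6 by rewrite szt.
have base_inv l y0 rg' A' : Inv l y0 rg' A' -> base rg'.
  by case=> fr _ _ _ _; apply: base_frame fr bs.
have nM : D < 2 ^ w by apply: leq_ltn_trans enough_words; clear -le_D; lia.
apply: (spec_sub lam_ge0 enough_words bound _ (spec_for (Inv := Inv) lam_ge0 F_ge0 enough_words _ _ _ _ _ _ _ _ _)) => //.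
- by move=> [] rg' A' [fr r12' _ _ ok'].
- by rewrite szt.
- by move=> l y0 rg' A' /base_inv [_ _ _ rD] /=; rewrite szt.
- move=> l y0 rg1 rg2 A1 [fr h12 h3 h4 h5] fr'; split=> //.
    exact: frame_step fr fr' isT.
  by rewrite fr'.
move=> l0 u l1 [] rg1 A1 tE inv; have bs1 := base_inv _ _ _ _ inv.
move: inv => [fr r12' uS1 sub1 ok1] r13 t K uu cc g H.
have uE := take_ord_cat tE; rewrite uE in r13.
have SpE : Sp (rcons l0 u) = fstep (Sp l0) u by rewrite /Sp -cats1 foldl_cat.
have r11' : rg1 11 = ft by rewrite fr.
rewrite /block; u_seq; u_op; first exact: bool_lt enough_words _.
rewrite r12' r11'; u_if.
set rg2 := upd _ 17 _.
have fr2 : frame [:: 12; 17] rg1 rg2 by apply: frame_upd.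
have bs2 : base rg2 by apply: base_frame fr2 bs1.
case: ltnP => lt_S /=; last first.
  u_skip; apply: (UB_spent lam_ge0) (H tt _ A1 _); first by clear; lia.
  split; last by rewrite fr2 // r13 uE.
  rewrite /Inv SpE /fstep ltnNge lt_S /=; split=> //.
  exact: frame_step fr fr2 isT.
apply: (UB_callR (spec_insert (C := C) _ _ bs2 uS1 sub1 ok1 (c := u) _ _)) => //.
move=> rg3 A3 [fr3 r12_3 ok3].
apply: (UB_spent lam_ge0) (H tt _ A3 _); first by clear; lia.
split; last by rewrite fr3 // fr2 // r13 uE.
rewrite /Inv SpE /fstep lt_S; split=> //.
- exact: frame_step (frame_step fr fr2 isT) fr3 isT.
- exact: uniq_add_color.
- by move=> c /sub1 cS; rewrite mem_add_color cS orbT.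
Qed.

Definition inner_regs : seq nat := [:: 17; 18; 26; 30; 31; 32; 33].

(** The acceptance probabilities involve the number of distinct blocked colours; the marks of array
    6 prevent counting a repeated colour twice, and serve afterwards as a constant-time test for
    being blocked. *)
Lemma spec_count rg A x y L S mk (v : 'I_n) vo :
  base rg -> operand_ok vo -> fresh [:: 26; 30; 31; 32; 33] vo -> operand_value rg vo = v ->
  mem_ok x y L S mk (fun=> 0) A ->
  spec (count_colors vo) rg A (D * 40 + 13) (Ret tt) (fun _ rg' A' =>
    [/\ frame inner_regs rg rg', rg' 26 = #|nbr_colors e x v|
      & mem_ok x y L S mk (fun c => c \in nbr_colors e x v) A']).
Proof.
move=> bs okv fresh_v vE ok t K u cc g H.
pose Inv (l : seq 'I_n) (_ : unit) rg' A' :=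
  [/\ frame inner_regs rg rg', rg' 26 = #|[seq x u | u <- l]|
    & mem_ok x y L S mk (fun c => c \in [seq x u | u <- l]) A'].
have low_inv l y0 rg' A' : Inv l y0 rg' A' -> low k e A' by case=> _ _ [].
have base_inv l y0 rg' A' : Inv l y0 rg' A' -> base rg'.
  by case=> fr _ _; apply: base_frame fr bs.
have vE' : operand_value (upd rg 26 0) vo = v.
  by rewrite -vE; case: vo fresh_v {okv vE H} => //= r; rewrite inE negb_or => /andP[/negPf ->].
have fresh_v' : fresh [:: 30; 31; 32; 33] vo.
  by case: vo fresh_v {okv vE vE' H} => //= r; rewrite inE negb_or => /andP[].
u_seq; u_move; first exact: operand_ok_lt8 enough_words _ _.
have step : spec (for_nbrs 30 31 32 33 vo (block
    [:: load 17 0 (Reg 32);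
        load 18 6 (Reg 17);
        If (Reg 18) Skip (block
          [:: store 6 (Reg 17) (Cst 1);
              Op Add 26 (Reg 26) (Cst 1)])])) (upd rg 26 0) A
    (size (nbrs e v) * (33 + 7) + 11) (foldM (fun _ _ => Ret tt) (nbrs e v) tt) (Inv (nbrs e v)).
  apply: (spec_nbrs (Inv := Inv) lam_ge0 F_ge0 enough_words _ _ _ low_inv) => //; last first.
  - split; first by apply: frame_upd.
      by rewrite /= (eq_card (B := pred0)) ?card0.
    exact: mem_ok_ext ok.
  - move=> l0 q l1 [] rg1 A1 nE inv r32; have [rB rn rk rD] := base_inv _ _ _ _ inv.
    move: inv => [fr r26 ok1] t' K' u' c' g' H'.
    have [_ h2 _ h4 _] := ok1; have [hx _ _ _] := h2 q.
    have ltq := ltn_ord q; have ltx := ltn_ord (x q).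
    have cardE : #|[seq x u | u <- rcons l0 q]| =
        (x q \notin [seq x u | u <- l0]) + #|[seq x u | u <- l0]|.
      by rewrite -cardU1; apply: eq_card => c; rewrite map_rcons mem_rcons !inE.
    rewrite /block; u_seq; u_load; rewrite r32; first by clear -ltq; lia.
    rewrite hx; u_seq; u_load; first by clear -ltx; lia.
    rewrite h4; u_if; case: (boolP (x q \in [seq x u | u <- l0])) => xl /=.
      u_skip; apply: (UB_spent lam_ge0) (H' tt _ _ _); first by clear; lia.
      split=> //=; split=> /=; first by do 2 apply: frame_upd => //.
        by rewrite cardE xl.
      apply: mem_ok_ext ok1 => // c; rewrite map_rcons mem_rcons inE.
      by case: eqP => [->|]; rewrite ?xl.
    u_seq; u_store; first by clear -ltx; lia.
    have le26 : #|[seq x u | u <- l0]| <= k by rewrite -[X in _ <= X]card_ord max_card.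
    u_op; first by rewrite r26; apply: leq_ltn_trans enough_words; clear -le26; lia.
    apply: (UB_spent lam_ge0) (H' tt _ _ _); first by clear; lia.
    split=> //=; split=> /=; first by do 3 apply: frame_upd => //.
      by rewrite cardE xl r26 addnC.
    apply: mem_ok_ext (mem_ok_nbr_mark (x q) 1 ok1) => // c.
    by rewrite map_rcons mem_rcons inE; case: (c == x q).
  - move=> l y0 rg1 rg2 A1 [fr h12 h3] fr'; split=> //.
      exact: frame_step fr fr' isT.
    by rewrite fr'.
rewrite foldM_unit in step; apply: (UB_callR step) => rg' A' [fr r26 ok'].
apply: (UB_spent lam_ge0) (H tt _ _ _); last by split.
have := size_nbrs e v; clear; nia.
Qed.

Lemma spec_clear_colors rg A x y L S mk (v : 'I_n) vo :
  base rg -> operand_ok vo -> fresh [:: 30; 31; 32; 33] vo -> operand_value rg vo = v ->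
  mem_ok x y L S mk (fun c => c \in nbr_colors e x v) A ->
  spec (clear_colors vo) rg A (D * 25 + 11) (Ret tt) (fun _ rg' A' =>
    frame [:: 17; 30; 31; 32; 33] rg rg' /\ mem_ok x y L S mk (fun=> 0) A').
Proof.
move=> bs okv fresh_v vE ok.
pose Inv (l : seq 'I_n) (_ : unit) rg' A' := frame [:: 17; 30; 31; 32; 33] rg rg' /\
  mem_ok x y L S mk (fun c => (c \in nbr_colors e x v) && (c \notin [seq x u | u <- l])) A'.
have low_inv l y0 rg' A' : Inv l y0 rg' A' -> low k e A' by case=> _ [].
have base_inv l y0 rg' A' : Inv l y0 rg' A' -> base rg'.
  by case=> fr _; apply: base_frame fr bs.
rewrite -(foldM_unit (nbrs e v)).
have bound : size (nbrs e v) * (18 + 7) + 11 <= D * 25 + 11.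
  by rewrite leq_add2r leq_mul2r size_nbrs orbT.
apply: (spec_sub lam_ge0 enough_words bound _ (spec_nbrs (Inv := Inv) lam_ge0 F_ge0 enough_words _ _ _ low_inv _ _ _ _)) => //.
- move=> [] rg' A' [fr ok']; split=> //; apply: mem_ok_ext ok' => // c.
  by rewrite andbN.
- move=> l y0 rg1 rg2 A1 [fr h3] fr'; split=> //.
  exact: frame_step fr fr' isT.
- move=> l0 q l1 [] rg1 A1 nE inv r32; have [rB rn rk rD] := base_inv _ _ _ _ inv.
  move: inv => [fr ok1] t K u c g H.
  have [_ h2 _ h4 _] := ok1; have [hx _ _ _] := h2 q.
  have ltq := ltn_ord q; have ltx := ltn_ord (x q).
  rewrite /block; u_seq; u_load; rewrite r32; first by clear -ltq; lia.
  rewrite hx; u_store; first by clear -ltx; lia.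
  apply: (UB_spent lam_ge0) (H tt _ _ _); first by clear; lia.
  split=> //=; split=> /=; first by apply: frame_upd.
  apply: mem_ok_ext (mem_ok_nbr_mark (x q) 0 ok1) => // c'.
  by rewrite map_rcons mem_rcons inE; case: (c' == x q) => //=; rewrite ?andbF.
split=> //; apply: mem_ok_ext ok => // c.
by rewrite andbT.
Qed.

Lemma spec_clear_marks rg A x y L (S C : seq 'I_k) nk :
  base rg -> rg 12 = size S -> uniq S -> {subset C <= S} ->
  mem_ok x y L S (mark S C) nk A ->
  spec clear_marks rg A (size S * 25 + 6) (Ret tt) (fun _ rg' A' =>
    frame [:: 13; 16; 17] rg rg' /\ mem_ok x y L [::] (fun=> 0) nk A').
Proof.
move=> bs r12 uS sub ok.
pose Inv (l : seq 'I_k) (_ : unit) rg' A' := frame [:: 13; 16; 17] rg rg' /\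
  mem_ok x y L S (fun c => if c \in l then 0 else mark S C c) nk A'.
rewrite -(foldM_unit S).
have base_inv l y0 rg' A' : Inv l y0 rg' A' -> base rg'.
  by case=> fr _; apply: base_frame fr bs.
have bound : size S * (20 + 5) + 6 <= size S * 25 + 6 by [].
have leS := size_uniq_le uS.
have nM : size S < 2 ^ w by apply: leq_ltn_trans enough_words; clear -leS; lia.
apply: (spec_sub lam_ge0 enough_words bound _ (spec_for (Inv := Inv) lam_ge0 F_ge0 enough_words _ _ _ _ _ _ _ _ _)) => //.
- move=> [] rg' A' [fr [h1 h2 h3 h4 h5]]; split=> //; split=> // c; rewrite h3.
  case: ifP => // cS; rewrite /mark cS.
  by case: ifP => // /sub; rewrite cS.
- by move=> l y0 rg' A' [fr _] /=; rewrite fr.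
- move=> l y0 rg1 rg2 A1 [fr h3] fr'; split=> //.
  exact: frame_step fr fr' isT.
- move=> l0 c l1 [] rg1 A1 SE inv r13; have [rB rn rk rD] := base_inv _ _ _ _ inv.
  move: inv => [fr ok1] t K u cc g H.
  have [_ _ _ _ h5] := ok1.
  have lt_l : size l0 < size S by rewrite SE size_cat /= -addn1 leq_add2l.
  have A5 : A1 5 (size l0) = c by rewrite (h5 _ c) // SE nth_cat ltnn subnn.
  have ltc := ltn_ord c.
  rewrite /block; u_seq; u_load; rewrite r13; first by clear -lt_l leS; lia.
  rewrite A5; u_store; first by clear -ltc; lia.
  apply: (UB_spent lam_ge0) (H tt _ _ _); first by clear; lia.
  split=> //=; split=> /=; first by apply: frame_upd.
  apply: mem_ok_ext (mem_ok_mark c 0 ok1) => // c'.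
  by rewrite mem_rcons inE; case: (c' == c).
Qed.

End Routines.

Definition sample_color : cmd := sample (Reg 3) (load 24 4 (Reg 20)).

Definition sample_below : cmd := sample (Reg 28) (move 24 (Cst 0)).

Definition sample_free : cmd :=
  sample (Reg 12) (Seq (load 25 5 (Reg 20)) (load 24 6 (Reg 25))).

Definition compress_cmd : cmd :=
  block [:: count_colors (Reg 15);
    sample_color;
    move 27 (Reg 20);
    Op Defs.Sub 28 (Reg 3) (Reg 26);
    sample_below;
    Op Defs.Sub 29 (Reg 3) (Reg 12);
    Op Lt 29 (Reg 20) (Reg 29);
    load 18 6 (Reg 27);
    Op Lt 18 (Reg 18) (Reg 29);
    If (Reg 18) (move 19 (Reg 27)) (Seq sample_free (load 19 5 (Reg 20)));
    clear_colors (Reg 15);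
    store 0 (Reg 15) (Reg 19);
    store 5 (Reg 12) (Reg 27);
    store 4 (Reg 27) (Cst 1);
    Op Add 12 (Reg 12) (Cst 1)].

Definition contract_cmd : cmd :=
  block [:: count_colors (Reg 9);
    sample_color;
    move 27 (Reg 20);
    Op Defs.Sub 28 (Reg 3) (Reg 4);
    sample_below;
    move 29 (Reg 20);
    Op Defs.Sub 28 (Reg 3) (Reg 26);
    sample_below;
    move 19 (Reg 27);
    move 16 (Reg 27);
    Op Lt 17 (Reg 29) (Reg 12);
    If (Reg 17) (block
      [:: load 18 5 (Reg 29);
          load 17 4 (Reg 18);
          Op Lt 17 (Reg 17) (Cst 2);
          If (Reg 17) (move 16 (Reg 18)) Skip;
          Op Defs.Sub 28 (Reg 3) (Reg 4);
          Op Lt 28 (Reg 20) (Reg 28);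
          load 17 6 (Reg 18);
          Op Lt 17 (Reg 17) (Reg 28);
          If (Reg 17) (move 19 (Reg 18)) Skip]) Skip;
    clear_colors (Reg 9);
    store 0 (Reg 9) (Reg 19);
    store 2 (Reg 9) (Reg 27);
    store 3 (Reg 9) (Reg 16)].

(** * The two heat-bath updates as programs *)

Section Updates.
Variables (R : realType) (w : nat) (lam : R) (F : state -> R).
Hypothesis lam_ge0 : (0 <= lam)%R.
Hypothesis F_ge0 : forall s, (0 <= F s)%R.
Variables (n k : nat) (e : rel 'I_n).

Local Notation B := (pointer e n).
Local Notation M := (n + k + 1).
Local Notation D := (max_degree e).
Hypothesis enough_words : B + 8 * M + 8 < 2 ^ w.
Hypothesis lt_D : 3 * D < k.

Local Notation UB := (UB w lam F B M).
Local Notation spec := (spec w lam F B M).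
Local Notation coloring := {ffun 'I_n -> 'I_k}.
Local Notation bounds := {ffun 'I_n -> 'I_k * 'I_k}.
Local Notation mem_ok := (mem_ok e).
Local Notation base := (base k e).
Local Notation lk := (up_log 2 k).

Ltac u_seq := apply: (UB_seq lam_ge0 F_ge0 enough_words).
Ltac u_op := apply: (UB_op lam_ge0 F_ge0 enough_words) => //=.
Ltac u_if := apply: (UB_if lam_ge0 F_ge0 enough_words) => //=.
Ltac u_skip := apply: (UB_skip lam_ge0 F_ge0 enough_words).
Ltac u_load := apply: (UB_load lam_ge0 F_ge0 enough_words) => //=.
Ltac u_store := apply: (UB_store lam_ge0 F_ge0 enough_words) => //=.
Ltac u_move := apply: (UB_move lam_ge0 F_ge0 enough_words) => //=.

(** The machine draws codes, the chain draws colours. An injective code can be inverted on the list,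
    so a reward on colours becomes one on codes. *)
Lemma spec_draw_map (U : eqType) (h : U -> nat) (l : seq U) p rg A cost Post :
  uniq (map h l) ->
  (forall j rg' A', Post j rg' A' -> j \in map h l) ->
  spec p rg A cost (Draw (map h l) Ret) Post ->
  spec p rg A cost (Draw l Ret) (fun s rg' A' => s \in l /\ Post (h s) rg' A').
Proof.
move=> uh inP H t K u c g H'.
case: l uh inP H H' => [|s0 l'] uh inP H H'.
  have := H t K u c (fun=> 0%R); rewrite /= !big_nil; apply => j rg' A' /inP.
  by rewrite in_nil.
set l := s0 :: l' in uh inP H H' *.
pose g' j := g (nth s0 l (index j (map h l))).
have gE s : s \in l -> nth s0 l (index (h s) (map h l)) = s.
  move=> sl; rewrite -{1}(nth_index s0 sl) -(nth_map s0 (h s0)) ?index_mem //.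
  by rewrite index_uniq ?size_map ?index_mem // nth_index.
have -> : expect (Draw l Ret) g = expect (Draw (map h l) Ret) g'.
  rewrite /expect size_map big_map; congr (_ / _)%R.
  by apply: eq_big_seq => s sl; rewrite /g' gE.
apply: H => j rg' A' Pj; have /mapP[s sl jE] := inP _ _ _ Pj.
by rewrite /g' jE gE //; apply: H'; split; rewrite // -jE.
Qed.

Lemma up_log_le m : m <= k -> up_log 2 m <= lk.
Proof. exact: leq_up_log. Qed.

Lemma words_mul x : x <= k -> 2 * x < 2 ^ w.
Proof. by move=> h; apply: leq_ltn_trans enough_words; clear -h; lia. Qed.

Lemma spec_sample_color rg A x y L (S C : seq 'I_k) nk :
  base rg -> uniq S -> size S <= 2 * D -> {subset C <= S} ->
  mem_ok x y L S (mark S C) nk A ->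
  spec sample_color rg A (60 * lk + 170) (Draw (outside S) Ret) (fun c rg' A' =>
    [/\ frame sample_regs rg rg', rg' 20 = c, c \notin S & A' = A]).
Proof.
move=> bs uS leS sub ok; have [rB rn rk rD] := bs.
have [_ _ h3 _ _] := ok.
have goodsE : [seq j <- iota 0 k | j \notin map val S] = map val (outside S).
  rewrite -val_enum_ord filter_map /outside; congr map; apply: eq_filter => c /=.
  by rewrite mem_map //; exact: val_inj.
have k0 : 0 < k by apply: leq_ltn_trans lt_D.
have S_lt : size S < k by apply: leq_ltn_trans leS _; apply: leq_ltn_trans lt_D; rewrite leq_mul2r orbT.
have out0 : outside S != [::] by exact: outside_neq0.
have test j rg' : frame sample_regs rg rg' -> rg' 20 = j -> j < k ->
  spec (load 24 4 (Reg 20)) rg' A 7 (Ret tt) (fun _ rg'' A'' =>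
    [/\ frame [:: 24; 25] rg' rg'', (rg'' 24 != 0) = ~~ (j \notin map val S) & A'' = A]).
  move=> fr r20 lt_j t K u c g H; u_load.
  - by rewrite fr.
  - by rewrite r20; clear -lt_j; lia.
  rewrite r20; apply: H; split=> //; first by apply: frame_upd.
  rewrite /= -[j]/(val (Ordinal lt_j)) h3 negbK mem_map ?/mark; last exact: val_inj.
  by case: ifP => [/sub ->|] //=; case: (_ \in S).
have sp := spec_sample lam_ge0 F_ge0 enough_words (m := Reg 3) (mm := k) (good := fun j => j \notin map val S)
  (ct := 7) (rho := 6) k0 (words_mul (leqnn k)) isT isT rk _ _ test.
rewrite goodsE size_map in sp.
have out0' : map val (outside S) != [::] by case: (outside S) out0.
(* More than a third of the colours lie outside S, since |S| <= 2D and 3D < k; hence rho = 6. *)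
have bound : 2 * k <= 6 * size (outside S).
  by rewrite size_outside_uniq //; clear -leS lt_D; lia.
have sp' := spec_draw_map _ _ (sp out0' bound).
apply: (spec_sub lam_ge0 enough_words _ _ (sp' _ _)); first by clear; lia.
- move=> c rg' A' [cS [fr r20 _ _ AE]]; split=> //.
  by rewrite -mem_outside.
- by rewrite (map_inj_uniq val_inj) filter_uniq // enum_uniq.
move=> j rg' A' [_ _ jS lt_j _]; rewrite -[j]/(val (Ordinal lt_j)) map_f // mem_outside.
by apply: contra jS => jS; rewrite -[j]/(val (Ordinal lt_j)) map_f.
Qed.

Lemma spec_sample_below rg A mm :
  rg 28 = mm -> 0 < mm -> mm <= k ->
  spec sample_below rg A (20 * lk + 50) (Draw (iota 0 mm) Ret) (fun a rg' A' =>
    [/\ frame sample_regs rg rg', rg' 20 = a, a < mm & A' = A]).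
Proof.
move=> r28 mm0 le_mm.
have test j rg' : frame sample_regs rg rg' -> rg' 20 = j -> j < mm ->
  spec (move 24 (Cst 0)) rg' A 1 (Ret tt) (fun _ rg'' A'' =>
    [/\ frame [:: 24; 25] rg' rg'', (rg'' 24 != 0) = ~~ xpredT j & A'' = A]).
  move=> fr r20 lt_j t K u c g H; u_move; first exact: operand_ok_lt8 enough_words _ _.
  apply: (UB_spent lam_ge0) (H tt _ _ _); first by clear; lia.
  by split=> //; apply: frame_upd.
(* Every value below [mm] is accepted, so rho = 2 only pays for rounding up to a power of 2. *)
have := spec_sample lam_ge0 F_ge0 enough_words (m := Reg 28) (mm := mm) (good := xpredT)
  (ct := 1) (rho := 2) mm0 (words_mul le_mm) isT isT r28 _ _ test.
rewrite filter_predT size_iota => sp.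
apply: (spec_sub lam_ge0 enough_words _ _ (sp _ _)) => //.
- by have := up_log_le le_mm; clear; lia.
- by move=> j rg' A' [].
by case: mm mm0 {r28 le_mm test sp}.
Qed.

(** A single free member among up to 2D may be all there is, whence rho = 4D and an expected cost of
    order D log k, within [update_cost]. *)
Lemma spec_sample_free rg A x y L (S : seq 'I_k) mk (N : seq 'I_k) :
  base rg -> uniq S -> rg 12 = size S -> size S <= 2 * D ->
  has [predC N] S ->
  mem_ok x y L S mk (fun c => c \in N) A ->
  spec sample_free rg A (D * (40 * lk + 140) + 3) (Draw [seq s <- S | s \notin N] Ret)
    (fun s rg' A' => [/\ frame sample_regs rg rg', s \in S, A 5 (rg' 20) = s,
       rg' 20 < size S & A' = A]).
Proof.
move=> bs uS r12 leS hasN ok; have [rB rn rk rD] := bs.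
have [_ _ _ h4 h5] := ok.
have [c0 c0S c0N] := hasP hasN.
have S0 : 0 < size S by case: S c0S {uS r12 leS hasN ok h5}.
have leSk := size_uniq_le uS.
pose good j := nth c0 S j \notin N.
have test j rg' : frame sample_regs rg rg' -> rg' 20 = j -> j < size S ->
  spec (Seq (load 25 5 (Reg 20)) (load 24 6 (Reg 25))) rg' A 15 (Ret tt) (fun _ rg'' A'' =>
    [/\ frame [:: 24; 25] rg' rg'', (rg'' 24 != 0) = ~~ good j & A'' = A]).
  move=> fr r20 lt_j t K u c g H; u_seq; u_load.
  - by rewrite fr.
  - by rewrite r20; clear -lt_j leSk; lia.
  have lt_c := ltn_ord (nth c0 S j).
  u_load; [by rewrite fr|rewrite r20 (h5 _ c0) //|].
    by apply: leq_trans lt_c _; rewrite addnAC leq_addl.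
  rewrite r20 (h5 _ c0) //.
  apply: (UB_spent lam_ge0) (H tt _ _ _); first by clear; lia.
  split=> //; first by do 2 apply: frame_upd => //.
  by rewrite /= h4 /good negbK; case: (_ \in N).
have := spec_sample lam_ge0 F_ge0 enough_words (m := Reg 12) (mm := size S) (good := good)
  (ct := 15) (rho := 4 * D) S0 (words_mul leSk) isT isT r12 _ _ test.
have SE : S = [seq nth c0 S j | j <- iota 0 (size S)] by rewrite map_nth_iota0 ?take_size.
have lE : [seq s <- S | s \notin N] = [seq nth c0 S j | j <- [seq j <- iota 0 (size S) | good j]].
  by rewrite {1}SE filter_map.
have goodsE : [seq j <- iota 0 (size S) | good j] = [seq index s S | s <- [seq s <- S | s \notin N]].
  rewrite lE -map_comp -[LHS]map_id; apply/eq_in_map => j.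
  by rewrite mem_filter mem_iota add0n => /andP[_ /andP[_ lt_j]] /=; rewrite index_uniq.
rewrite goodsE size_map => sp.
have f0 : has [predC N] S -> [seq s <- S | s \notin N] != [::] by rewrite has_filter.
have f0' := f0 hasN.
have sz0 : 0 < size [seq s <- S | s \notin N] by rewrite lt0n size_eq0.
have sp1 := spec_draw_map _ _ (sp _ _).
apply: (spec_sub lam_ge0 enough_words _ _ (sp1 _ _ _ _)).
- have := up_log_le leSk; clear; nia.
- move=> s rg' A' [sN [fr r20 _ lt_s AE]]; have sS : s \in S by move: sN; rewrite mem_filter => /andP[].
  by split=> //; rewrite r20 // (h5 _ c0) ?nth_index.
- by rewrite -goodsE filter_uniq // iota_uniq.
- by move=> j rg' A' [_ _ gj lt_j _]; rewrite -goodsE mem_filter gj mem_iota add0n.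
- by case: [seq s <- S | s \notin N] f0'.
by move: leS sz0; clear; nia.
Qed.

Definition update_cost : nat := 500 * (D.+1 * lk.+1).

Lemma spec_compress rg A x y L (S C : seq 'I_k) (v : 'I_n) :
  base rg -> rg 15 = v -> rg 12 = size S -> uniq S -> {subset C <= S} ->
  D <= size S -> size S < 2 * D -> mem_ok x y L S (mark S C) (fun=> 0) A ->
  spec compress_cmd rg A update_cost (compress e v (x, S)) (fun q rg' A' =>
    [/\ frame (12 :: iota 17 17) rg rg', rg' 12 = size q.2,
       exists2 c, c \notin S & q.2 = rcons S c
     & mem_ok q.1 y L q.2 (mark q.2 C) (fun=> 0) A']).
Proof.
move=> bs r15 r12 uS sub geS ltS ok t K u cc g H.
have leS := ltnW ltS.
have leSk : size S <= k by exact: size_uniq_le.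
pose N := nbr_colors e x v.
have leN : #|N| <= D by exact: card_nbr_colors.
have ltn_v := ltn_ord v.
(* The nested draws of [compress] are cut into one reward function per sampling command, to be
   handed over successively. *)
pose g2 c a := expect (if (c \notin N) && (a < k - size S)
  then Ret (recolor x v c, rcons S c)
  else Draw [seq s <- S | s \notin N] (fun s => Ret (recolor x v s, rcons S c))) g.
pose g1 c := expect (Draw (iota 0 (k - #|N|)) Ret) (g2 c).
rewrite -[expect _ g]/(expect (Draw (outside S) Ret) g1).
rewrite /compress_cmd; rewrite {1}/block; u_seq.
apply: (UB_callR lam_ge0 (spec_count lam_ge0 F_ge0 enough_words (v := v) bs _ _ _ ok)) => //.
move=> rg1 A1 [fr1 r26 ok1]; rewrite -/N in r26 ok1.
have bs1 := base_frame (T := inner_regs) isT fr1 bs.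
u_seq; apply: (UB_call lam_ge0 (spec_sample_color bs1 uS leS sub ok1) (lexx _)).
move=> c rg2 A2 [fr2 r20 cS ->] {A2}.
have bs2 := base_frame (T := sample_regs) isT fr2 bs1.
have ltc := ltn_ord c.
u_seq; u_move; first by rewrite r20; apply: (word_small enough_words); clear -ltc; lia.
have r26_2 : rg2 26 = #|N| by rewrite fr2.
have [_ _ r3_2 _] := bs2.
u_seq; u_op; first by apply: (word_small enough_words); rewrite r3_2; clear; lia.
rewrite r20 r3_2 r26_2.
set rg3 := upd _ 28 _.
have fr3 : frame [:: 27; 28] rg2 rg3 by do 2 apply: frame_upd => //.
have pos_N : 0 < k - #|N| by clear -leN lt_D; lia.
have r28 : rg3 28 = k - #|N| by [].
u_seq; apply: (UB_call (g := g2 c) lam_ge0 (spec_sample_below r28 pos_N (leq_subr _ _))) => //.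
move=> a rg4 A4 [fr4 r20' lta ->] {A4}.
have fr04 : frame (12 :: iota 17 17) rg rg4.
  exact: frame_step (frame_step (frame_step (frame_step (@frame_refl (12 :: iota 17 17) rg) fr1 isT) fr2 isT) fr3 isT) fr4 isT.
have bs4 := base_frame (T := 12 :: iota 17 17) isT fr04 bs.
have [rB4 rn4 rk4 rD4] := bs4.
have r27_4 : rg4 27 = c by rewrite fr4.
have r12_4 : rg4 12 = size S by rewrite fr4 // fr3 // fr2 // fr1.
have r15_4 : rg4 15 = v by rewrite fr04.
have tail rg5 A5 (s : 'I_k) cost : frame (iota 17 9 ++ [:: 29]) rg4 rg5 -> rg5 19 = s ->
   mem_ok x y L S (mark S C) (fun c => c \in N) A5 ->
   cost + (D * 25 + 40) <= update_cost ->
   UB t (block [:: clear_colors (Reg 15); store 0 (Reg 15) (Reg 19);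
    store 5 (Reg 12) (Reg 27); store 4 (Reg 27) (Cst 1); Op Add 12 (Reg 12) (Cst 1)] :: K)
    rg5 A5 (u + cost) cc (g (recolor x v s, rcons S c)).
  move=> fr5 r19 ok5 le_cost.
  have fr05 : frame (12 :: iota 17 17) rg rg5 by exact: frame_step fr04 fr5 isT.
  have bs5 := base_frame (T := 12 :: iota 17 17) isT fr05 bs.
  rewrite /block; u_seq.
  apply: (UB_callR lam_ge0 (spec_clear_colors lam_ge0 F_ge0 enough_words (v := v) bs5 _ _ _ ok5)) => //.
    by rewrite /= fr5.
  move=> rg6 A6 [fr6 ok6].
  have fr06 : frame (12 :: iota 17 17) rg rg6 by exact: frame_step fr05 fr6 isT.
  have [rB6 _ _ _] := base_frame (T := 12 :: iota 17 17) isT fr06 bs.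
  have r15_6 : rg6 15 = v by rewrite fr06.
  have r12_6 : rg6 12 = size S by rewrite fr6 // fr5.
  have r19_6 : rg6 19 = s by rewrite fr6.
  have r27_6 : rg6 27 = c by rewrite fr6 // fr5.
  u_seq; u_store; first by rewrite r15_6; clear -ltn_v; lia.
  u_seq; u_store; first by rewrite r12_6; clear -leSk; lia.
  u_seq; u_store; first by rewrite r27_6; clear -ltc; lia.
  u_op; first by apply: (word_small enough_words); rewrite r12_6; clear -leSk; lia.
  rewrite r15_6 r12_6 r19_6 r27_6 (addn1 (size S)).
  apply: (UB_spent lam_ge0) (H _ _ _ _); first by clear -le_cost; lia.
  split=> /=.
  - by apply: frame_upd.
  - by rewrite size_rcons.
  - by exists c.
  have := mem_ok_mark c 1 (mem_ok_rcons c (mem_ok_x v s ok6)).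
  apply: mem_ok_ext => // c'; rewrite /mark mem_rcons inE.
  case: eqP => [->|_] //=; case: ifP => // /sub; by rewrite (negPf cS).
have le_size : k - size S <= k by exact: leq_subr.
u_seq; u_op; first by apply: (word_small enough_words); rewrite rk4; clear; lia.
u_seq; u_op; first exact: bool_lt enough_words _.
u_seq; u_load; first by rewrite r27_4; clear -ltc; lia.
have [_ _ _ h4 _] := ok1.
rewrite r27_4 h4 r20' rk4 r12_4.
u_seq; u_op; first exact: bool_lt enough_words _.
(* On bits, the machine comparison x < y computes the conjunction of y with the negation of x. *)
have -> : ((c \in N) < (a < k - size S)) = (c \notin N) && (a < k - size S).
  by case: (c \in N); case: (a < _).
set rg5 := upd _ 18 _.
have fr5 : frame (iota 17 9 ++ [:: 29]) rg4 rg5 by do 4 apply: frame_upd => //.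
have r27_5 : rg5 27 = c by rewrite fr5.
have r18 : rg5 18 = (c \notin N) && (a < k - size S) by [].
rewrite /g2; u_seq; u_if; rewrite r18; case: (boolP ((c \notin N) && _)) => [_|bad] /=.
  u_move; first by rewrite r27_5; apply: (word_small enough_words); clear -ltc; lia.
  apply: (UB_spent lam_ge0) (tail _ _ c (D * 40 + lk * 80 + 300) _ _ ok1 _).
  - by clear; lia.
  - by apply: frame_upd.
  - by rewrite /= r27_5.
  rewrite /update_cost; clear; nia.
(* The rejection loop must be able to succeed. If all of S were blocked, then S = N as sets and the
   test on c and a could not have failed. *)
have hasN : has [predC N] S.
  rewrite has_predC; apply/negP => /allP SN.
  have leSN : size S <= #|N|.
    by rewrite -(card_uniqP uS); apply: subset_leq_card; apply/fintype.subsetP => c' /SN.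
  have eqS : size S = #|N| by apply/eqP; rewrite eqn_leq leSN (leq_trans leN).
  move: bad; rewrite eqS lta andbT negbK => cN.
  have SNE : mem S =i N.
    apply/fintype.subset_cardP; first by rewrite (card_uniqP uS).
    by apply/fintype.subsetP => c' /SN.
  by move: cS; rewrite -[c \in S]/(c \in mem S) SNE cN.
rewrite -[(_ / _)%R]/(expect (Draw [seq s <- S | s \notin N] Ret) (fun s =>
  g (recolor x v s, rcons S c))).
have fr05 : frame (12 :: iota 17 17) rg rg5 by exact: frame_step fr04 fr5 isT.
have bs5 := base_frame (T := 12 :: iota 17 17) isT fr05 bs.
u_seq; apply: (UB_call lam_ge0 (spec_sample_free bs5 uS _ leS hasN ok1) (lexx _)) => //.
move=> s rg6 A6 [fr6 sS A5s lt20 ->] {A6}.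
have bs6 := base_frame (T := sample_regs) isT fr6 bs5; have [rB6 _ _ _] := bs6.
u_load; first by clear -lt20 leSk; lia.
rewrite A5s.
apply: (UB_spent lam_ge0) (tail _ _ s (D * 40 + lk * 80 + 300 + D * (40 * lk + 140)) _ _ ok1 _).
- by clear; lia.
- by apply: frame_upd => //; exact: frame_step fr5 fr6 isT.
- by [].
rewrite /update_cost; clear; nia.
Qed.

Lemma spec_contract rg A x y L (S C : seq 'I_k) (v : 'I_n) :
  base rg -> rg 9 = v -> rg 12 = size S -> uniq S -> {subset C <= S} ->
  size S <= 2 * D -> mem_ok x y L S (mark S C) (fun=> 0) A ->
  spec contract_cmd rg A update_cost (contract e v C S (x, L)) (fun p rg' A' =>
    frame (iota 16 18) rg rg' /\ mem_ok p.1 y p.2 S (mark S C) (fun=> 0) A').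
Proof.
move=> bs r9 r12 uS sub leS ok t K u cc g H.
have leSk : size S <= k by exact: size_uniq_le.
pose N := nbr_colors e x v.
have leN : #|N| <= D by exact: card_nbr_colors.
have ltn_v := ltn_ord v.
pose g3 c j a := let c' := nth c S j in
  g (recolor x v (if [&& j < size S, c' \notin N & a < k - D] then c' else c),
     recolor L v (c, if (j < size S) && (c' \notin C) then c' else c)).
pose g2 c j := expect (Draw (iota 0 (k - #|N|)) Ret) (g3 c j).
pose g1 c := expect (Draw (iota 0 (k - D)) Ret) (g2 c).
rewrite -[expect _ g]/(expect (Draw (outside S) Ret) g1).
rewrite /contract_cmd; rewrite {1}/block; u_seq.
apply: (UB_callR lam_ge0 (spec_count lam_ge0 F_ge0 enough_words (v := v) bs _ _ _ ok)) => //.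
move=> rg1 A1 [fr1 r26 ok1]; rewrite -/N in r26 ok1.
have bs1 := base_frame (T := inner_regs) isT fr1 bs.
u_seq; apply: (UB_call lam_ge0 (spec_sample_color bs1 uS leS sub ok1) (lexx _)).
move=> c rg2 A2 [fr2 r20 cS ->] {A2}.
have bs2 := base_frame (T := sample_regs) isT fr2 bs1.
have ltc := ltn_ord c.
u_seq; u_move; first by rewrite r20; apply: (word_small enough_words); clear -ltc; lia.
have r26_2 : rg2 26 = #|N| by rewrite fr2.
have [_ _ r3_2 r4_2] := bs2.
u_seq; u_op; first by apply: (word_small enough_words); rewrite r3_2; clear; lia.
rewrite r20 r3_2 r4_2.
set rg3 := upd _ 28 _.
have fr3 : frame [:: 27; 28] rg2 rg3 by do 2 apply: frame_upd => //.
have r28 : rg3 28 = k - D by [].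
have pos_D : 0 < k - D by clear -lt_D; lia.
u_seq; apply: (UB_call (g := g2 c) lam_ge0 (spec_sample_below r28 pos_D (leq_subr _ _))) => //.
move=> j rg4 A4 [fr4 r20' ltj ->] {A4}.
have lt_jk : j < k by apply: leq_trans ltj (leq_subr _ _).
u_seq; u_move; first by rewrite r20'; apply: (word_small enough_words); clear -lt_jk; lia.
have r26_4 : rg4 26 = #|N| by rewrite fr4 // fr3.
have [_ _ r3_4 r4_4] := base_frame (T := sample_regs) isT fr4 (base_frame (T := [:: 27; 28]) isT fr3 bs2).
u_seq; u_op; first by apply: (word_small enough_words); rewrite r3_4; clear; lia.
rewrite r20' r3_4 r26_4.
set rg5 := upd _ 28 _.
have fr5 : frame [:: 28; 29] rg4 rg5 by do 2 apply: frame_upd => //.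
have r28_5 : rg5 28 = k - #|N| by [].
have pos_N : 0 < k - #|N| by clear -leN lt_D; lia.
u_seq; apply: (UB_call (g := g3 c j) lam_ge0 (spec_sample_below r28_5 pos_N (leq_subr _ _))) => //.
move=> a rg6 A6 [fr6 r20'' lta ->] {A6}.
have fr06 : frame (iota 16 18) rg rg6.
  have fr := frame_step (frame_step (@frame_refl (iota 16 18) rg) fr1 isT) fr2 isT.
  exact: frame_step (frame_step (frame_step (frame_step fr fr3 isT) fr4 isT) fr5 isT) fr6 isT.
have bs6 := base_frame (T := iota 16 18) isT fr06 bs.
have [rB6 rn6 rk6 rD6] := bs6.
have r27_6 : rg6 27 = c by rewrite fr6 // fr5 // fr4.
have r29_6 : rg6 29 = j by rewrite fr6.
have r12_6 : rg6 12 = size S by rewrite fr06.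
have r9_6 : rg6 9 = v by rewrite fr06.
have tail rg7 (s s' : 'I_k) cost : frame [:: 16; 17; 18; 19; 28] rg6 rg7 ->
   rg7 19 = s -> rg7 16 = s' -> cost + (D * 25 + 40) <= update_cost ->
   UB t (block [:: clear_colors (Reg 9); store 0 (Reg 9) (Reg 19);
    store 2 (Reg 9) (Reg 27); store 3 (Reg 9) (Reg 16)] :: K)
    rg7 A1 (u + cost) cc (g (recolor x v s, recolor L v (c, s'))).
  move=> fr7 r19 r16 le_cost.
  have fr07 : frame (iota 16 18) rg rg7 by exact: frame_step fr06 fr7 isT.
  have bs7 := base_frame (T := iota 16 18) isT fr07 bs.
  rewrite /block; u_seq.
  apply: (UB_callR lam_ge0 (spec_clear_colors lam_ge0 F_ge0 enough_words (v := v) bs7 _ _ _ ok1)) => //.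
    by rewrite /= fr7.
  move=> rg8 A8 [fr8 ok8].
  have fr08 : frame (iota 16 18) rg rg8 by exact: frame_step fr07 fr8 isT.
  have [rB8 _ _ _] := base_frame (T := iota 16 18) isT fr08 bs.
  have r9_8 : rg8 9 = v by rewrite fr08.
  have r19_8 : rg8 19 = s by rewrite fr8.
  have r16_8 : rg8 16 = s' by rewrite fr8.
  have r27_8 : rg8 27 = c by rewrite fr8 // fr7.
  u_seq; u_store; first by rewrite r9_8; clear -ltn_v; lia.
  u_seq; u_store; first by rewrite r9_8; clear -ltn_v; lia.
  u_store; first by rewrite r9_8; clear -ltn_v; lia.
  rewrite r9_8 r16_8 r19_8 r27_8.
  apply: (UB_spent lam_ge0) (H _ _ _ _); first by clear -le_cost; lia.
  by split=> //=; apply: mem_ok_L (mem_ok_x v s ok8).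
have cost_ok : D * 40 + 13 + (60 * lk + 170) + 2 * (20 * lk + 50) + 80 + (D * 25 + 40) <= update_cost.
  by rewrite /update_cost; clear; nia.
have [_ _ h3 h4 h5] := ok1.
u_seq; u_move; first by rewrite r27_6; apply: (word_small enough_words); clear -ltc; lia.
u_seq; u_move; first by rewrite r27_6; apply: (word_small enough_words); clear -ltc; lia.
u_seq; u_op; first exact: bool_lt enough_words _.
rewrite r27_6 r29_6 r12_6; set rg7 := upd _ 17 _.
have fr7 : frame [:: 16; 17; 18; 19; 28] rg6 rg7 by do 3 apply: frame_upd => //.
have r17_7 : rg7 17 = (j < size S) by [].
rewrite /g3; u_seq; u_if; rewrite r17_7; case: ltnP => ltjS /=; last first.
  u_skip; apply: (UB_spent lam_ge0) (tail _ c c _ fr7 _ _ cost_ok) => //.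
  by clear; lia.
set c' := nth c S j; have ltc' := ltn_ord c'.
have [rB7 _ rk7 rD7] := base_frame (T := [:: 16; 17; 18; 19; 28]) isT fr7 bs6.
have r29_7 : rg7 29 = j by rewrite fr7.
have r20_7 : rg7 20 = a by rewrite fr7.
u_seq; u_load; first by rewrite r29_7; clear -lt_jk; lia.
rewrite r29_7 (h5 _ c) // -/c'.
u_seq; u_load; first by clear -ltc'; lia.
rewrite h3; u_seq; u_op; first exact: bool_lt enough_words _.
have -> : (mark S C c' < 2) = (c' \notin C).
  by rewrite /mark; case: (c' \in C); case: (c' \in S).
set rg8 := upd _ 17 (nat_of_bool (c' \notin C)).
have fr8 : frame [:: 16; 17; 18; 19; 28] rg6 rg8 by do 3 apply: frame_upd => //.
have r17_8 : rg8 17 = (c' \notin C) by [].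
have r18_8 : rg8 18 = c' by [].
u_seq; u_if; rewrite r17_8.
(* The second bound. Marks distinguish blocked for sure (2) from merely listed (1), so comparing the
   mark with 2 decides it without reference to the colouring. *)
pose c2 := if c' \notin C then c' else c.
have after rg9 cost : frame [:: 16; 17; 18; 19; 28] rg6 rg9 -> rg9 18 = c' ->
  rg9 16 = c2 -> rg9 19 = c ->
  cost + 20 + (D * 25 + 40) <= update_cost ->
  UB t [:: block
         [:: Op Defs.Sub 28 (Reg 3) (Reg 4);
          Op Lt 28 (Reg 20) (Reg 28);
          load 17 6 (Reg 18);
          Op Lt 17 (Reg 17) (Reg 28);
          If (Reg 17) (move 19 (Reg 18)) Skip],
         block [:: clear_colors (Reg 9); store 0 (Reg 9) (Reg 19);
    store 2 (Reg 9) (Reg 27); store 3 (Reg 9) (Reg 16)] & K] rg9 A1 (u + cost) cc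
    (g (recolor x v (if (c' \notin N) && (a < k - D) then c' else c), recolor L v (c, c2))).
  move=> fr9 r18 r16 r19 le_cost.
  have [rB9 _ rk9 rD9] := base_frame (T := [:: 16; 17; 18; 19; 28]) isT fr9 bs6.
  have r20_9 : rg9 20 = a by rewrite fr9.
  rewrite {1}/block; u_seq; u_op; first by apply: (word_small enough_words); rewrite rk9; clear; lia.
  u_seq; u_op; first exact: bool_lt enough_words _.
  u_seq; u_load; first by rewrite r18; clear -ltc'; lia.
  rewrite r18 h4 r20_9 rk9 rD9.
  u_seq; u_op; first exact: bool_lt enough_words _.
  have -> : ((c' \in N) < (a < k - D)) = (c' \notin N) && (a < k - D).
    by case: (c' \in N); case: (a < _).
  set rg10 := upd _ 17 _.
  have fr10 : frame [:: 16; 17; 18; 19; 28] rg6 rg10 by do 4 apply: frame_upd => //.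
  have r17_10 : rg10 17 = (c' \notin N) && (a < k - D) by [].
  have r18_10 : rg10 18 = c' by rewrite /rg10 /=.
  u_if; rewrite r17_10; case: (_ && _) => /=.
    u_move; first by rewrite r18_10; apply: (word_small enough_words); clear -ltc'; lia.
    apply: (UB_spent lam_ge0) (tail _ c' c2 _ _ _ _ le_cost).
    - by clear; lia.
    - by apply: frame_upd.
    - by rewrite /= r18_10.
    - by rewrite /rg10 /= r16.
  u_skip; apply: (UB_spent lam_ge0) (tail _ c c2 _ fr10 _ _ le_cost) => //.
  by clear; lia.
have cost_ok' : (D * 40 + 13 + (60 * lk + 170) + 2 * (20 * lk + 50) + 60) + 20 + (D * 25 + 40) <= update_cost.
  by apply: leq_trans cost_ok; clear; lia.
rewrite -[X in recolor L v (c, X)]/c2.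
case: (boolP (c' \notin C)) => c'C /=.
  u_move; first by rewrite r18_8; apply: (word_small enough_words); clear -ltc'; lia.
  apply: (UB_spent lam_ge0) (after _ _ _ _ _ _ cost_ok').
  - by clear; lia.
  - by apply: frame_upd.
  - by [].
  - by rewrite /= r18_8 /c2 c'C.
  - by [].
u_skip; apply: (UB_spent lam_ge0) (after _ _ fr8 _ _ _ cost_ok') => //.
  by clear; lia.
by rewrite /c2 (negPf c'C).
Qed.

End Updates.

Definition process_cmd : cmd :=
  block [:: move 12 (Cst 0);
    gather_lists;
    fill_list;
    for_nbrs 13 14 15 16 (Reg 9) (block
      [:: Op Lt 17 (Reg 15) (Reg 10);
          If (Reg 17) Skip compress_cmd]);
    contract_cmd;
    clear_marks].

(** * A complete update of one vertex *)

Section Process.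
Variables (R : realType) (w : nat) (lam : R) (F : state -> R).
Hypothesis lam_ge0 : (0 <= lam)%R.
Hypothesis F_ge0 : forall s, (0 <= F s)%R.
Variables (n k : nat) (e : rel 'I_n).

Local Notation B := (pointer e n).
Local Notation M := (n + k + 1).
Local Notation D := (max_degree e).
Hypothesis enough_words : B + 8 * M + 8 < 2 ^ w.
Hypothesis lt_D : 3 * D < k.

Local Notation UB := (UB w lam F B M).
Local Notation spec := (spec w lam F B M).
Local Notation coloring := {ffun 'I_n -> 'I_k}.
Local Notation bounds := {ffun 'I_n -> 'I_k * 'I_k}.
Local Notation mem_ok := (mem_ok e).
Local Notation base := (base k e).
Local Notation lk := (up_log 2 k).

Ltac u_seq := apply: (UB_seq lam_ge0 F_ge0 enough_words).
Ltac u_op := apply: (UB_op lam_ge0 F_ge0 enough_words) => //=.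
Ltac u_if := apply: (UB_if lam_ge0 F_ge0 enough_words) => //=.
Ltac u_skip := apply: (UB_skip lam_ge0 F_ge0 enough_words).
Ltac u_load := apply: (UB_load lam_ge0 F_ge0 enough_words) => //=.
Ltac u_store := apply: (UB_store lam_ge0 F_ge0 enough_words) => //=.
Ltac u_move := apply: (UB_move lam_ge0 F_ge0 enough_words) => //=.

Definition process_regs : seq nat := iota 12 22.

(** When all bounds are trusted no neighbour is compressed, which saves a factor D. Without this
    saving, the roughly D log n later sweeps would bring in a further factor D. *)
Definition process_cost (lim : nat) : nat :=
  1000 * ((if lim == n then 1 else D.+1) * (D.+1 * lk.+1)).

Lemma spec_compress_late rg A x y L (S0 C : seq 'I_k) (v : 'I_n) lim :
  base rg -> rg 9 = v -> rg 10 = lim -> rg 12 = size S0 -> uniq S0 -> {subset C <= S0} ->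
  size S0 + count (late lim) (nbrs e v) <= 2 * D ->
  count (late lim) (nbrs e v) = 0 \/ D <= size S0 ->
  mem_ok x y L S0 (mark S0 C) (fun=> 0) A ->
  spec (for_nbrs 13 14 15 16 (Reg 9) (block
      [:: Op Lt 17 (Reg 15) (Reg 10);
          If (Reg 17) Skip compress_cmd])) rg A
    (D * ((if lim == n then 4 else update_cost k e + 4) + 7) + 11)
    (foldM (compress_late e lim) (nbrs e v) (x, S0)) (fun q rg' A' =>
    [/\ frame process_regs rg rg', rg' 12 = size q.2, uniq q.2 /\ {subset C <= q.2},
        size q.2 <= 2 * D & mem_ok q.1 y L q.2 (mark q.2 C) (fun=> 0) A']).
Proof.
move=> bs r9 r10 r12 uS sub leS geS ok.
pose Inv (l : seq 'I_n) (q : coloring * seq 'I_k) rg' A' :=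
  [/\ frame process_regs rg rg', rg' 12 = size q.2, uniq q.2 /\ {subset C <= q.2},
      size q.2 = size S0 + count (late lim) l & mem_ok q.1 y L q.2 (mark q.2 C) (fun=> 0) A'].
have low_inv l y0 rg' A' : Inv l y0 rg' A' -> low k e A' by case=> _ _ _ _ [].
have base_inv l y0 rg' A' : Inv l y0 rg' A' -> base rg'.
  by case=> fr _ _ _ _; apply: base_frame fr bs.
set cb := (if lim == n then 4 else _).
have bound : size (nbrs e v) * (cb + 7) + 11 <= D * (cb + 7) + 11.
  by rewrite leq_add2r leq_mul2r size_nbrs orbT.
apply: (spec_sub lam_ge0 enough_words bound _ (spec_nbrs (Inv := Inv) lam_ge0 F_ge0 enough_words _ _ _ low_inv _ _ _ _)) => //.
- by move=> q rg' A' [? ? ? sE ?]; split=> //; rewrite sE.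
- move=> l y0 rg1 rg2 A1 [fr ? ? ? ?] fr'; split=> //.
    exact: frame_step fr fr' isT.
  by rewrite fr'.
- move=> l0 u l1 [x1 S1] rg1 A1 nE inv r15 t K uu cc g H.
  have bs1 := base_inv _ _ _ _ inv.
  case: inv => fr /= r12' [uS1 sub1] sizeS ok1.
  have r10' : rg1 10 = lim by rewrite fr.
  rewrite /block; u_seq; u_op; first exact: bool_lt enough_words _.
  rewrite r15 r10'; set rg2 := upd _ 17 _.
  have fr2 : frame (12 :: iota 17 17) rg1 rg2 by apply: frame_upd.
  have r17 : rg2 17 = (u < lim) by [].
  have countE : count (late lim) (rcons l0 u) = count (late lim) l0 + ~~ (u < lim).
    by rewrite -cats1 count_cat /= addn0.
  u_if; rewrite r17; rewrite /compress_late in H *; case: ltnP countE H => /= ltu countE H.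
    u_skip; apply: (UB_spent lam_ge0) (H (x1, S1) _ A1 _).
      by rewrite /cb; case: (_ == _); clear; lia.
    split=> //=; split=> //=; first exact: frame_step fr fr2 isT.
    by rewrite countE addn0.
  have cbE : cb = update_cost k e + 4.
    by rewrite /cb ltn_eqF // (leq_ltn_trans ltu).
  have count_nbrs : count (late lim) l0 < count (late lim) (nbrs e v).
    by rewrite nE count_cat /= /late -leqNgt ltu -addSnnS leq_addr.
  have bs2 := base_frame (T := 12 :: iota 17 17) isT fr2 bs1.
  have geS1 : D <= size S1.
    rewrite sizeS; case: geS count_nbrs => [->|h _]; first by rewrite ltn0.
    exact: leq_trans h (leq_addr _ _).
  have ltS1 : size S1 < 2 * D.
    by rewrite sizeS; apply: leq_trans leS; rewrite ltn_add2l.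
  apply: (UB_call lam_ge0 (spec_compress lam_ge0 F_ge0 enough_words lt_D bs2 _ _ uS1 sub1 geS1 ltS1 ok1) (lexx _)) => //.
  move=> q rg3 A3 [fr3 r12_3 [c cS qE] ok3].
  apply: (UB_spent lam_ge0) (H _ _ _ _); first by rewrite cbE; clear; lia.
  have fr13 : frame (12 :: iota 17 17) rg1 rg3 by exact: frame_step fr2 fr3 isT.
  split; [|by rewrite fr13|by rewrite fr13].
  split=> //.
  - exact: frame_step fr fr13 isT.
  - rewrite qE rcons_uniq cS; split=> // c' /sub1 c'S.
    by rewrite mem_rcons inE c'S orbT.
  by rewrite qE size_rcons sizeS countE addn1 addnS.
by split=> //=; rewrite addn0.
Qed.

Lemma spec_process rg A (x y : coloring) (L : bounds) (it : item n) :
  valid e it -> base rg -> rg 9 = it.2 -> rg 10 = it.1.1 -> rg 11 = it.1.2 ->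
  mem_ok x y L [::] (fun=> 0) (fun=> 0) A ->
  spec process_cmd rg A (process_cost it.1.1) (process e it (x, L)) (fun p rg' A' =>
    frame process_regs rg rg' /\ mem_ok p.1 y p.2 [::] (fun=> 0) (fun=> 0) A').
Proof.
move=> vit bs r9 r10 r11 ok t K u cc g H.
have [s1 s2 s3 s4] := startP lt_D L vit.
have cert : {subset certain e L it.1.1 it.2 <= start e it L}.
  by move=> c /mem_certain[q /andP[qn ql] Lq]; have [] := s4 q qn ql; rewrite Lq.
case: it vit r9 r10 r11 H s1 s2 s3 s4 cert => [[lim ft] v] /= vit r9 r10 r11 H s1 s2 s3 s4 cert.
have ltn_v := ltn_ord v.
have le_lim : lim <= n by case: vit => /= -[-> _] //; exact: ltnW.
have le_D : D <= k by clear -lt_D; lia.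
rewrite /process expect_bind /process_cmd {1}/block /=.
pose g1 q := expect (contract e v (certain e L lim v) q.2 (q.1, L)) g.
rewrite -/g1.
u_seq; u_move; first exact: operand_ok_lt8 enough_words _ _.
set rg1 := upd rg 12 0.
have fr1 : frame process_regs rg rg1 by apply: frame_upd.
have bs1 := base_frame (T := process_regs) isT fr1 bs.
u_seq; apply: (UB_callR lam_ge0 (spec_gather lam_ge0 F_ge0 enough_words (v := v) (lim := lim) bs1 _ _ _ _ ok)) => //.
move=> rg2 A2 [fr2 r12 ok2].
have fr02 : frame process_regs rg rg2 by exact: frame_step fr1 fr2 isT.
have bs2 := base_frame (T := process_regs) isT fr02 bs.
have r11_2 : rg2 11 = ft by rewrite fr02.
have [gu _ _] := gatherP lt_D L lim v.
have gcert : {subset certain e L lim v <= gather e L lim v}.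
  by move=> c /mem_certain[q /andP[qn ql] Lq]; have [_ _ h] := gatherP lt_D L lim v; have [] := h q qn ql; rewrite Lq.
u_seq; apply: (UB_callR lam_ge0 (spec_fill lam_ge0 F_ge0 enough_words bs2 le_D r11_2 r12 gu gcert ok2)).
move=> rg3 A3 [fr3 r12_3 ok3].
have fr03 : frame process_regs rg rg3 by exact: frame_step fr02 fr3 isT.
have bs3 := base_frame (T := process_regs) isT fr03 bs.
u_seq; apply: (UB_call (g := g1) lam_ge0 (spec_compress_late bs3 _ _ r12_3 s1 cert s2 s3 ok3)) => //; try by rewrite fr03.
move=> [x4 S4] rg4 A4 /= [fr4 r12_4 [uS4 sub4] leS4 ok4].
have fr04 : frame process_regs rg rg4 by exact: frame_step fr03 fr4 isT.
have bs4 := base_frame (T := process_regs) isT fr04 bs.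
u_seq; apply: (UB_call lam_ge0 (spec_contract lam_ge0 F_ge0 enough_words lt_D (v := v) bs4 _ r12_4 uS4 sub4 leS4 ok4) (lexx _)); first by rewrite fr04.
move=> p rg5 A5 [fr5 ok5].
have fr05 : frame process_regs rg rg5 by exact: frame_step fr04 fr5 isT.
have bs5 := base_frame (T := process_regs) isT fr05 bs.
have r12_5 : rg5 12 = size S4 by rewrite fr5.
apply: (UB_callR lam_ge0 (spec_clear_marks lam_ge0 F_ge0 enough_words bs5 r12_5 uS4 sub4 ok5)).
move=> rg6 A6 [fr6 ok6].
apply: (UB_spent lam_ge0) (H _ _ _ _); last by split=> //; exact: frame_step fr05 fr6 isT.
rewrite /process_cost /update_cost; case: (_ == _); move: leS4; clear; nia.
Qed.

End Process.

Definition sweep_cmd (lim ft : operand) : cmd :=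
  for_range 9 34 (Reg 2) (block [:: move 10 lim; move 11 ft; process_cmd]).

(** The colouring at the start of a block is saved as candidate output. The bounds are reset to the
    placeholder 0, harmless because the first sweep starts by trusting no vertex. *)
Definition restart_cmd : cmd :=
  for_range 9 34 (Reg 2) (block
    [:: load 17 0 (Reg 9);
        store 1 (Reg 9) (Reg 17);
        store 2 (Reg 9) (Cst 0);
        store 3 (Reg 9) (Cst 0)]).

Definition check_cmd : cmd :=
  Seq (move 36 (Cst 1)) (for_range 9 34 (Reg 2) (block
    [:: load 17 2 (Reg 9);
        load 18 3 (Reg 9);
        Op Eq 17 (Reg 17) (Reg 18);
        If (Reg 17) Skip (move 36 (Cst 0))])).

Definition run_block : cmd :=
  block [:: restart_cmd;
    sweep_cmd (Reg 9) (Reg 4);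
    for_range 8 35 (Reg 5) (sweep_cmd (Reg 2) (Cst 0));
    check_cmd].

Lemma foldM_map (I J Y : Type) (h : I -> J) (f : J -> Y -> dist Y) (l : seq I) (y : Y) :
  foldM f [seq h i | i <- l] y = foldM (fun i => f (h i)) l y.
Proof. by elim: l y => //= i l IH y; congr (bind _ _); apply: functional_extensionality_dep. Qed.

Lemma foldl_recolor n (Y : Type) (h : 'I_n -> Y) (l : seq 'I_n) (y : {ffun 'I_n -> Y}) u :
  foldl (fun y v => recolor y v (h v)) y l u = if u \in l then h u else y u.
Proof.
elim/last_ind: l => [//|l v IH]; rewrite -cats1 foldl_cat /= recolorE IH mem_cat mem_seq1 orbC.
by case: eqP => [->|].
Qed.

(** * Sweeps and blocks *)

Section Blocks.
Variables (R : realType) (w : nat) (lam : R) (F : state -> R).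
Hypothesis lam_ge0 : (0 <= lam)%R.
Hypothesis F_ge0 : forall s, (0 <= F s)%R.
Variables (n k : nat) (e : rel 'I_n).

Local Notation B := (pointer e n).
Local Notation M := (n + k + 1).
Local Notation D := (max_degree e).
Hypothesis enough_words : B + 8 * M + 8 < 2 ^ w.
Hypothesis lt_D : 3 * D < k.

Local Notation UB := (UB w lam F B M).
Local Notation spec := (spec w lam F B M).
Local Notation coloring := {ffun 'I_n -> 'I_k}.
Local Notation bounds := {ffun 'I_n -> 'I_k * 'I_k}.
Local Notation mem_ok := (mem_ok e).
Local Notation base := (base k e).
Local Notation lk := (up_log 2 k).

Ltac u_seq := apply: (UB_seq lam_ge0 F_ge0 enough_words).
Ltac u_op := apply: (UB_op lam_ge0 F_ge0 enough_words) => //=.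
Ltac u_if := apply: (UB_if lam_ge0 F_ge0 enough_words) => //=.
Ltac u_skip := apply: (UB_skip lam_ge0 F_ge0 enough_words).
Ltac u_load := apply: (UB_load lam_ge0 F_ge0 enough_words) => //=.
Ltac u_store := apply: (UB_store lam_ge0 F_ge0 enough_words) => //=.
Ltac u_move := apply: (UB_move lam_ge0 F_ge0 enough_words) => //=.


Definition sweep_regs : seq nat := iota 9 26.

Lemma spec_sweep rg A (x y : coloring) (L : bounds) lim ft (h : 'I_n -> item n) cp :
  (forall v, valid e (h v) /\ (h v).2 = v) ->
  operand_ok lim -> operand_ok ft ->
  (forall rg' (v : 'I_n), base rg' -> rg' 9 = v ->
     operand_value rg' lim = (h v).1.1 /\ operand_value (upd rg' 10 (h v).1.1) ft = (h v).1.2) ->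
  (forall v, process_cost k e (h v).1.1 <= cp) ->
  base rg -> mem_ok x y L [::] (fun=> 0) (fun=> 0) A ->
  spec (sweep_cmd lim ft) rg A (n * (cp + 10) + 6)
    (foldM (process e) [seq h v | v <- enum 'I_n] (x, L)) (fun p rg' A' =>
    frame sweep_regs rg rg' /\ mem_ok p.1 y p.2 [::] (fun=> 0) (fun=> 0) A').
Proof.
move=> hP oklim okft valE le_cp bs ok; rewrite foldM_map.
pose Inv (l : seq 'I_n) (p : coloring * bounds) rg' A' :=
  frame sweep_regs rg rg' /\ mem_ok p.1 y p.2 [::] (fun=> 0) (fun=> 0) A'.
have base_inv l p rg' A' : Inv l p rg' A' -> base rg'.
  by case=> fr _; apply: base_frame fr bs.
have bound : size (enum 'I_n) * (cp + 5 + 5) + 6 <= n * (cp + 10) + 6.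
  by rewrite size_enum_ord -addnA.
have small_n : size (enum 'I_n) < 2 ^ w.
  by rewrite size_enum_ord; apply: (word_small enough_words); clear; lia.
apply: (spec_sub lam_ge0 enough_words bound _ (spec_for (Inv := Inv) lam_ge0 F_ge0 enough_words _ _ _ _ small_n _ _ _ _)) => //.
- by move=> l p rg' A' /base_inv [_ rn _ _]; rewrite size_enum_ord.
- move=> l p rg1 rg2 A1 [fr h3] fr'; split=> //.
  exact: frame_step fr fr' isT.
move=> l0 v l1 [x1 L1] rg1 A1 lE inv r9 t K u cc g H.
have bs1 := base_inv _ _ _ _ inv; case: inv => fr /= ok1.
rewrite (enum_ord_cat lE) in r9 H.
have [vlim vft] := valE rg1 v bs1 r9; have [vit itE] := hP v.
have ltn_v := ltn_ord v.
have [small_lim small_ft] : (h v).1.1 < 2 ^ w /\ (h v).1.2 < 2 ^ w.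
  by case: vit => ->; rewrite ?itE; split; apply: (word_small enough_words) => /=; clear -ltn_v lt_D; lia.
rewrite /block; u_seq; u_move; first by rewrite vlim.
rewrite vlim; u_seq; u_move; first by rewrite vft.
rewrite vft; set rg2 := upd _ 11 _.
have fr2 : frame sweep_regs rg1 rg2 by do 2 apply: frame_upd => //.
have bs2 := base_frame (T := sweep_regs) isT fr2 bs1.
have r9_2 : rg2 9 = (h v).2 by rewrite itE.
apply: (UB_call lam_ge0 (spec_process lam_ge0 F_ge0 enough_words lt_D vit bs2 r9_2 _ _ ok1) (lexx _)) => //.
move=> p rg3 A3 [fr3 ok3].
apply: (UB_spent lam_ge0) (H _ _ _ _); first by have := le_cp v; clear; lia.
split; last by rewrite fr3 // r9_2 itE.
split=> //; apply: frame_step (isT : all (mem sweep_regs) process_regs); last exact: fr3.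
exact: frame_step fr fr2 isT.
Qed.

Lemma spec_restart rg A (x y : coloring) (L : bounds) (c0 : 'I_k) :
  c0 = 0 :> nat -> base rg -> mem_ok x y L [::] (fun=> 0) (fun=> 0) A ->
  spec restart_cmd rg A (n * 40 + 6) (Ret tt) (fun _ rg' A' =>
    frame [:: 9; 17; 34] rg rg' /\
    mem_ok x x (start_bounds n c0) [::] (fun=> 0) (fun=> 0) A').
Proof.
move=> c00 bs ok.
pose ys l := foldl (fun y v => recolor y v (x v)) y l.
pose Ls l := foldl (fun L v => recolor L v (c0, c0)) L l.
pose Inv (l : seq 'I_n) (_ : unit) rg' A' :=
  frame [:: 9; 17; 34] rg rg' /\ mem_ok x (ys l) (Ls l) [::] (fun=> 0) (fun=> 0) A'.
have base_inv l p rg' A' : Inv l p rg' A' -> base rg'.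
  by case=> fr _; apply: base_frame fr bs.
rewrite -(foldM_unit (enum 'I_n)).
have bound : size (enum 'I_n) * (35 + 5) + 6 <= n * 40 + 6 by rewrite size_enum_ord.
have small_n : size (enum 'I_n) < 2 ^ w.
  by rewrite size_enum_ord; apply: (word_small enough_words); clear; lia.
apply: (spec_sub lam_ge0 enough_words bound _ (spec_for (Inv := Inv) lam_ge0 F_ge0 enough_words _ _ _ _ small_n _ _ _ _)) => //.
- move=> [] rg' A' [fr ok']; split=> //.
  have ysE : ys (enum 'I_n) = x by apply/ffunP => v; rewrite foldl_recolor mem_enum.
  have LsE : Ls (enum 'I_n) = start_bounds n c0.
    by apply/ffunP => v; rewrite foldl_recolor mem_enum ffunE.
  by rewrite ysE LsE in ok'.
- by move=> l p rg' A' /base_inv [_ rn _ _]; rewrite size_enum_ord.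
- move=> l p rg1 rg2 A1 [fr h3] fr'; split=> //.
  exact: frame_step fr fr' isT.
move=> l0 v l1 [] rg1 A1 lE inv r9 t K u cc g H.
have [rB _ _ _] := base_inv _ _ _ _ inv; case: inv => fr ok1.
rewrite (enum_ord_cat lE) in r9 H; have ltn_v := ltn_ord v.
have [_ /(_ v)[hx _ _ _] _ _ _] := ok1.
rewrite /block; u_seq; u_load; first by rewrite r9; clear -ltn_v; lia.
rewrite r9 hx.
u_seq; u_store; first by rewrite r9; clear -ltn_v; lia.
u_seq; u_store; first by rewrite r9; clear -ltn_v; lia.
u_store; first by rewrite r9; clear -ltn_v; lia.
rewrite r9; apply: (UB_spent lam_ge0) (H tt _ _ _); first by clear; lia.
split=> //; split; first by apply: frame_upd.
rewrite /ys /Ls -cats1 !foldl_cat /= -/(ys l0) -/(Ls l0).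
have := mem_ok_L v c0 c0 (mem_ok_y v (x v) ok1).
by rewrite c00.
Qed.

Lemma spec_check rg A (x y : coloring) (L : bounds) :
  base rg -> mem_ok x y L [::] (fun=> 0) (fun=> 0) A ->
  spec check_cmd rg A (n * 35 + 8) (Ret tt) (fun _ rg' A' =>
    [/\ frame [:: 9; 17; 18; 34; 36] rg rg', rg' 36 = coalesced L & A' = A]).
Proof.
move=> bs ok t K u cc g H.
rewrite /check_cmd; u_seq; u_move; first exact: operand_ok_lt8 enough_words _ _.
pose Inv (l : seq 'I_n) (_ : unit) rg' A' :=
  [/\ frame [:: 9; 17; 18; 34; 36] rg rg', rg' 36 = all (fun v => (L v).1 == (L v).2) l & A' = A].
have base_inv l p rg' A' : Inv l p rg' A' -> base rg'.
  by case=> fr _ _; apply: base_frame fr bs.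
have small_n : size (enum 'I_n) < 2 ^ w.
  by rewrite size_enum_ord; apply: (word_small enough_words); clear; lia.
have step : spec (for_range 9 34 (Reg 2) (block
    [:: load 17 2 (Reg 9);
        load 18 3 (Reg 9);
        Op Eq 17 (Reg 17) (Reg 18);
        If (Reg 17) Skip (move 36 (Cst 0))])) (upd rg 36 1) A (size (enum 'I_n) * (30 + 5) + 6)
    (foldM (fun _ _ => Ret tt) (enum 'I_n) tt) (Inv (enum 'I_n)).
  apply: (spec_for (Inv := Inv) lam_ge0 F_ge0 enough_words _ _ _ _ small_n) => //.
  - by move=> l p rg' A' /base_inv [_ rn _ _]; rewrite size_enum_ord.
  - move=> l p rg1 rg2 A1 [fr h3 h4] fr'; split=> //; last by rewrite fr'.
    exact: frame_step fr fr' isT.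
  - move=> l0 v l1 [] rg1 A1 lE inv r9 t' K' u' c' g' H'.
    have [rB _ _ _] := base_inv _ _ _ _ inv; case: inv => fr r36 AE.
    rewrite (enum_ord_cat lE) in r9 H'; have ltn_v := ltn_ord v.
    have [_ /(_ v)[_ _ h1 h2] _ _ _] := ok.
    rewrite AE /block; u_seq; u_load; first by rewrite r9; clear -ltn_v; lia.
    u_seq; u_load; first by rewrite r9; clear -ltn_v; lia.
    u_seq; u_op; first exact: bool_lt enough_words _.
    rewrite r9 h1 h2 (inj_eq val_inj).
    have allE : all (fun v => (L v).1 == (L v).2) (rcons l0 v) =
        ((L v).1 == (L v).2) && all (fun v => (L v).1 == (L v).2) l0 by rewrite all_rcons.
    u_if; case: (_ == _) allE => /= allE.
      u_skip; apply: (UB_spent lam_ge0) (H' tt _ _ _); first by clear; lia.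
      by split=> //; split; rewrite ?allE //; do 3 apply: frame_upd => //.
    u_move; first exact: operand_ok_lt8 enough_words _ _.
    apply: (UB_spent lam_ge0) (H' tt _ _ _); first by clear; lia.
    by split=> //; split; rewrite ?allE //; do 4 apply: frame_upd => //.
  by split=> //; apply: frame_upd.
rewrite foldM_unit in step; apply: (UB_callR lam_ge0 step) => rg' A' [fr r36 AE].
apply: (UB_spent lam_ge0) (H tt _ _ _); first by rewrite size_enum_ord; clear; lia.
split=> //; rewrite r36; congr nat_of_bool.
by apply/allP/forallP => h v; [apply: h; rewrite mem_enum|move=> _].
Qed.

(** The summand D + 1 is for the first sweep, where neighbours are compressed, and T for the later
    sweeps. *)
Definition block_cost (T : nat) : nat :=
  2000 * (n.+1 * ((D.+1 + T) * (D.+1 * lk.+1))).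

Lemma spec_run_block rg A (x y : coloring) (L : bounds) (c0 : 'I_k) T :
  c0 = 0 :> nat -> T < 2 ^ w -> base rg -> rg 5 = T ->
  mem_ok x y L [::] (fun=> 0) (fun=> 0) A ->
  spec run_block rg A (block_cost T)
    (foldM (process e) (schedule e T) (x, start_bounds n c0)) (fun p rg' A' =>
    [/\ frame (iota 8 29) rg rg', rg' 36 = coalesced p.2
      & mem_ok p.1 x p.2 [::] (fun=> 0) (fun=> 0) A']).
Proof.
move=> c00 T_small bs r5 ok t K u cc g H.
rewrite /run_block {1}/block; u_seq.
apply: (UB_callR lam_ge0 (spec_restart c00 bs ok)) => rg1 A1 [fr1 ok1].
have fr01 : frame (iota 8 29) rg rg1 by exact: frame_step (@frame_refl (iota 8 29) rg) fr1 isT.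
have bs1 := base_frame (T := iota 8 29) isT fr01 bs.
pose g1 p := expect (foldM (process e) (flatten (nseq T (later_sweep n))) p) g.
have -> : expect (foldM (process e) (schedule e T) (x, start_bounds n c0)) g =
    expect (foldM (process e) (first_sweep e) (x, start_bounds n c0)) g1.
  by rewrite /schedule foldM_cat.
u_seq; apply: (UB_call lam_ge0 (spec_sweep (h := fun v => ((nat_of_ord v, D), v))
  (cp := process_cost k e 0) _ _ _ _ _ bs1 ok1) (lexx _)) => //.
- by move=> v; split=> //; right.
- by move=> rg' v [_ _ _ rD] r9 /=; split.
(* All limits of the first sweep are below n and cost the same; limit 0 stands for them, as n > 0
   once a vertex exists. *)
- by move=> v /=; rewrite /process_cost (ltn_eqF (ltn_ord v)) (ltn_eqF (leq_ltn_trans (leq0n v) (ltn_ord v))).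
move=> [x2 L2] rg2 A2 /= [fr2 ok2].
have fr02 : frame (iota 8 29) rg rg2 by exact: frame_step fr01 fr2 isT.
have bs2 := base_frame (T := iota 8 29) isT fr02 bs.
have g1E p : g1 p = expect (foldM (fun _ => foldM (process e) (later_sweep n)) (iota 0 T) p) g.
  rewrite /g1; elim: T 0 p {H T_small r5 g1} => [//|T IH] i p /=.
  by rewrite foldM_cat expect_bind; apply: eq_expect => p'; exact: IH.
pose Inv (l : seq nat) (p : coloring * bounds) rg' A' :=
  frame (iota 8 29) rg rg' /\ mem_ok p.1 x p.2 [::] (fun=> 0) (fun=> 0) A'.
have base_inv l p rg' A' : Inv l p rg' A' -> base rg'.
  by case=> fr _; apply: base_frame fr bs.
rewrite g1E.
have small_T : size (iota 0 T) < 2 ^ w by rewrite size_iota.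
have step : spec (for_range 8 35 (Reg 5) (sweep_cmd (Reg 2) (Cst 0))) rg2 A2
    (size (iota 0 T) * ((n * (process_cost k e n + 10) + 6) + 5) + 6)
    (foldM (fun _ => foldM (process e) (later_sweep n)) (iota 0 T) (x2, L2)) (Inv (iota 0 T)).
  apply: (spec_for (Inv := Inv) lam_ge0 F_ge0 enough_words _ _ _ _ small_T) => //.
  - by move=> l p rg' A' [fr _] /=; rewrite fr // size_iota.
  - move=> l p rg3 rg4 A3 [fr h3] fr'; split=> //.
    exact: frame_step fr fr' isT.
  move=> l0 i l1 [x3 L3] rg3 A3 lE inv r8.
  have bs3 := base_inv _ _ _ _ inv; case: inv => fr3 ok3.
  apply: (spec_sub lam_ge0 enough_words (leqnn _) _ (spec_sweep (h := fun v => ((n, 0), v)) _ _ _ _ _ bs3 ok3)) => //.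
  - move=> p rg4 A4 [fr4 ok4]; split; last by rewrite fr4.
    by split=> //; exact: frame_step fr3 fr4 isT.
  - by move=> v; split=> //; left.
  - by move=> rg' v [_ rn _ _] r9 /=; split.
u_seq; apply: (UB_call lam_ge0 step (lexx _)) => -[x3 L3] rg3 A3 [fr3 ok3].
have bs3 := base_frame (T := iota 8 29) isT fr3 bs.
apply: (UB_callR lam_ge0 (spec_check bs3 ok3)) => rg4 A4 [fr4 r36 ->].
apply: (UB_spent lam_ge0) (H _ _ _ _); last first.
  by split=> //; exact: frame_step fr3 fr4 isT.
rewrite size_iota /block_cost /process_cost eqxx mul1n; clear.
set m := D.+1 * lk.+1; have : 0 < m by rewrite muln_gt0.
have : (if 0 == n then 1 else D.+1) <= D.+1 by case: (_ == _).
move: (if 0 == n then 1 else D.+1) => d.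
move: m D => m D' le_d m0; move: T (n) => T' n'.
have h1 : n' * (1000 * (d * m) + 10) <= n' * (1000 * (D'.+1 * m) + 10).
  by rewrite leq_mul2l leq_add2r leq_mul2l leq_mul2r le_d !orbT.
have h2 : n' <= n' * (D'.+1 * m) by rewrite leq_pmulr // muln_gt0 m0.
have h3 : T' * n' <= T' * n' * m by rewrite leq_pmulr.
have h4 : T' <= T' * m by rewrite leq_pmulr.
have h5 : 1 <= D'.+1 * m by rewrite muln_gt0 m0.
move: h1 h2 h3 h4 h5; clear; nia.
Qed.

End Blocks.

Definition degree_cmd : cmd :=
  Seq (move 4 (Cst 0)) (for_range 9 34 (Reg 2) (block
    [:: Op Add 17 (Reg 9) (Cst 2);
        Read 18 (Reg 17);
        Op Add 17 (Reg 9) (Cst 3);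
        Read 19 (Reg 17);
        Op Defs.Sub 18 (Reg 19) (Reg 18);
        Op Lt 17 (Reg 4) (Reg 18);
        If (Reg 17) (move 4 (Reg 18)) Skip])).

(** The product (2D + 1)(log n + 1) is obtained by adding 2D + 1 at each doubling of register 29
    until it reaches n. *)
Definition num_sweeps_cmd : cmd :=
  block [:: Op Mul 28 (Reg 4) (Cst 2);
    Op Add 28 (Reg 28) (Cst 1);
    move 5 (Reg 28);
    move 29 (Cst 1);
    Op Lt 17 (Reg 29) (Reg 2);
    While (Reg 17) (block
      [:: Op Add 29 (Reg 29) (Reg 29);
          Op Add 5 (Reg 5) (Reg 28);
          Op Lt 17 (Reg 29) (Reg 2)])].

(** Register 6 remembers the first coalescence; the second one clears register 7 and stops the loop.
    At that moment array 1 still holds the colouring saved before the block, which is the output. *)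
Definition loop_body : cmd :=
  Seq run_block
    (If (Reg 36) (If (Reg 6) (move 7 (Cst 0)) (move 6 (Cst 1))) Skip).

Definition output_cmd : cmd :=
  for_range 9 34 (Reg 2) (Seq (load 17 1 (Reg 9)) (Write (Reg 9) (Reg 17))).

Definition main : cmd :=
  block [:: Read 2 (Cst 0);
    Read 3 (Cst 1);
    Op Add 1 (Reg 2) (Cst 2);
    Read 1 (Reg 1);
    degree_cmd;
    num_sweeps_cmd;
    move 6 (Cst 0);
    move 7 (Cst 1);
    While (Reg 7) loop_body;
    output_cmd].

(** * The main loop and its value *)

Section Main.
Variables (R : realType) (w : nat) (lam : R) (F : state -> R).
Hypothesis lam_ge0 : (0 <= lam)%R.
Hypothesis F_ge0 : forall s, (0 <= F s)%R.
Variables (n k : nat) (e : rel 'I_n).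

Local Notation B := (pointer e n).
Local Notation M := (n + k + 1).
Local Notation D := (max_degree e).
Hypothesis enough_words : B + 8 * M + 8 < 2 ^ w.
Hypotheses (sym_e : symmetric e) (irr_e : irreflexive e) (lt_D : 3 * D < k).

Local Notation UB := (UB w lam F B M).
Local Notation spec := (spec w lam F B M).
Local Notation coloring := {ffun 'I_n -> 'I_k}.
Local Notation bounds := {ffun 'I_n -> 'I_k * 'I_k}.
Local Notation mem_ok := (mem_ok e).
Local Notation base := (base k e).
Local Notation lk := (up_log 2 k).

Ltac u_seq := apply: (UB_seq lam_ge0 F_ge0 enough_words).
Ltac u_op := apply: (UB_op lam_ge0 F_ge0 enough_words) => //=.
Ltac u_if := apply: (UB_if lam_ge0 F_ge0 enough_words) => //=.
Ltac u_skip := apply: (UB_skip lam_ge0 F_ge0 enough_words).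
Ltac u_load := apply: (UB_load lam_ge0 F_ge0 enough_words) => //=.
Ltac u_store := apply: (UB_store lam_ge0 F_ge0 enough_words) => //=.
Ltac u_move := apply: (UB_move lam_ge0 F_ge0 enough_words) => //=.


Definition num_sweeps : nat := (2 * D).+1 * (up_log 2 n).+1.
Hypothesis num_sweeps_small : num_sweeps < 2 ^ w.

Lemma spec_degree rg A : rg 2 = n -> low k e A ->
  spec degree_cmd rg A (n * 30 + 8) (Ret tt) (fun _ rg' A' =>
    [/\ frame [:: 4; 9; 17; 18; 19; 34] rg rg', rg' 4 = D & A' = A]).
Proof.
move=> r2 lowA t K u cc g H.
rewrite /degree_cmd; u_seq; u_move; first exact: operand_ok_lt8 enough_words _ _.
pose Inv (l : seq 'I_n) (_ : unit) rg' A' :=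
  [/\ frame [:: 4; 9; 17; 18; 19; 34] rg rg', rg' 4 = \max_(v <- l) #|neighbours e v| & A' = A].
have small_n : size (enum 'I_n) < 2 ^ w.
  by rewrite size_enum_ord; apply: (word_small enough_words); clear; lia.
have [nB BM] : n + 3 <= B /\ B < 2 ^ w.
  by split; [exact: n_lt_B|apply: (word_small enough_words); rewrite -addnA leq_addr].
rewrite -[g tt]/(expect (Ret tt) g) -(foldM_unit (enum 'I_n)).
apply: (UB_call lam_ge0 (spec_for (Inv := Inv) (cb := 25) lam_ge0 F_ge0 enough_words _ _ _ _ small_n _ _ _ _) (lexx _)) => //; last first.
- move=> y rg' A' [fr r4 AE]; apply: (UB_spent lam_ge0) (H _ _ _ _); first by rewrite size_enum_ord; clear; lia.
  by case: y; split=> //; rewrite r4 big_enum.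
- by split; rewrite ?big_nil //; apply: frame_upd.
- move=> l0 v l1 [] rg1 A1 lE [fr r4 ->] r9 t' K' u' c' g' H'.
  rewrite (enum_ord_cat lE) in r9 H'; have ltn_v := ltn_ord v.
  have h2 := low_pointer lowA (ltnW ltn_v); have h3 := low_pointer lowA ltn_v.
  have hB : pointer e v.+1 <= B by exact: pointer_mono.
  rewrite addSnnS in h3.
  have le4 : rg1 4 <= n.
    by rewrite r4; elim/big_ind: _ => // [a b|i _]; [rewrite geq_max => -> ->|rewrite cardE degree_le].
  rewrite /block; u_seq; u_op; first by rewrite r9; apply: leq_ltn_trans BM; clear -ltn_v nB; lia.
  u_seq; apply: (UB_read lam_ge0 F_ge0 enough_words) => //=; first by rewrite r9; clear -ltn_v nB; lia.
  rewrite r9 h2; u_seq; u_op; first by rewrite r9; apply: leq_ltn_trans BM; clear -ltn_v nB; lia.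
  rewrite r9; u_seq; apply: (UB_read lam_ge0 F_ge0 enough_words) => //=; first by clear -ltn_v nB; lia.
  rewrite h3 pointerS; rewrite pointerS in hB.
  u_seq; u_op; first by apply: leq_ltn_trans BM; move: hB; clear; lia.
  rewrite addKn; u_seq; u_op; first exact: bool_lt enough_words _.
  set rg2 := upd _ 17 _.
  have fr2 : frame [:: 17; 18; 19] rg1 rg2 by do 6 apply: frame_upd => //.
  have r17 : rg2 17 = (rg1 4 < size (nbrs e v)) by [].
  have r18 : rg2 18 = size (nbrs e v) by [].
  have fr3 : frame [:: 4; 9; 17; 18; 19; 34] rg rg2 by exact: frame_step fr fr2 isT.
  have maxE : \max_(v <- rcons l0 v) #|neighbours e v| = maxn (rg1 4) (size (nbrs e v)).
    by rewrite -cats1 big_cat big_seq1 /= -r4 -cardE.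
  u_if; rewrite r17; case: ltnP => le_v /=.
    u_move; first by rewrite r18; apply: leq_ltn_trans BM; move: hB; clear; lia.
    apply: (UB_spent lam_ge0) (H' tt _ _ _); first by clear; lia.
    split; last by rewrite /= fr2.
    split=> //; first by apply: frame_upd.
    by rewrite maxE /= r18; apply/esym/maxn_idPr; exact: ltnW.
  u_skip; apply: (UB_spent lam_ge0) (H' tt _ _ _); first by clear; lia.
  split; last by rewrite /= fr2.
  split=> //; rewrite maxE fr2 //.
  by apply/esym/maxn_idPl.
- move=> l y rg1 rg2 A1 [fr h3 h4] fr'; split=> //; last by rewrite fr'.
  exact: frame_step fr fr' isT.
by move=> l y rg' A' [fr _ _] /=; rewrite fr // size_enum_ord.
Qed.

Lemma spec_num_sweeps rg A : base rg ->
  spec num_sweeps_cmd rg A (up_log 2 n * 10 + 12) (Ret tt) (fun _ rg' A' =>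
    [/\ frame [:: 5; 17; 28; 29] rg rg', rg' 5 = num_sweeps & A' = A]).
Proof.
move=> [rB rn rk rD] t K u cc g H.
set ln := up_log 2 n.
have small_d : (2 * D).+1 < 2 ^ w by apply: (word_small enough_words); move: lt_D; clear; lia.
pose Inv (l : seq nat) (_ : unit) rg' (A' : nat -> nat -> nat) :=
  [/\ size l <= ln, frame [:: 5; 17; 28; 29] rg rg',
      rg' 29 = 2 ^ (ln - size l) /\ rg' 5 = (2 * D).+1 * (ln - size l).+1,
      rg' 17 = (0 < size l) /\ rg' 28 = (2 * D).+1 & A' = A].
rewrite /num_sweeps_cmd /block; u_seq; u_op.
  by rewrite rD; apply: leq_ltn_trans small_d; clear; lia.
rewrite rD mulnC; u_seq; u_op; first by rewrite addn1.
rewrite (addn1 (2 * D)); u_seq; u_move; u_seq; u_move; first exact: operand_ok_lt8 enough_words _ _.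
u_seq; u_op; first exact: bool_lt enough_words _.
rewrite rn; set rg1 := upd _ 17 _.
have inv : Inv (iota 0 ln) tt rg1 A.
  split; rewrite ?size_iota ?subnn //.
  - by do 5 apply: frame_upd => //.
  - by rewrite /rg1 /= expn0 muln1.
  by split=> //; rewrite -(up_log_doubling n 0).
rewrite -[g tt]/(expect (Ret tt) g) -(foldM_unit (iota 0 ln)).
apply: (UB_call lam_ge0 (spec_while (Inv := Inv) (cb := 5) lam_ge0 F_ge0 enough_words _ _ _ inv) (lexx _)) => //; last first.
- move=> y rg' A' [_ fr [_ r5] _ AE]; apply: (UB_spent lam_ge0) (H _ _ _ _).
    by rewrite size_iota; clear; lia.
  by case: y; split=> //; rewrite r5 subn0.
- move=> i l [] rg2 A2 [/= le_l fr [r29 r5] [r17 r28] ->] t' K' u' c' g' H'.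
  have lt_ln : ln - (size l).+1 < ln by clear -le_l; lia.
  have S_ln : (ln - (size l).+1).+1 = ln - size l by clear -le_l; lia.
  have pow_n : 2 ^ (ln - (size l).+1) < n by rewrite up_log_doubling.
  rewrite /block; u_seq; u_op.
    by rewrite r29; apply: (word_small enough_words); clear -pow_n; lia.
  rewrite r29 addnn -mul2n -expnS S_ln.
  u_seq; u_op.
    rewrite r5 r28 S_ln -mulnSr; apply: leq_ltn_trans num_sweeps_small.
    by rewrite /num_sweeps leq_pmul2l // ltnS leq_subr.
  rewrite r5 r28 S_ln -mulnSr; u_op; first exact: bool_lt enough_words _.
  have r2 : rg2 2 = n by rewrite fr.
  rewrite r2 up_log_doubling.
  apply: (UB_spent lam_ge0) (H' tt _ _ _); first by clear; lia.
  split=> //; first exact: ltnW.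
    by do 3 apply: frame_upd => //.
  by split=> //=; congr nat_of_bool; clear -le_l; lia.
move=> l y rg' A' [_ _ _ [/= -> _] _].
by case: l.
Qed.

Variable phi : coloring -> R.
Hypothesis phi_ge0 : forall x, (0 <= phi x)%R.
Hypothesis F_le : forall (s : state) (x : coloring),
  (forall v : 'I_n, memory s v = x v) -> (F s <= phi x)%R.

(** Exchanges time budget for reward: d units missing in the new budget are charged to b', and d'
    units in excess are credited. It adjusts the budget after each block. *)
Lemma UB_rebase t K rg A u c c' (d d' : nat) (b b' : R) :
  c + d <= c' + d' -> (b + lam * d'%:R <= b' + lam * d%:R)%R ->
  UB t K rg A u c b -> UB t K rg A u c' b'.
Proof.
move=> le_c le_b H regs mem rep t' le_t'; have := H _ _ rep _ le_t'.
have : (lam * (c + d)%:R <= lam * (c' + d')%:R)%R by rewrite ler_wpM2l // ler_nat.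
by rewrite !natrD !mulrDr; move: le_b; lra.
Qed.

Lemma UB_output t rg (A : nat -> nat -> nat) (y : coloring) u :
  base rg -> (forall v : 'I_n, A 1 v = y v :> nat) ->
  UB t [:: output_cmd] rg A u (u + (n * 20 + 6)) (phi y).
Proof.
move=> bs yE.
pose Inv (l : seq 'I_n) (_ : unit) (rg' : nat -> nat) (A' : nat -> nat -> nat) :=
  [/\ frame [:: 9; 17; 34] rg rg', forall v : 'I_n, A' 1 v = y v :> nat
    & forall v, v \in l -> A' 7 v = y v :> nat].
have base_inv l p rg' A' : Inv l p rg' A' -> base rg'.
  by case=> fr _ _; apply: base_frame fr bs.
have small_n : size (enum 'I_n) < 2 ^ w.
  by rewrite size_enum_ord; apply: (word_small enough_words); clear; lia.
have nB : n <= B by apply: leq_trans (leq_addr 3 n) _; exact: n_lt_B.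
have step : spec output_cmd rg A (size (enum 'I_n) * (15 + 5) + 6)
    (foldM (fun _ _ => Ret tt) (enum 'I_n) tt) (Inv (enum 'I_n)).
  apply: (spec_for (Inv := Inv) lam_ge0 F_ge0 enough_words _ _ _ _ small_n) => //.
  - by move=> l p rg' A' /base_inv [_ rn _ _]; rewrite size_enum_ord.
  - move=> l p rg1 rg2 A1 [fr h3 h4] fr'; split=> //.
    exact: frame_step fr fr' isT.
  move=> l0 v l1 [] rg1 A1 lE inv r9 t' K' u' c' g' H'.
  have [rB _ _ _] := base_inv _ _ _ _ inv; case: inv => fr h1 h7.
  rewrite (enum_ord_cat lE) in r9 H'; have ltn_v := ltn_ord v.
  u_seq; u_load; first by rewrite r9; clear -ltn_v; lia.
  rewrite r9 h1; apply: (UB_write lam_ge0 F_ge0 enough_words) => //=.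
    by rewrite r9; apply: leq_trans nB.
  rewrite r9; apply: (UB_spent lam_ge0) (H' tt _ _ _); first by clear; lia.
  split=> //; split=> //; first by apply: frame_upd.
  move=> q; rewrite mem_rcons inE /= (inj_eq val_inj); case: eqP => [->|_] //=.
  exact: h7.
rewrite foldM_unit in step; apply: (UB_callR lam_ge0 step) => rg' A' [_ _ h7] regs mem [_ _ rep] t' _.
rewrite value_halted // size_enum_ord.
have : (F (State [::] regs mem) <= phi y)%R.
  by apply: F_le => v /=; rewrite rep ?h7 ?mem_enum // (leq_trans (ltn_ord v)).
lra.
Qed.

Variable c0 : 'I_k.
Hypothesis c00 : c0 = 0 :> nat.

Local Notation T := num_sweeps.
Local Notation L0 := (start_bounds n c0).
Local Notation payoff := (payoff e T L0 phi).
Local Notation bmean := (block_mean e T L0).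
Local Notation mean := (uniform_mean e phi).

Lemma coalescence_num_sweeps : (2^-1 <= coalescence e R T L0)%R.
Proof. by apply: coalescence_half => //; exact: up_logP. Qed.

Lemma uniform_mean_ge0 : (0 <= mean)%R.
Proof. by rewrite divr_ge0 // sumr_ge0. Qed.

(* Each block pays [c] when it coalesces and costs [c] when it does not. *)
Lemma block_drift x (h1 h2 : coloring -> R) (c : R) : (0 <= c)%R ->
  (bmean x (fun q => (coalesced q.2)%:R * (h1 q.1 - c) +
      (~~ coalesced q.2)%:R * (h2 q.1 + c)) <=
   bmean x (fun q => (coalesced q.2)%:R * h1 q.1) +
   bmean x (fun q => (~~ coalesced q.2)%:R * h2 q.1))%R.
Proof.
move=> c_ge0.
have -> : bmean x (fun q => (coalesced q.2)%:R * (h1 q.1 - c) +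
      (~~ coalesced q.2)%:R * (h2 q.1 + c))%R =
  (bmean x (fun q => (coalesced q.2)%:R * h1 q.1) +
   bmean x (fun q => (~~ coalesced q.2)%:R * h2 q.1) +
   (c * bmean x (fun q => (~~ coalesced q.2)%:R) -
    c * bmean x (fun q => (coalesced q.2)%:R)))%R.
  rewrite /block_mean -mulNr -!expectZ -!expectD; apply: eq_expect => q.
  by case: coalesced; rewrite /=; lra.
rewrite block_coalesced // block_not_coalesced //.
by have := coalescence_num_sweeps; move: (coalescence _ _ _ _) => p; nra.
Qed.

Local Notation cb := (block_cost k e T + 10).
Local Notation co := (n * 20 + 6).

Lemma UB_loop1 t rg A (x y : coloring) (L : bounds) u :
  base rg -> rg 5 = T -> rg 6 = 1 -> rg 7 = 1 ->
  mem_ok x y L [::] (fun=> 0) (fun=> 0) A ->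
  UB t [:: While (Reg 7) loop_body; output_cmd] rg A u (u + (2 * cb + co)) (payoff t x).
Proof.
elim: t rg A x y L u => [|t IH] rg A x y L u bs r5 r6 r7 ok.
  apply: UB_0 => //; rewrite [payoff 0 x]/= addr0 ler_wpM2l //.
  by rewrite ler_nat leq_addr.
apply: (UB_while lam_ge0 F_ge0 enough_words) => //=; rewrite r7 /= /loop_body; u_seq.
pose h1 (_ : coloring) := phi x.
pose g (q : coloring * bounds) := ((coalesced q.2)%:R * (h1 q.1 - lam * cb%:R) +
  (~~ coalesced q.2)%:R * (payoff t q.1 + lam * cb%:R))%R.
apply: (UB_call (g := g) lam_ge0 (spec_run_block lam_ge0 F_ge0 enough_words lt_D c00 num_sweeps_small bs r5 ok)).
  apply: le_trans (block_drift x _ _ _) _; first by rewrite mulr_ge0.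
  rewrite lerD2r /block_mean /h1; under eq_expect do rewrite mulrC.
  by rewrite expectZ mulrC -/(bmean x _) block_coalesced.
move=> q rg1 A1 [fr1 r36 ok1].
have bs1 := base_frame (T := iota 8 29) isT fr1 bs.
have r6_1 : rg1 6 = 1 by rewrite fr1.
u_if; rewrite r36 /g; case: (coalesced q.2); rewrite /= mul1r mul0r ?addr0 ?add0r.
  u_if; rewrite r6_1 /=; u_move; first exact: operand_ok_lt8 enough_words _ _.
  apply: (UB_while lam_ge0 F_ge0 enough_words) => //=.
  apply: (UB_rebase (d := cb) (d' := 0)) (@UB_output _ _ _ x _ _ _) => //.
  - by move: (block_cost k e T) => bc; clear; lia.
  - by rewrite /h1 mulr0 addr0 subrK.
  by case: ok1 => _ h _ _ _ v; have [_ ->] := h v.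
u_skip; apply: (UB_rebase (d := 0) (d' := cb)) (IH _ _ _ _ _ _ bs1 _ _ _ ok1); rewrite ?fr1 //.
  by move: (block_cost k e T) => bc; clear; lia.
by rewrite mulr0 addr0.
Qed.

(** Two coalescences are awaited, hence 4 [cb]. As for the reward, the coalescing part of a block is
    worth at most p * mean by [block_payoff], and the rest (1 - p) * mean by induction; the sum is
    the mean over proper colourings, whatever x is. *)
Lemma UB_loop0 t rg A (x y : coloring) (L : bounds) u :
  base rg -> rg 5 = T -> rg 6 = 0 -> rg 7 = 1 ->
  mem_ok x y L [::] (fun=> 0) (fun=> 0) A ->
  UB t [:: While (Reg 7) loop_body; output_cmd] rg A u (u + (4 * cb + co)) mean.
Proof.
elim: t rg A x y L u => [|t IH] rg A x y L u bs r5 r6 r7 ok.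
  apply: UB_0 => //; apply: (@le_trans _ _ (lam * (u + (4 * cb + co))%:R)%R).
    by rewrite ler_wpM2l // ler_nat leq_addr.
  by rewrite lerDl uniform_mean_ge0.
apply: (UB_while lam_ge0 F_ge0 enough_words) => //=; rewrite r7 /= /loop_body; u_seq.
pose h2 (_ : coloring) := mean.
pose g (q : coloring * bounds) := ((coalesced q.2)%:R * (payoff t q.1 - lam * cb%:R) +
  (~~ coalesced q.2)%:R * (h2 q.1 + lam * cb%:R))%R.
apply: (UB_call (g := g) lam_ge0 (spec_run_block lam_ge0 F_ge0 enough_words lt_D c00 num_sweeps_small bs r5 ok)).
  apply: le_trans (block_drift x _ _ _) _; first by rewrite mulr_ge0.
  have -> : bmean x (fun q => (~~ coalesced q.2)%:R * h2 q.1)%R =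
      ((1 - coalescence e R T L0) * mean)%R.
    rewrite /block_mean /h2; under eq_expect do rewrite mulrC.
    by rewrite expectZ mulrC -/(bmean x _) block_not_coalesced.
  have := block_payoff sym_e irr_e lt_D T L0 phi_ge0 x t.
  by move: (coalescence _ _ _ _) (mean) => p m; lra.
move=> q rg1 A1 [fr1 r36 ok1].
have bs1 := base_frame (T := iota 8 29) isT fr1 bs.
have r6_1 : rg1 6 = 0 by rewrite fr1.
u_if; rewrite r36 /g; case: (coalesced q.2); rewrite /= mul1r mul0r ?addr0 ?add0r.
  u_if; rewrite r6_1 /=; u_move; first exact: operand_ok_lt8 enough_words _ _.
  apply: (UB_rebase (d := cb) (d' := 0)) (@UB_loop1 _ _ _ q.1 _ _ _ _ _ _ _ ok1) => //=; rewrite ?fr1 //.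
    by move: (block_cost k e T) => bc; clear; lia.
  by rewrite mulr0 addr0 subrK.
u_skip; apply: (UB_rebase (d := 0) (d' := cb)) (IH _ _ _ _ _ _ bs1 _ _ _ ok1); rewrite ?fr1 //.
  by move: (block_cost k e T) => bc; clear; lia.
by rewrite mulr0 addr0.
Qed.

Definition main_cost : nat := 4 * cb + n * 80 + 60.

Lemma value_main t : (value w lam F t (init main e k) <= lam * main_cost%:R + mean)%R.
Proof.
(* Beyond the input the memory is zero, so the working arrays start empty and the initial colouring
   is constant. *)
pose A a j := if a == 7 then nth 0 (encode e k) j else 0.
have lowA : low k e A by [].
have [nB BM] : n + 3 <= B /\ B < 2 ^ w.
  by split; [exact: n_lt_B|apply: (word_small enough_words); rewrite -addnA leq_addr].
have k_gt0 : 0 < k by apply: leq_ltn_trans lt_D.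
suff : UB t [:: main] (fun=> 0) A 0 main_cost mean.
  move=> /(_ (fun=> 0) (nth 0 (encode e k))) H.
  have {H} := H _ t (leqnn t); rewrite mulr0 addr0; apply; split=> // a j lt_a _.
  by rewrite /A ltn_eqF // nth_default // size_encode -addnA leq_addr.
rewrite /main {1}/block; u_seq; apply: (UB_read lam_ge0 F_ge0 enough_words) => //=; first by clear -nB; lia.
u_seq; apply: (UB_read lam_ge0 F_ge0 enough_words) => //=; first by clear -nB; lia.
rewrite !lowA; try by clear -nB; lia.
rewrite encode_n encode_k.
u_seq; u_op; first by apply: leq_ltn_trans BM; clear -nB; lia.
u_seq; apply: (UB_read lam_ge0 F_ge0 enough_words) => //=; first by clear -nB; lia.
rewrite (low_pointer lowA (leqnn n)); set rg1 := upd _ 1 B.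
u_seq; apply: (UB_callR lam_ge0 (spec_degree (erefl (rg1 2)) lowA)) => rg2 A2 [fr2 r4 ->] {A2}.
have bs2 : base rg2 by split; first [exact: r4|by rewrite fr2].
u_seq; apply: (UB_callR lam_ge0 (spec_num_sweeps bs2)) => rg3 A3 [fr3 r5 ->] {A3}.
u_seq; u_move; first exact: operand_ok_lt8 enough_words _ _.
u_seq; u_move; first exact: operand_ok_lt8 enough_words _ _.
set rg4 := upd _ 7 1.
have bs4 : base rg4.
  have fr4 : frame [:: 5; 6; 7; 17; 28; 29] rg2 rg4.
    by do 2 apply: frame_upd => //; apply: frame_sub fr3; apply/allP.
  exact: (base_frame (T := [:: 5; 6; 7; 17; 28; 29]) isT fr4 bs2).
(* The constant initial colouring is in general improper. This is allowed: consistency with the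
   bounds holds from every start, and properness enters only through the average in
   [block_payoff]. *)
u_seq; apply: (UB_rebase (d := 0) (d' := 0)) (@UB_loop0 t _ _ [ffun=> c0] [ffun=> c0] L0 _ bs4 _ _ _ _) => //; last first.
  by split=> // v; rewrite !ffunE /= /A c00.
have le_ln : up_log 2 n <= n.
  by rewrite up_log_min // ltnW // ltn_expl.
by rewrite /main_cost; move: (block_cost k e T) le_ln => bc; clear; lia.
Qed.

End Main.

(** * Running time *)

Section Correctness.
Variables (n k w : nat) (e : rel 'I_n).
Hypotheses (sym_e : symmetric e) (irr_e : irreflexive e) (lt_D : 3 * max_degree e < k).
Hypothesis bits_e : enough_bits 6 n k w.

Local Notation coloring := {ffun 'I_n -> 'I_k}.

(** The exponent 6 splits as 4 + 2: since k > 0, the fourth power is at least 3^4 = 81 > 20, and a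
    square covers the memory and the number of sweeps. *)
Lemma enough_bits_square x : x <= 20 * (n + k + 2) ^ 2 -> x < 2 ^ w.
Proof.
move=> le_x; apply: leq_trans bits_e; rewrite (expnD _ 4 2).
apply: leq_ltn_trans le_x _; rewrite ltn_pmul2r ?expn_gt0; last by rewrite addn2.
have k_gt0 : 0 < k by apply: leq_ltn_trans lt_D.
by apply: (@leq_trans (3 ^ 4)) => //; rewrite leq_exp2r // -(addnC 2) (leq_add2l 2 1) addn_gt0 k_gt0 orbT.
Qed.

Lemma enough_words_of_bits : pointer e n + 8 * (n + k + 1) + 8 < 2 ^ w.
Proof.
apply: enough_bits_square; have := pointer_le e (leqnn n).
by move: (pointer e n) => B; clear; nia.
Qed.

Lemma up_log_le_self m : up_log 2 m <= m.
Proof. by rewrite up_log_min // ltnW // ltn_expl. Qed.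

Lemma num_sweeps_of_bits : num_sweeps e < 2 ^ w.
Proof.
apply: enough_bits_square; rewrite /num_sweeps.
have le_l := up_log_le_self n.
apply: (@leq_trans (k * n.+1)); last by clear; nia.
by rewrite leq_mul //; move: lt_D; clear; lia.
Qed.

Variables (R : realType) (d : measure_display) (Omega : measurableType d).
Variables (P : probability Omega R) (coin : nat -> {RV P >-> bool}).
Hypothesis fair : fair_coins coin.

Lemma k_pos : 0 < k. Proof. exact: leq_ltn_trans lt_D. Qed.

Lemma value_main_time t :
  (value w 1 (fun=> 0) t (init main e k) <= (main_cost k e)%:R :> R)%R.
Proof.
have h := value_main (F := fun=> 0%R) (phi := fun=> 0%R) (@ler01 R) (fun=> lexx _) enough_words_of_bits
  sym_e irr_e lt_D num_sweeps_of_bits (fun=> lexx _) (fun _ _ _ => lexx _)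
  (erefl : Ordinal k_pos = 0 :> nat) t.
apply: le_trans h _; rewrite mul1r /uniform_mean big1 // mul0r addr0 //.
Qed.

Lemma main_correct : samples_uniformly coin main w e k /\
  (expected_time coin main w e k <= (main_cost k e)%:R%:E)%E.
Proof.
split; last exact: (expected_time_le fair value_main_time erefl).
have main_le (F : state -> R) (phi : coloring -> R) (F_ge0 : forall s, (0 <= F s)%R)
    (phi_ge0 : forall x, (0 <= phi x)%R)
    (F_le : forall s (x : coloring), (forall v : 'I_n, memory s v = x v :> nat) -> (F s <= phi x)%R) t :
    (value w 0 F t (init main e k) <= uniform_mean e phi)%R.
  have := value_main (lexx _) F_ge0 enough_words_of_bits
    sym_e irr_e lt_D num_sweeps_of_bits phi_ge0 F_le
    (erefl : Ordinal k_pos = 0 :> nat) t.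
  by rewrite mul0r add0r.
apply: (samples_uniformly_of_bounds fair value_main_time erefl) => [chi chiP t|t].
  apply: le_trans (main_le _ (fun x => (x == chi)%:R%R) _ _ _ t) _ => // [s x xE|].
    rewrite ler_nat; case: (boolP [forall v, _]) => // /forallP h.
    by rewrite (_ : x == chi) //; apply/eqP/ffunP => v; apply: val_inj; rewrite /= -xE; exact/eqP.
  rewrite /uniform_mean (bigD1 chi) //= eqxx big1 ?addr0 ?mul1r // => x /andP[_ /negPf ->].
  by [].
(* The indicator of improper colourings has mean 0 over proper ones, just as the indicator of [chi]
   above has mean 1/N. *)
apply: le_trans (main_le _ (fun x => (~~ proper_coloring e x)%:R%R) _ _ _ t) _ => // [s x xE|].
  rewrite ler_nat; case: (boolP (proper_coloring e x)) => [xP|_]; last by case: (~~ _).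
  rewrite (_ : [exists chi, _]) //; apply/existsP; exists x; rewrite xP.
  by apply/forallP => v; rewrite xE.
by rewrite /uniform_mean big1 ?mul0r // => x ->.
Qed.

(** With N = n + k + 1, the five factors n + 1, 2D + 1, log n + 1, D + 1 and log k + 1 of the
    dominant term are each at most N. *)
Lemma main_cost_poly :
  main_cost k e <= (8 * 2000 + 180) * (n + k + 1) ^ 5.
Proof.
rewrite /main_cost /block_cost /num_sweeps; set N := n + k + 1.
have le_l := up_log_le_self n; have le_k := up_log_le_self k.
have N_gt0 : 0 < N by rewrite /N addn1.
have hn : n.+1 <= N by rewrite /N addn1 ltnS leq_addr.
have hD : (max_degree e).+1 <= N by move: lt_D; rewrite /N; clear; lia.
have hD2 : (2 * max_degree e).+1 <= N by move: lt_D; rewrite /N; clear; lia.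
have hl : (up_log 2 n).+1 <= N by apply: leq_trans hn; rewrite ltnS.
have hk : (up_log 2 k).+1 <= N by rewrite /N; move: le_k; clear; lia.
have hT := leq_mul hD2 hl.
have hT2 : (max_degree e).+1 + (2 * max_degree e).+1 * (up_log 2 n).+1 <= 2 * N ^ 2.
  by apply: leq_trans (leq_add hD hT) _; rewrite -mulnn mul2n -addnn leq_add2r leq_pmulr.
have hb := leq_mul hn (leq_mul hT2 (leq_mul hD hk)).
have hN : N <= N ^ 5 by rewrite -[X in X <= _]expn1 leq_pexp2l.
have e5 : N * (2 * N ^ 2 * (N * N)) = 2 * N ^ 5.
  by rewrite !expnS expn0; clear; nia.
rewrite e5 in hb.
have hn' : n <= N ^ 5 by apply: leq_trans hN; apply: ltnW.
have h1 : 1 <= N ^ 5 by rewrite expn_gt0 N_gt0.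
move: (n.+1 * _) (N ^ 5) hb hn' h1 => b X; move: 2000 => C; clear; nia.
Qed.

(** * Comparison of the cost with the stated time bound *)

Local Open Scope ring_scope.

(** The inequality exp(-1/2) >= 1 - 1/2 gives exp(1/2) <= 2. *)
Lemma ln2_ge : 2^-1 <= ln 2 :> R.
Proof.
rewrite -(expRK 2^-1) ler_ln ?posrE ?expR_gt0 //.
have : 1 + - 2^-1 <= expR (- 2^-1) :> R by exact: expR_ge1Dx.
rewrite expRN => h; rewrite -[leLHS]invrK -[leRHS]invrK.
by rewrite lef_pV2 ?posrE ?invr_gt0 ?expR_gt0 //; lra.
Qed.

Lemma lg_ge m : 2^-1 <= lg R m.
Proof.
apply: le_trans ln2_ge _; rewrite /lg ler_ln ?posrE ?ltr0n ?leq_max ?orbT //.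
by rewrite ler_nat leq_maxr.
Qed.

(** If the rounded logarithm is l + 1, then 2^l < m gives l <= 2 lg m, and the remaining 2 is at
    most 4 lg m. *)
Lemma up_log_lg m : (up_log 2 m).+1%:R <= 6 * lg R m.
Proof.
have h2 := ln2_ge; have hm := lg_ge m.
have [->|] := posnP (up_log 2 m); first by rewrite (_ : 1%:R = 1) //; lra.
case E : (up_log 2 m) => [//|l] _.
have m2 : (2 ^ l < m)%N.
  rewrite ltnNge; apply/negP => /(up_log_min (isT : 1 < 2)%N).
  by rewrite E ltnn.
have : l%:R * ln 2 <= lg R m.
  rewrite /lg mulr_natl -lnXn // ler_ln ?posrE ?exprn_gt0 // ?ltr0n ?leq_max ?orbT //.
  by rewrite -natrX ler_nat leq_max (ltnW m2).
have l0 : 0 <= l%:R :> R by [].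
have : l%:R * 2^-1 <= l%:R * ln 2 :> R by rewrite ler_wpM2l.
by rewrite -[l.+2]addn2 natrD; lra.
Qed.

Lemma main_cost_time :
  (main_cost k e)%:R <= (100 * 100 * (100 * 100))%:R * time_bound R n (max_degree e) k.
Proof.
rewrite /main_cost /block_cost /num_sweeps /time_bound.
set D := max_degree e.
have h2000 : 2000%:R <= 2 * 1000 :> R by rewrite -natrM ler_nat.
move: (2000)%N h2000 => C hC.
set n1 := (maxn n 1)%:R : R; set D1 := (maxn D 1)%:R : R.
have hn1 : n.+1%:R <= 2 * n1 by rewrite /n1 -natrM ler_nat; clear; lia.
have hn : n%:R <= n1 by rewrite /n1 ler_nat leq_maxl.
have n1_ge1 : 1 <= n1 by rewrite /n1 ler1n leq_maxr.
have hD : D.+1%:R <= 2 * D1 by rewrite /D1 -natrM ler_nat; clear; lia.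
have hD2 : (2 * D).+1%:R <= 3 * D1 by rewrite /D1 -natrM ler_nat; clear; lia.
have D1_ge1 : 1 <= D1 by rewrite /D1 ler1n leq_maxr.
have hl := up_log_lg n; have hk := up_log_lg k.
have ha := lg_ge n; have hb := lg_ge D; have hc := lg_ge k.
move: (lg R n) (lg R D) (lg R k) hl hk ha hb hc => a b c hl hk ha hb hc.
set T := ((2 * D).+1 * _)%N.
have hT : (D.+1 + T)%:R <= 22 * (a * D1).
  have : T%:R <= 3 * D1 * (6 * a) by rewrite natrM ler_pM.
  have : D1 * 2^-1 <= D1 * a by rewrite ler_wpM2l // (le_trans _ D1_ge1).
  by rewrite natrD; lra.
have hblock : (n.+1 * ((D.+1 + T) * (D.+1 * (up_log 2 k).+1)))%:R <=
    2 * n1 * (22 * (a * D1) * (2 * D1 * (6 * c))) :> R.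
  by rewrite !natrM !ler_pM // ?mulr_ge0.
move: (n.+1 * _)%N hblock => M hM.
have D2_ge1 : 1 <= D1 ^+ 2 by rewrite exprn_ege1.
have pos x : 2^-1 <= x :> R -> 0 <= x by apply: le_trans; rewrite invr_ge0.
have [a0 b0 c0] := And3 (pos _ ha) (pos _ hb) (pos _ hc).
(* The cost contains lg n and lg k once, the bound also a second lg n and lg Delta. Each is at least
   1/2, so the surplus factor is paid for by 4. *)
have ab : 1 <= 4 * (a * b).
  have : 2^-1 * 2^-1 <= a * b by rewrite ler_pM // invr_ge0.
  by lra.
have ac : 1 <= 4 * (a * c).
  have : 2^-1 * 2^-1 <= a * c by rewrite ler_pM // invr_ge0.
  by lra.
have n1_ge0 : 0 <= n1 by exact: le_trans n1_ge1.
set tb := n1 * a ^+ 2 * _.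
have X_le : n1 * (D1 ^+ 2 * (a * c)) <= 4 * tb.
  have -> : 4 * tb = n1 * (D1 ^+ 2 * (a * c)) * (4 * (a * b)) by rewrite /tb; ring.
  by rewrite ler_peMr // !mulr_ge0 // exprn_ge0 // (le_trans _ D1_ge1).
have n1_le : n1 <= 16 * tb.
  apply: (@le_trans _ _ (4 * (n1 * (D1 ^+ 2 * (a * c))))); last by lra.
  have -> : 4 * (n1 * (D1 ^+ 2 * (a * c))) = n1 * (D1 ^+ 2 * (4 * (a * c))) by ring.
  by rewrite ler_peMr // (le_trans D2_ge1) // ler_peMr // (le_trans _ D2_ge1).
have hCM : (C * M)%:R <= 2 * 1000 * (2 * n1 * (22 * (a * D1) * (2 * D1 * (6 * c)))).
  by rewrite natrM ler_pM.
have E : 2 * n1 * (22 * (a * D1) * (2 * D1 * (6 * c))) = 528 * (n1 * (D1 ^+ 2 * (a * c))) by ring.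
rewrite E in hCM.
rewrite (natrM _ (100 * 100)) !(natrM _ 100) 2!natrD !(natrM _ 4) (natrM _ n) natrD.
lra.
Qed.

End Correctness.

Local Open Scope ring_scope.

Theorem theorem1p1 :
  (exists (prog : cmd) (c C : nat),
     perfect_sampler prog c
       (fun n e k => (3 * max_degree e < k)%N)
       (fun R n e k => C%:R * time_bound R n (max_degree e) k)) /\
  (forall Delta : nat, exists2 k0 : nat, is_k0 Delta k0 & (k0 <= 3 * Delta)%N).
Proof.
split.
  exists main, 6, (100 * 100 * (100 * 100))%N.
  move=> n e k w sym_e irr_e lt_D bits R d Omega P coin fair.
  have [unif time] := main_correct sym_e irr_e lt_D bits fair; split=> //.
  by apply: le_trans time _; rewrite lee_fin; exact: main_cost_time.
(* The minimum defining k_0 exists because 3 Delta is admissible; the property is made boolean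
   classically to use the least-number principle. *)
move=> Delta; pose p k' := `[< poly_sampleable Delta k' >].
have pDelta : p (3 * Delta)%N.
  apply/asboolP; exists main, 6, (8 * 2000 + 180)%N, 5.
  move=> n e k w sym_e irr_e [DeltaE lt_k] bits R d Omega P coin fair.
  have lt_D : (3 * max_degree e < k)%N by rewrite DeltaE.
  have [unif time] := main_correct sym_e irr_e lt_D bits fair; split=> //.
  by apply: le_trans time _; rewrite lee_fin ler_nat; exact: main_cost_poly.
have ex_p : exists k', p k' by exists (3 * Delta)%N.
exists (ex_minn ex_p); case: ex_minnP => k0 pk0 min_k0; last exact: min_k0.
split=> [|k' pk']; first exact/asboolP.
by apply: min_k0; exact/asboolP.
Qed.
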